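(* Let $T:[0,1]\to[0,1]$ be a uniformly expanding full-branch Markov map with constants $\gamma>1$ and $G>0$ and with invariant probability measure $m_0$, as described in the context, and let $f:[0,1]\to\mathbb{R}$ be Lipschitz with respect to $d$ with $\mathbb{E}[f]=\int f\,dm_0=0$. Let $S_nf=\sum_{k=0}^{n-1}f\circ T^k$ and $\sigma^2=\lim_{n\to\infty}\frac1n\mathbb{E}[(S_nf)^2]$, and assume $\sigma>0$. Then for all $x\in\mathbb{R}$ and all $n\ge 1$, $$\left|m_0\left(\frac{S_nf}{\sigma\sqrt n}\le x\right)-\frac1{\sqrt{2\pi}}\int_{-\infty}^x e^{-t^2/2}\,dt\right|\le C\,\frac{\cosh^6(D_{\mathbb{R}}/4)\,\|f\|_\infty\,(\|f\|_\infty+|f|_\ell)^2}{\sigma^3\sqrt n},$$ where $C=11460$ and $$D_{\mathbb{R}}=\frac{2(\gamma^2G+1)}{\gamma(\gamma-1)}+2\log\frac{2\gamma^2G+\gamma+1}{\gamma-1}.$$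
   Context: Setting. $X=[0,1]$, and $d$ is a metric on $X$ compatible with the usual topology, with $d(x,y)\le 1$ for all $x,y$. For $u:X\to\mathbb{C}$, $|u|_\ell=\sup_{x\ne y}|u(x)-u(y)|/d(x,y)$ and $\|u\|_\infty=\sup_X|u|$. The map $T:X\to X$: there is a finite or countable family of disjoint open intervals $(a_j,b_j)$, $j\in J$, such that $X=S\cup\bigcup_j(a_j,b_j)$ with $S$ at most countable (or of zero Lebesgue measure). On each $(a_j,b_j)$, $T$ is differentiable with non-vanishing derivative, strictly monotonic, and maps $(a_j,b_j)$ onto $(0,1)$; $\sigma_j:[0,1]\to[a_j,b_j]$ denotes the (continuously extended) inverse of $T|_{(a_j,b_j)}$. Put $g=-\log|T'|$ on $\bigcup_j(a_j,b_j)$; the values of $g$ at endpoints are immaterial ($g\circ\sigma_j$ is understood as the continuous extension to $[0,1]$ of this function on $(0,1)$). Assumptions: (A1) there is $\gamma>1$ with $d(\sigma_jx,\sigma_jy)\le\gamma^{-1}d(x,y)$ for all $x,y\in X$, $j\in J$; (A2) there is $0<G<\infty$ with $\sup_j|g\circ\sigma_j|_\ell\le G$; (A3) $\sup_{x\in X}\sum_j\exp(g(\sigma_jx))<\infty$. Transfer operator: $\mathcal{L}u(x)=\sum_{j\in J}e^{g(\sigma_jx)}u(\sigma_jx)$, acting on Lipschitz functions. It is known that there is a unique Lipschitz function $h_0>0$ with $\mathcal{L}h_0=h_0$ and $\int_0^1h_0(x)\,dx=1$; the measure $dm_0=h_0\,dx$ is a mixing $T$-invariant probability measure (the Gibbs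 measure), and $\mathbb{E}$ denotes expectation with respect to $m_0$. For Lipschitz $f$ with $\mathbb{E}[f]=0$ the limit defining $\sigma^2$ exists; $\sigma\ge 0$ is its square root. *)

(* Defs.v *)
From HB Require Import structures.
From mathcomp Require Import all_boot all_order all_algebra.
From mathcomp Require Import all_classical all_reals all_analysis.

Set Implicit Arguments.
Unset Strict Implicit.
Unset Printing Implicit Defensive.

Import Order.TTheory GRing.Theory Num.Theory.
Import numFieldNormedType.Exports.

Local Open Scope classical_set_scope.
Local Open Scope ring_scope.

(* The space X is the subset `[0, 1] of R.  Functions on X are total functions
   on R of which only the values on `[0, 1] are ever used. *)

Record compatible_metric (R : realType) (d : R -> R -> R) : Prop := {
  dist_bounds : {in `[0, 1] &, forall x y, 0 <= d x y <= 1} ;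
  dist_eq0 : {in `[0, 1] &, forall x y, d x y = 0 <-> x = y} ;
  dist_sym : {in `[0, 1] &, forall x y, d x y = d y x} ;
  dist_triangle :
    {in `[0, 1] & &, forall x y z, d x z <= d x y + d y z} ;
  dist_topology : forall A : set R, A `<=` `[0, 1] ->
    (forall x, A x -> exists2 e : R, 0 < e &
       forall y, y \in `[0, 1] -> d x y < e -> A y) <->
    (exists2 U : set R, open U & A = `[0, 1] `&` U) }.

Definition lip_seminorm (R : realType) (d : R -> R -> R) (u : R -> R) : \bar R :=
  ereal_sup [set e | exists x y : R,
    [/\ x \in `[0, 1], y \in `[0, 1], x != y &
        e = (`|u x - u y| / d x y)%:E]].

Definition is_lipschitz (R : realType) (d : R -> R -> R) (u : R -> R) : Prop :=
  (lip_seminorm d u < +oo)%E.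

Definition sup_norm (R : realType) (u : R -> R) : \bar R :=
  ereal_sup [set `|u x|%:E | x in `[0, 1]].

(* [sigma j] is the continuous extension to `[0, 1] of the inverse of T on the
   j-th interval, and [gs j] is the continuous extension to `[0, 1] of
   g \o sigma j, where g = - log |T'|.  The latter is a datum of its own since g
   may have different limits on the two sides of a common endpoint of two
   intervals. *)
Record full_branch_map (R : realType) (J : countType) (T : R -> R)
    (a b : J -> R) (sigma gs : J -> R -> R) : Prop := {
  map_unit : {homo T : x / x \in `[0, 1]} ;
  branch_cover : exists2 S : set R,
    countable S \/ (@lebesgue_measure R).-negligible S &
    `[0, 1]%classic = S `|` \bigcup_j `]a j, b j[%classic ;
  branch_disjoint : trivIset [set: J] (fun j => `]a j, b j[%classic) ;
  branch_derivable : forall j, {in `]a j, b j[, forall x : R, derivable T x 1} ;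
  branch_derive_neq0 : forall j, {in `]a j, b j[, forall x, derive1 T x != 0} ;
  branch_monotone : forall j,
    {in `]a j, b j[ &, {homo T : x y / x < y}} \/
    {in `]a j, b j[ &, {homo T : x y /~ x < y}} ;
  branch_onto : forall j, T @` `]a j, b j[ = `]0, 1[%classic ;
  inverse_branch : forall j, {in `]a j, b j[, cancel T (sigma j)} ;
  inverse_branch_continuous : forall j, {within `[0, 1], continuous (sigma j)} ;
  potential_branch : forall j,
    {in `]0, 1[, forall y, gs j y = - ln `|derive1 T (sigma j y)|} ;
  potential_branch_continuous : forall j, {within `[0, 1], continuous (gs j)} }.

Record expanding_assumptions (R : realType) (J : countType) (d : R -> R -> R)
    (sigma gs : J -> R -> R) (gamma G : R) : Prop := {
  gamma_gt1 : 1 < gamma ;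
  G_gt0 : 0 < G ;
  branch_contraction : forall j, {in `[0, 1] &, forall x y,
    d (sigma j x) (sigma j y) <= gamma^-1 * d x y} ;
  potential_lipschitz :
    (ereal_sup [set lip_seminorm d (gs j) | j in [set: J]] <= G%:E)%E ;
  potential_summable :
    (ereal_sup [set \esum_(j in [set: J]) (expR (gs j x))%:E | x in `[0%R, 1%R]]
       < +oo)%E }.

(* [esum] is meant for nonnegative families: the positive and negative parts of
   the terms are summed separately. *)
Definition transfer (R : realType) (J : countType) (sigma gs : J -> R -> R)
    (u : R -> R) (x : R) : \bar R :=
  let t := fun j : J => (expR (gs j x) * u (sigma j x))%:E in
  (\esum_(j in [set: J]) t^\+ j - \esum_(j in [set: J]) t^\- j)%E.

Record gibbs_density (R : realType) (J : countType) (d : R -> R -> R)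
    (sigma gs : J -> R -> R) (h0 : R -> R) : Prop := {
  density_lipschitz : is_lipschitz d h0 ;
  density_gt0 : {in `[0, 1], forall x, 0 < h0 x} ;
  density_fixed : {in `[0, 1], forall x, transfer sigma gs h0 x = (h0 x)%:E} ;
  density_mass :
    (\int[@lebesgue_measure R]_(x in `[0%R, 1%R]) (h0 x)%:E = 1)%E }.

(* The measure dm_0 = h0 dx and the expectation for it.  Since T is arbitrary on
   a null set, sets and functions built from T are in general Lebesgue
   measurable but not Borel measurable.  The integral of a nonnegative function
   being a supremum over Borel simple functions below it, it agrees with the
   integral for the completed measure on Lebesgue measurable functions. *)
Definition gibbs_measure (R : realType) (h0 : R -> R) (A : set R) : \bar R :=
  (\int[@lebesgue_measure R]_(x in `[0%R, 1%R] `&` A) (h0 x)%:E)%E.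

Definition gibbs_expectation (R : realType) (h0 u : R -> R) : \bar R :=
  (\int[@lebesgue_measure R]_(x in `[0%R, 1%R]) (u x * h0 x)%:E)%E.

Definition birkhoff_sum (R : realType) (T f : R -> R) (n : nat) (x : R) : R :=
  \sum_(0 <= k < n) f (iter k T x).

Definition std_normal_cdf (R : realType) (x : R) : R :=
  (Num.sqrt (2 * pi))^-1 *
  \int[@lebesgue_measure R]_(t in `]-oo, x]) expR (- (t ^+ 2) / 2).

Definition cosh (R : realType) (x : R) : R := (expR x + expR (- x)) / 2.

Definition D_R (R : realType) (gamma G : R) : R :=
  2 * (gamma ^+ 2 * G + 1) / (gamma * (gamma - 1)) +
  2 * ln ((2 * gamma ^+ 2 * G + gamma + 1) / (gamma - 1)).

(* Main.v *)
(** On the cone of positive functions u with u(x) <= exp(a d(x, y)) u(y), the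
    transfer operator L contracts Hilbert's projective metric at a rate given
    by the projective diameter D_R.  Hence L contracts the seminorm measuring
    the oscillation of u relative to h0 for the order of the cone, and, extended
    to complex functions, this makes every iterate of u |-> L(exp(i t f) u) on
    h0, once normalized to integral 1, stay within oscillation O(t) of h0; no
    eigenfunction of the twisted operator is needed.  The normalization factors
    are 1 - sigma_m^2 t^2 / 2 + O(t^3), where sigma_m^2 -> sigma^2 geometrically,
    and their product is the characteristic function of S_n f under m_0.
    Esseen's smoothing inequality, with the Fejer kernel, then gives the bound,
    with room to spare in the constant. *)
Require Import Defs.
From HB Require Import structures.
From mathcomp Require Import all_boot all_order all_algebra.
From mathcomp Require Import all_classical all_reals all_analysis.
From mathcomp Require Import measurable_realfun ring lra complex.

Set Implicit Arguments.
Unset Strict Implicit.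
Unset Printing Implicit Defensive.

Import Order.TTheory GRing.Theory Num.Theory.
Import numFieldNormedType.Exports.
Local Open Scope classical_set_scope.
Local Open Scope ring_scope.

(** * Projective contraction on cones of log-Lipschitz functions *)

(** With [Q = exp(D_R/2)] the contraction rate is [eta = tanh(D_R/4) = (Q-1)/(Q+1)]. Multiplication
    by [exp(i t f)] does not preserve a cone, so several apertures are needed: with [b = a + 1], the
    operator sends aperture [b] to [a] and [a] to [a1]. The room between [b] and the aperture [a0]
    of [h0] absorbs the multiplier; the room between [a] and [a1] gives a finite diameter. Errors
    then add up along geometric series of sum [A = B / (1 - eta)], where [B] is the larger of [2]
    and [1 + 2 G], and the final estimate is proportional to [A^2]. The inequality
    [B^2 Q^3 <= (Q+1)^4] turns this into [A^2 <= 16 cosh^6(D_R/4)]: of the three powers of [Q] in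
    [cosh^6], two pay for the gap [1 - eta] and one for the distortion. A second obstacle is
    measurability: [T] is unconstrained on a null set, so all computations use a Borel modification
    and are carried over to [T] off a null set of orbits. *)

Section Exponential.
Context {R : realType}.
Implicit Types s t u : R.

(** The bound [1 + x <= exp x] at [(1 - l) u] and at [- l u], weighted by [l] and [1 - l] so that
    the linear terms cancel. *)
Lemma expR_convex_0 (l u : R) : 0 <= l <= 1 ->
  expR (l * u) <= l * expR u + (1 - l).
Proof.
move=> /andP[l0 l1].
have h1 := expR_ge1Dx ((1 - l) * u); have h2 := expR_ge1Dx (- (l * u)).
have : 1 <= l * expR ((1 - l) * u) + (1 - l) * expR (- (l * u)) by nra.
rewrite -(ler_pM2l (expR_gt0 (l * u))) mulr1 => /le_trans; apply.
rewrite mulrDr mulrCA -expRD mulrCA -expRD subrr expR0 mulr1.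
by rewrite (_ : l * u + (1 - l) * u = u) //; ring.
Qed.

(** After division by [expR (a * t)] this is concavity of [1 - exp(-s)], at the fraction
    [(a - a1) / (a + a1)] of [s = (a + a1) t]. It is the source of the factor [(a + a1) / (a - a1)]
    in the projective diameter. *)
Lemma expR_cone_gap (a a1 t : R) : 0 <= a1 -> a1 < a -> 0 <= t ->
  (a - a1) / (a + a1) * (expR (a * t) - expR (- (a1 * t)))
    <= expR (a * t) - expR (a1 * t).
Proof.
move=> a10 a1a t0; have P0 : 0 < a + a1 by lra.
have := @expR_convex_0 ((a - a1) / (a + a1)) (- ((a + a1) * t)).
rewrite mulrN mulrA divfK ?gt_eqF// => H.
have {H} := H _; have -> : 0 <= (a - a1) / (a + a1) <= 1; last move=> /(_ isT).
  by apply/andP; split; [apply: divr_ge0; lra | rewrite ler_pdivrMr// mul1r; lra].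
rewrite -(ler_pM2l (expR_gt0 (a * t))) mulrDr mulrCA -!expRD.
rewrite (_ : a * t - (a - a1) * t = a1 * t); last by ring.
rewrite (_ : a * t - (a + a1) * t = - (a1 * t)); last by ring.
by move=> h; lra.
Qed.

Lemma expR_le_div (t : R) : 0 <= t <= 1 -> t <= 2 * (1 - expR (- t)).
Proof.
move=> /andP[t0 t1]; rewrite expRN.
have h := expR_ge1Dx t; have e0 := expR_gt0 t.
suff : (expR t)^-1 <= 1 - t / 2 by lra.
by rewrite -(ler_pM2l e0) divff ?gt_eqF//; nra.
Qed.

End Exponential.

Section Cone.
Context {R : realType}.
Variable d : R -> R -> R.
Local Notation X := (fun x : R => x \in `[0%R, 1%R]).

Definition dlip (u : R -> R) :=
  exists K, forall x y, X x -> X y -> `|u x - u y| <= K * d x y.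

(** No sign condition is imposed: nonnegativity follows from the inequality itself, see [cone_ge0],
    and the zero function belongs to the cone. *)
Definition cone (c : R) (v : R -> R) :=
  forall x y, X x -> X y -> v x <= expR (c * d x y) * v y.

Hypothesis d_ge0 : forall x y, X x -> X y -> 0 <= d x y.
Hypothesis d_le1 : forall x y, X x -> X y -> d x y <= 1.
Hypothesis d_sym : forall x y, X x -> X y -> d x y = d y x.
Hypothesis d_gt0 : 0 < d 0 1.

Let X0 : X 0. Proof. by rewrite /= in_itv/= lexx ler01. Qed.
Let X1 : X 1. Proof. by rewrite /= in_itv/= lexx ler01. Qed.

Lemma eq_cone (c : R) u v : (forall x, X x -> u x = v x) -> cone c u -> cone c v.
Proof. by move=> e h x y Hx Hy; rewrite -!e//; exact: h. Qed.

(** Between two points at positive distance, the inequality used in both directions gives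
    [v y <= exp(2 c d) v y], which excludes [v y < 0]. The pair [0], [1] is enough: the inequality
    from [0] carries the sign to every other point. *)
Lemma cone_ge0 (c : R) v x : 0 < c -> cone c v -> X x -> 0 <= v x.
Proof.
move=> c0 h Hx.
have pos y z : X y -> X z -> 0 < d y z -> 0 <= v y.
  move=> Hy Hz dyz; have := h _ _ Hy Hz.
  have := h _ _ Hz Hy; rewrite -(d_sym Hy Hz) -(ler_pM2l (expR_gt0 (c * d y z))).
  move=> h1 /le_trans/(_ h1); rewrite mulrA -expRD => h2.
  have : 1 + c * d y z *+ 2 <= expR (c * d y z + c * d y z).
    by rewrite -mulr2n; exact: expR_ge1Dx.
  have : 0 < c * d y z by rewrite mulr_gt0.
  by move=> e0 e1; rewrite leNgt; apply/negP => v0; nra.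
have v0 : 0 <= v 0 by exact: (pos 0 1).
have := h _ _ X0 Hx => /(le_trans v0); rewrite pmulr_rge0 ?expR_gt0//.
Qed.

Lemma cone_le (c c' : R) v : 0 < c -> c <= c' -> cone c v -> cone c' v.
Proof.
move=> c0 cc' h x y Hx Hy; apply: (le_trans (h x y Hx Hy)).
rewrite ler_wpM2r ?(cone_ge0 c0 h)// ler_expR.
by rewrite ler_wpM2r ?d_ge0.
Qed.

Lemma coneD (c : R) u v : cone c u -> cone c v -> cone c (fun x => u x + v x).
Proof. by move=> hu hv x y Hx Hy; rewrite mulrDr lerD ?hu ?hv. Qed.

Lemma coneZ (c k : R) v : 0 <= k -> cone c v -> cone c (fun x => k * v x).
Proof.
by move=> k0 h x y Hx Hy; rewrite [leRHS]mulrCA ler_wpM2l ?h.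
Qed.

Lemma cone_le_sup (c : R) v x y : 0 < c -> cone c v -> X x -> X y -> v x <= expR c * v y.
Proof.
move=> c0 h Hx Hy; apply: (le_trans (h x y Hx Hy)).
rewrite ler_wpM2r ?(cone_ge0 c0 h)// ler_expR.
by rewrite -[leRHS]mulr1 ler_wpM2l ?(ltW c0)// d_le1.
Qed.

Lemma cone_dlip (c : R) v : 0 < c -> cone c v -> dlip v.
Proof.
move=> c0 h; exists (c * expR c * (expR c * v 0)).
suff H x y : X x -> X y -> v x - v y <= c * expR c * (expR c * v 0) * d x y.
  move=> x y Hx Hy; rewrite ler_norml H// andbT lerNl opprB.
  by rewrite (d_sym Hx Hy) H.
move=> Hx Hy; have := h _ _ Hx Hy; have := cone_le_sup c0 h Hy X0.
have vy := cone_ge0 c0 h Hy.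
have e1 : expR (c * d x y) - 1 <= c * expR c * d x y.
  have d0 := d_ge0 Hx Hy; have d1 := d_le1 Hx Hy.
  have h1 := expR_ge1Dx (- (c * d x y)); rewrite expRN in h1.
  have e0 := expR_gt0 (c * d x y).
  have h2 : expR (c * d x y) <= expR c.
    by rewrite ler_expR; nra.
  have : expR (c * d x y) * (1 - c * d x y) <= 1.
    by rewrite -ler_pdivlMl// mulr1.
  have : 0 <= c * d x y by nra.
  by nra.
move=> h1 h2.
have c1 : 0 <= c * expR c * d x y.
  by rewrite !mulr_ge0 ?expR_ge0 ?d_ge0 ?(ltW c0).
have : (expR (c * d x y) - 1) * v y <= c * expR c * d x y * (expR c * v 0).
  by apply: ler_pM => //; rewrite subr_ge0 -expR0 ler_expR; rewrite mulr_ge0 ?d_ge0 ?(ltW c0).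
by lra.
Qed.

(** Turns the pointwise order [k w2 <= w1] into the cone order of the larger aperture [a], at the
    price of the factor [(a - a1) / (a + a1)]. This is why the cone [a1] has finite projective
    diameter in the cone [a]. *)
Lemma cone_sub (a a1 k : R) w1 w2 : 0 < a1 -> a1 < a -> 0 <= k ->
  cone a1 w1 -> cone a1 w2 -> (forall x, X x -> k * w2 x <= w1 x) ->
  cone a (fun x => w1 x - (a - a1) / (a + a1) * k * w2 x).
Proof.
move=> a10 a1a k0 h1 h2 h12 x y Hx Hy.
have p1 := h1 _ _ Hx Hy; have := h2 _ _ Hy Hx; rewrite (d_sym Hy Hx).
rewrite -(ler_pM2l (expR_gt0 (- (a1 * d x y)))) mulrA -expRD addNr expR0 mul1r => p2.
have p3 := h12 _ Hy.
have g := @expR_cone_gap R a a1 (d x y) (ltW a10) a1a (d_ge0 Hx Hy).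
set kk := (a - a1) / (a + a1) in g *.
have kk0 : 0 <= kk by rewrite /kk divr_ge0; lra.
have e2 : 0 <= expR (a * d x y) - expR (a1 * d x y).
  by rewrite subr_ge0 ler_expR ler_wpM2r ?d_ge0// ltW.
have w20 := cone_ge0 a10 h2 Hy.
have q1 : kk * k * (expR (- (a1 * d x y)) * w2 y) <= kk * k * w2 x.
  by apply: ler_wpM2l => //; exact: mulr_ge0.
have q2 : (kk * (expR (a * d x y) - expR (- (a1 * d x y)))) * (k * w2 y) <=
   (expR (a * d x y) - expR (a1 * d x y)) * w1 y.
  apply: (@le_trans _ _ ((expR (a * d x y) - expR (a1 * d x y)) * (k * w2 y))).
    by rewrite ler_wpM2r ?mulr_ge0.
  by rewrite ler_wpM2l.
by lra.
Qed.

Section Hopf.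
Variables (a0 a1 a : R) (h : R -> R).
Hypotheses (a0_gt0 : 0 < a0) (a0a1 : a0 <= a1) (a1a : a1 < a).
Hypothesis h_cone : cone a0 h.
Hypothesis h_gt0 : forall x, X x -> 0 < h x.
(** The exponential of half the diameter bound, so that [(Q - 1) / (Q + 1)] is Birkhoff's
    [tanh(diameter / 4)]. *)
Let Q := expR a1 * ((a + a1) / (a - a1)).

Let a1_gt0 : 0 < a1. Proof. exact: lt_le_trans a0a1. Qed.
Let a_gt0 : 0 < a. Proof. exact: lt_trans a1a. Qed.
Let Q1 : 1 <= Q.
Proof.
have e1 : 1 <= expR a1 by rewrite -expR0 ler_expR ltW.
have e2 : 1 <= (a + a1) / (a - a1).
  by rewrite ler_pdivlMr ?subr_gt0// mul1r; have := a1_gt0; lra.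
by rewrite /Q; nra.
Qed.

Let hc : cone a h. Proof. by apply: cone_le h_cone => //; exact: ltW (le_lt_trans a0a1 a1a). Qed.

(* Here al and be are the optimal constants in al w2 <= w1 and be w1 <= w2 for
   the order of the cone, up to the bound 1 / (al * be) <= Q^2 on the
   projective distance of w1 and w2. *)
Lemma hopf_contraction (r : R) (w1 w2 : R -> R) :
  cone a1 w1 -> cone a1 w2 -> (forall x, X x -> w1 x + w2 x = r * h x) ->
  exists m, cone a (fun x => w1 x - m * h x) /\
    cone a (fun x => (m + (Q - 1) / (Q + 1) * r) * h x - w1 x).
Proof.
move=> c1 c2 e12; have q1 := Q1.
have eta0 : 0 <= (Q - 1) / (Q + 1) by rewrite divr_ge0; lra.
have r0 : 0 <= r.
  have := e12 _ X0; have := cone_ge0 a1_gt0 c1 X0.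
  have := cone_ge0 a1_gt0 c2 X0; have := h_gt0 X0.
  by move=> ? ? ? e; rewrite -(pmulr_lge0 _ (h_gt0 X0)) -e; lra.
have zero w : cone a1 w -> w 0 = 0 -> forall x, X x -> w x = 0.
  move=> cw w0 x Hx; have := cone_le_sup a1_gt0 cw Hx X0.
  by rewrite w0 mulr0 => le0; apply/le_anti; rewrite le0 (cone_ge0 a1_gt0 cw).
(* A cone element vanishing at one point vanishes identically. These two degenerate cases are set
   apart because the ratio [w1 / w2] and its inverse are used below. *)
have [w10|w10] := eqVneq (w1 0) 0.
  have z1 := zero _ c1 w10; exists 0; split.
    apply: (@eq_cone _ (fun x => 0 * h x)); last by apply: coneZ.
    by move=> x Hx; rewrite z1//; ring.
  apply: (@eq_cone _ (fun x => ((Q - 1) / (Q + 1) * r) * h x)).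
    by move=> x Hx; rewrite z1//; ring.
  by apply: coneZ => //; rewrite mulr_ge0.
have [w20|w20] := eqVneq (w2 0) 0.
  have z2 := zero _ c2 w20.
  exists (r - (Q - 1) / (Q + 1) * r); split.
    apply: (@eq_cone _ (fun x => ((Q - 1) / (Q + 1) * r) * h x)).
      by move=> x Hx; have := e12 _ Hx; rewrite z2// addr0 => ->; ring.
    by apply: coneZ => //; rewrite mulr_ge0.
  apply: (@eq_cone _ (fun x => 0 * h x)); last by apply: coneZ.
  by move=> x Hx; have := e12 _ Hx; rewrite z2// addr0 => ->; ring.
have pos w : cone a1 w -> w 0 != 0 -> forall x, X x -> 0 < w x.
  move=> cw wn0 x Hx; rewrite -(pmulr_rgt0 _ (expR_gt0 a1)).
  apply: lt_le_trans (cone_le_sup a1_gt0 cw X0 Hx).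
  by rewrite lt_def wn0 (cone_ge0 a1_gt0 cw X0).
have {w10}w1p := pos _ c1 w10; have {w20}w2p := pos _ c2 w20.
have ratio x y : X x -> X y ->
    expR (- (a1 + a1)) * (w1 y / w2 y) <= w1 x / w2 x.
  move=> Hx Hy; have h1 := cone_le_sup a1_gt0 c1 Hy Hx.
  have h2 := cone_le_sup a1_gt0 c2 Hx Hy.
  rewrite mulrA ler_pdivrMr ?w2p// mulrAC ler_pdivlMr ?w2p// -mulrA.
  have ee : expR (- (a1 + a1)) * (expR a1 * expR a1) = 1.
    by rewrite -!expRD addNr expR0.
  rewrite -[leRHS]mul1r -ee -mulrA ler_pM2l ?expR_gt0// mulrACA.
  by rewrite ler_pM// ltW// ?w1p ?w2p.
pose E := [set w1 x / w2 x | x in [set x | X x]].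
pose al0 := inf E.
have E0 : E !=set0 by exists (w1 0 / w2 0); exists 0.
have lbE y : X y -> lbound E (expR (- (a1 + a1)) * (w1 y / w2 y)).
  by move=> Hy _ [x Hx <-]; exact: ratio.
have hE : has_inf E by split => //; eexists; exact: (lbE 0).
have al0P x : X x -> al0 * w2 x <= w1 x.
  move=> Hx; rewrite -ler_pdivlMr ?w2p//; apply: ge_inf; first by case: hE.
  by exists x.
have al0Q x : X x -> expR (- (a1 + a1)) * w1 x <= al0 * w2 x.
  move=> Hx; rewrite -ler_pdivrMr ?w2p// -mulrA.
  by apply: lb_le_inf => //; exact: lbE.
have al0_gt0 : 0 < al0.
  rewrite -(pmulr_lgt0 _ (w2p _ X0)); apply: lt_le_trans (al0Q _ X0).
  by rewrite mulr_gt0 ?expR_gt0 ?w1p.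
(* As [w1 / w2] varies by a factor at most [exp(2 a1)], this is a lower bound for [w2 / w1], and it
   makes [al0 * be0] exactly [exp(-2 a1)]. *)
pose be0 := expR (- (a1 + a1)) / al0.
have be0_gt0 : 0 < be0 by rewrite divr_gt0 ?expR_gt0.
have be0P x : X x -> be0 * w1 x <= w2 x.
  by move=> Hx; rewrite /be0 mulrAC ler_pdivrMr// [leRHS]mulrC al0Q.
have sub1 := cone_sub a1_gt0 a1a (ltW al0_gt0) c1 c2 al0P.
have sub2 := cone_sub a1_gt0 a1a (ltW be0_gt0) c2 c1 be0P.
pose kk := (a - a1) / (a + a1).
have kk0 : 0 < kk by rewrite divr_gt0; have := a_gt0; have := a1_gt0; have := a1a; lra.
pose al := kk * al0; pose be := kk * be0.
have albe : al * be * Q ^+ 2 = 1.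
  rewrite /al /be /be0 /Q /kk expRN expRD.
  have := expR_gt0 a1; have := a_gt0; have := a1_gt0; have := a1a => *.
  by field; rewrite !gt_eqF//; lra.
have al_gt0 : 0 < al by rewrite mulr_gt0.
have be_gt0 : 0 < be by rewrite mulr_gt0.
(* Since [w1 + w2 = r h], the function [w1 - al w2] equals [(1 + al) w1 - al r h]; dividing by
   [1 + al] gives the lower multiple of [h]. The upper one, [r / (1 + be)], comes from [w2 - be w1]
   in the same way. *)
exists (r * (al / (1 + al))); split.
  apply: (@eq_cone _ (fun x => (1 + al)^-1 * (w1 x - (a - a1) / (a + a1) * al0 * w2 x))).
    move=> x Hx; rewrite -/kk -/al.
    have -> : w2 x = r * h x - w1 x by rewrite -e12//; ring.
    by field; rewrite gt_eqF//; lra.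
  by apply: coneZ sub1; rewrite invr_ge0; lra.
pose m' := r / (1 + be).
have mm : m' <= r * (al / (1 + al)) + (Q - 1) / (Q + 1) * r.
  rewrite /m' -[X in _ <= _ + X]mulrC -mulrDr ler_wpM2l//.
  have q0 : 0 < Q by lra.
  (* Arithmetic-geometric mean, from [al * be = Q^-2]. It bounds the width
     [(1 - al be) / ((1 + al) (1 + be))] by [(Q - 1) / (Q + 1)]. *)
  have : 2 <= Q * (al + be).
    have := sqr_ge0 (al - be).
    have : 4 * (al * be * Q ^+ 2) = 4 by rewrite albe mulr1.
    have p0 : 0 < Q * (al + be) by rewrite mulr_gt0//; lra.
    move=> ? ?; rewrite leNgt; apply/negP => lt2.
    have : (Q * (al + be)) ^+ 2 < 2 ^+ 2 by rewrite ltr_pXn2r ?nnegrE// ltW.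
    by nra.
  move=> h2.
  rewrite -subr_ge0.
  have -> : al / (1 + al) + (Q - 1) / (Q + 1) - (1 + be)^-1 =
     ((Q - 1) * (1 + al) * (1 + be) - (Q + 1) * (1 - al * be)) /
       ((1 + al) * (1 + be) * (Q + 1)).
    by field; rewrite !gt_eqF//; lra.
  apply: divr_ge0; last by rewrite !mulr_ge0//; lra.
  have : (Q - 1) * (Q * (al + be)) >= (Q - 1) * 2 by rewrite ler_wpM2l; lra.
  have ab : Q * (al * be) * Q = 1 by rewrite -albe; ring.
  have ab0 : 0 < al * be by rewrite mulr_gt0.
  move=> h3.
  rewrite -(pmulr_rge0 _ q0); nra.
apply: (@eq_cone _ (fun x => (1 + be)^-1 * (w2 x - (a - a1) / (a + a1) * be0 * w1 x)
   + (r * (al / (1 + al)) + (Q - 1) / (Q + 1) * r - m') * h x)).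
  move=> x Hx; rewrite -/kk -/be.
  have -> : w2 x = r * h x - w1 x by rewrite -e12//; ring.
  rewrite /m'; field; rewrite !gt_eqF//; lra.
apply: coneD; last by apply: coneZ => //; rewrite subr_ge0.
by apply: coneZ sub2; rewrite invr_ge0; lra.
Qed.

End Hopf.
End Cone.

(** * Perturbation of a positive operator by a unimodular twist *)

Lemma le_of_eq disp (T : porderType disp) (x y : T) : x = y -> (x <= y)%O.
Proof. by move=> ->. Qed.

Section Modulus.
Context {R : realType}.
Implicit Types (z w c : R[i]) (r : R).

Definition cabs (z : R[i]) : R := Normc.normc z.

Lemma cabsM z w : cabs (z * w) = cabs z * cabs w.
Proof. exact: Normc.normcM. Qed.

Lemma cabsD z w : cabs (z + w) <= cabs z + cabs w.
Proof. exact: le_normcD. Qed.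

Lemma cabsN z : cabs (- z) = cabs z.
Proof. exact: normcN. Qed.

Lemma cabsB z w : cabs (z - w) <= cabs z + cabs w.
Proof. by rewrite -(cabsN w) cabsD. Qed.

Lemma cabsV z : cabs z^-1 = (cabs z)^-1.
Proof. exact: Normc.normcV. Qed.

Lemma cabs0 : cabs 0 = 0. Proof. exact: Normc.normc0. Qed.

Lemma cabs1 : cabs 1 = 1. Proof. exact: Normc.normc1. Qed.

Lemma cabs_ge0 z : 0 <= cabs z.
Proof. by case: z => x y; exact: sqrtr_ge0. Qed.

Lemma cabs_eq0 z : cabs z = 0 -> z = 0.
Proof. exact: Normc.eq0_normc. Qed.

Lemma cabs_real r : cabs r%:C%C = `|r|.
Proof. by rewrite /cabs /= expr0n/= addr0 sqrtr_sqr. Qed.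

Lemma cabs_realB r1 r2 : cabs (r1%:C%C - r2%:C%C) = `|r1 - r2|.
Proof. by rewrite -rmorphB cabs_real. Qed.

Lemma imag_mul r1 r2 : ((0 : R) +i* (r1 * r2))%C = (0 +i* r1)%C * r2%:C%C.
Proof. by apply/eqP; rewrite eq_complex /=; apply/andP; split; apply/eqP; ring. Qed.

Lemma realCM r1 r2 : (r1 * r2)%:C%C = r1%:C%C * r2%:C%C.
Proof. by rewrite rmorphM. Qed.

Lemma Re_le_cabs z : complex.Re z <= cabs z.
Proof.
case: z => x y; rewrite /cabs /=; apply: (le_trans (ler_norm x)).
by rewrite -sqrtr_sqr ler_wsqrtr// lerDl sqr_ge0.
Qed.

Lemma cabs_rotation z : exists2 c, cabs c = 1 & complex.Re (c * z) = cabs z.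
Proof.
have [z0|z0] := eqVneq (cabs z) 0.
  by exists 1; rewrite ?cabs1// mul1r (cabs_eq0 z0) cabs0.
exists ((cabs z)^-1%:C%C * z^*%C).
  rewrite cabsM cabs_real ger0_norm ?invr_ge0 ?cabs_ge0//.
  have -> : cabs z^*%C = cabs z by case: (z) => x y; rewrite /cabs /= sqrrN.
  by rewrite mulVf.
rewrite -mulrA mulrC.
case: z z0 => x y; rewrite /cabs /=; set n := Num.sqrt _ => n0.
have nE : n ^+ 2 = x ^+ 2 + y ^+ 2 by rewrite sqr_sqrtr// addr_ge0 ?sqr_ge0.
rewrite mulr0 subr0; apply: (mulIf n0); rewrite mulfVK//.
by rewrite -[RHS]/(n ^+ 2) nE; ring.
Qed.

(** A bound on a modulus is a bound on the real part of every rotation. Complex estimates are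
    reduced through this to real inequalities, for which the cone order makes sense. *)
Lemma cabs_leP z (M : R) :
  (forall c, cabs c = 1 -> complex.Re (c * z) <= M) <-> cabs z <= M.
Proof.
split=> [H|zM c c1]; last by rewrite (le_trans (Re_le_cabs _))// cabsM c1 mul1r.
by have [c c1 <-] := cabs_rotation z; exact: H.
Qed.

Lemma ReD z w : complex.Re (z + w) = complex.Re z + complex.Re w.
Proof. by rewrite raddfD. Qed.

Lemma complexReN z : complex.Re (- z) = - complex.Re z.
Proof. by rewrite raddfN. Qed.

Lemma Re_real_mul r z : complex.Re (r%:C%C * z) = r * complex.Re z.
Proof. by case: z => x y /=; rewrite mul0r subr0. Qed.

Lemma complexReM z w :
  complex.Re (z * w) = complex.Re z * complex.Re w - complex.Im z * complex.Im w.
Proof. by case: z w => x y [x' y']. Qed.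

Lemma complexImM z w :
  complex.Im (z * w) = complex.Re z * complex.Im w + complex.Im z * complex.Re w.
Proof. by case: z w => x y [x' y']. Qed.

End Modulus.

(** * Taylor bounds for [exp(i x)] *)

Section Cis.
Context {R : realType}.
Implicit Types (x y : R) (F : R -> R[i]).

Definition cis x : R[i] := (cos x +i* sin x)%C.

Lemma cisD x y : cis (x + y) = cis x * cis y.
Proof. by rewrite /cis cosD sinD [in RHS]/GRing.mul /=; congr Complex; ring. Qed.

Lemma cis0 : cis 0 = 1. Proof. by rewrite /cis cos0 sin0. Qed.

Lemma cabs_cis x : cabs (cis x) = 1.
Proof. by rewrite /cabs /= cos2Dsin2 sqrtr1. Qed.

Lemma cabs_mulI (z : R[i]) : cabs ('i%C * z) = cabs z.
Proof. by rewrite cabsM /cabs /= expr0n/= add0r expr1n sqrtr1 mul1r. Qed.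

(** The equality form of the mean value theorem fails for complex values; it is applied to
    [Re (c F)] for each unimodular [c], and [cabs_leP] recovers the modulus. *)
Lemma cabs_mvt F (F' : R -> R[i]) (r M : R) :
  (forall x, is_derive x 1 (fun x => complex.Re (F x)) (complex.Re (F' x))) ->
  (forall x, is_derive x 1 (fun x => complex.Im (F x)) (complex.Im (F' x))) ->
  (forall x, `|x| <= r -> cabs (F' x) <= M) ->
  forall x y, `|x| <= r -> `|y| <= r -> cabs (F x - F y) <= M * `|x - y|.
Proof.
move=> dR dI hM.
have H x y c : x <= y -> `|x| <= r -> `|y| <= r -> cabs c = 1 ->
    complex.Re (c * (F y - F x)) <= M * (y - x).
  move=> xy xr yr c1.
  pose g : R -> R := (complex.Re c \*: (fun x => complex.Re (F x))) -
    (complex.Im c \*: (fun x => complex.Im (F x))).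
  have dg (z : R) : is_derive z 1 g (complex.Re (c * F' z)).
    by rewrite complexReM; apply: is_deriveB.
  have [|z] := @MVT_segment _ g (fun z => complex.Re (c * F' z)) _ _ xy (fun z _ => dg z).
    apply: continuous_subspaceT => z; apply: differentiable_continuous.
    by apply/derivable1_diffP; have [] := dg z.
  rewrite in_itv/= => /andP[xz zy] e.
  have -> : complex.Re (c * (F y - F x)) = g y - g x.
    have gE w : g w = complex.Re (c * F w) by rewrite complexReM.
    by rewrite mulrBr ReD complexReN !gE.
  rewrite e ler_wpM2r ?subr_ge0//; apply: (cabs_leP _ _).2 => //; apply: hM.
  by move: xr yr; rewrite !ler_norml => /andP[? ?] /andP[? ?]; apply/andP; split; lra.
move=> x y xr yr; apply/cabs_leP => c c1; have [xy|/ltW yx] := leP x y.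
  rewrite distrC ger0_norm ?subr_ge0// -(opprB (F y)) mulrN -mulNr.
  by apply: H; rewrite ?cabsN.
by rewrite ger0_norm ?subr_ge0//; apply: H.
Qed.

Lemma cabs_cisB x y : cabs (cis x - cis y) <= `|x - y|.
Proof.
rewrite -[leRHS]mul1r.
apply: (@cabs_mvt cis (fun x => 'i%C * cis x) (`|x| + `|y|)).
- move=> z; rewrite (_ : complex.Re _ = - sin z)//; first exact: is_derive_cos.
  by rewrite /= mul0r mul1r sub0r.
- move=> z; rewrite (_ : complex.Im _ = cos z)//; first exact: is_derive_sin.
  by rewrite /= mul0r mul1r add0r.
- by move=> z _; rewrite cabs_mulI cabs_cis.
- by rewrite lerDl.
- by rewrite lerDr.
Qed.

Lemma cabs_cis_sub1 x : cabs (cis x - 1) <= `|x|.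
Proof. by rewrite -cis0 -{2}[x]subr0 cabs_cisB. Qed.

(** Taylor remainders of [exp(i x)]. The derivative of [cis_rem3] is [i * cis_rem2] and that of
    [cis_rem2] is [i * (cis x - 1)], so [cabs_mvt] bounds them in turn, without the factorials. *)
Definition cis_rem2 x : R[i] := cis x - 1 - (0 +i* x)%C.
Definition cis_rem3 x : R[i] := cis_rem2 x + (x ^+ 2 / 2)%:C%C.

Lemma cabs_cis_rem2B (r : R) x y : `|x| <= r -> `|y| <= r ->
  cabs (cis_rem2 x - cis_rem2 y) <= r * `|x - y|.
Proof.
apply: (@cabs_mvt cis_rem2 (fun x => 'i%C * (cis x - 1))).
- move=> z; rewrite (_ : complex.Re _ = - sin z); last first.
    by rewrite /= mul0r mul1r sub0r subr0.
  have -> : (fun x => complex.Re (cis_rem2 x)) = (cos - cst 1).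
    by apply/funext => w; rewrite /= !fctE oppr0 addr0.
  by apply: is_derive_eq; rewrite subr0.
- move=> z; rewrite (_ : complex.Im _ = cos z - 1); last first.
    by rewrite /= mul0r mul1r add0r.
  have -> : (fun x => complex.Im (cis_rem2 x)) = (sin - id).
    by apply/funext => w; rewrite /= !fctE oppr0 addr0.
  by apply: is_derive_eq.
- by move=> z zr; rewrite cabs_mulI (le_trans (cabs_cis_sub1 _)).
Qed.

Lemma cabs_cis_rem2 x : cabs (cis_rem2 x) <= x ^+ 2.
Proof.
have := @cabs_cis_rem2B `|x| x 0 (lexx _); rewrite normr0 subr0 => /(_ (normr_ge0 _)).
rewrite (_ : cis_rem2 0 = 0); last by rewrite /cis_rem2 cis0 subrr sub0r oppr0.
by rewrite subr0 -normrM -expr2 ger0_norm ?sqr_ge0.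
Qed.

Lemma cabs_cis_rem3 x : cabs (cis_rem3 x) <= `|x| ^+ 3.
Proof.
have := @cabs_mvt cis_rem3 (fun x => 'i%C * cis_rem2 x) `|x| (`|x| ^+ 2) _ _ _ x 0 (lexx _).
rewrite normr0 subr0 (_ : cis_rem3 0 = 0); last first.
  by rewrite /cis_rem3 /cis_rem2 cis0 subrr sub0r oppr0 add0r expr0n/= mul0r.
rewrite subr0 -exprSr; apply.
- move=> z; rewrite (_ : complex.Re _ = - sin z + z); last first.
    by rewrite /= mul0r mul1r sub0r !oppr0 addr0; ring.
  have -> : (fun x => complex.Re (cis_rem3 x)) = (cos - cst 1 + 2^-1 \*: (id ^+ 2)).
    apply/funext => w; transitivity (cos w - 1 + 2^-1 * w ^+ 2); last by [].
    by rewrite /= oppr0; ring.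
  by apply: is_derive_eq; rewrite /GRing.scale /=; field.
- move=> z; rewrite (_ : complex.Im _ = cos z - 1); last first.
    by rewrite /= mul0r mul1r add0r; ring.
  have -> : (fun x => complex.Im (cis_rem3 x)) = (sin - id).
    by apply/funext => w; rewrite /= !fctE oppr0 !addr0.
  by apply: is_derive_eq.
- move=> z zr; rewrite cabs_mulI (le_trans (cabs_cis_rem2 _))//.
  by rewrite -real_normK ?num_real// ler_pXn2r ?nnegrE.
- by rewrite normr_ge0.
Qed.

End Cis.

Lemma expRN_taylor (R : realType) (x : R) : 0 <= x ->
  `|1 - x - expR (- x)| <= x ^+ 2.
Proof.
move=> x0; have h1 := expR_ge1Dx (- x); have h2 := expR_ge1Dx x.
have e0 := expR_gt0 x; have x20 := sqr_ge0 x.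
have h3 : expR (- x) <= 1 - x + x ^+ 2.
  rewrite expRN -[leLHS]mul1r ler_pdivrMr//.
  have p0 : 0 <= 1 - x + x ^+ 2 by nra.
  have : (1 - x + x ^+ 2) * (1 + x) <= (1 - x + x ^+ 2) * expR x by rewrite ler_wpM2l.
  have : 0 <= x * x ^+ 2 by rewrite mulr_ge0.
  by lra.
by rewrite ler_norml; apply/andP; split; lra.
Qed.

(** Telescoping: each term of the difference has one factor [z k - e], earlier factors [z] and later
    factors [e]. It therefore carries only [n - 1] factors bounded by [rho]; the extra [rho] on the
    left restores the power [rho ^+ n]. *)
Lemma prod_telescope_le (R : realType) (z : nat -> R[i]) (e rho : R) (w q : nat -> R) :
  0 <= e <= rho -> rho <= 1 -> (forall n, 0 <= w n) -> (forall n, 0 <= q n) ->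
  (forall n, cabs (z n) <= rho * expR (w n)) ->
  (forall n, cabs (z n - e%:C%C) <= q n) ->
  forall n, rho * cabs (\prod_(k < n) z k - (e ^+ n)%:C%C) <=
    rho ^+ n * expR (\sum_(k < n) w k) * \sum_(k < n) q k.
Proof.
move=> /andP[e0 er] r1 w0 q0 zw zq n; have r0 : 0 <= rho by exact: le_trans er.
have P m : cabs (\prod_(k < m) z k) <= rho ^+ m * expR (\sum_(k < m) w k).
  elim: m => [|m ih]; first by rewrite !big_ord0 cabs1 expr0 expR0 mulr1.
  rewrite !big_ord_recr /= cabsM exprSr expRD.
  by rewrite mulrACA ler_pM ?cabs_ge0.
elim: n => [|n ih].
  by rewrite !big_ord0 expr0 rmorph1 subrr cabs0 !mulr0.
rewrite !big_ord_recr /= exprSr realCM.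
rewrite (_ : _ - _ = \prod_(i < n) z i * (z n - e%:C%C) +
  e%:C%C * (\prod_(i < n) z i - (e ^+ n)%:C%C)); last by ring.
have h1 := ler_wpM2l r0 (cabsD (\prod_(i < n) z i * (z n - e%:C%C))
  (e%:C%C * (\prod_(i < n) z i - (e ^+ n)%:C%C))).
apply: (le_trans h1); rewrite !cabsM cabs_real (ger0_norm e0) expRD.
have ew : 1 <= expR (w n) by rewrite -expR0 ler_expR.
set E := expR (\sum_(k < n) w k) in ih P *; set S := \sum_(k < n) q k in ih *.
have E0 : 0 <= E := expR_ge0 _.
have S0 : 0 <= S by apply: sumr_ge0.
have h2 : cabs (\prod_(i < n) z i) * cabs (z n - e%:C%C) <= rho ^+ n * E * q n.
  by rewrite ler_pM ?cabs_ge0 ?P.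
have h3 : rho * (cabs (\prod_(i < n) z i) * cabs (z n - e%:C%C)) <=
    rho ^+ n.+1 * (E * expR (w n)) * q n.
  apply: (le_trans (ler_wpM2l r0 h2)).
  rewrite exprS -!mulrA ler_wpM2l// ler_wpM2l ?exprn_ge0// ler_wpM2l//.
  by rewrite -{1}[q n]mul1r ler_wpM2r.
have h4 : rho * (e * cabs (\prod_(i < n) z i - (e ^+ n)%:C%C)) <=
    rho ^+ n.+1 * (E * expR (w n)) * S.
  rewrite mulrCA (le_trans (ler_wpM2r _ er))//.
    by rewrite mulr_ge0 ?cabs_ge0.
  apply: (le_trans (ler_wpM2l r0 ih)).
  rewrite exprS -!mulrA ler_wpM2l// ler_wpM2l ?exprn_ge0// ler_wpM2l//.
  by rewrite -{1}[S]mul1r ler_wpM2r.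
by lra.
Qed.

Section DLip.
Context {R : realType}.
Variable d : R -> R -> R.
Local Notation X := (fun x : R => x \in `[0%R, 1%R]).
Hypothesis d_ge0 : forall x y, X x -> X y -> 0 <= d x y.
Hypothesis d_le1 : forall x y, X x -> X y -> d x y <= 1.

Let X0 : X 0. Proof. by rewrite /= in_itv/= lexx ler01. Qed.

Lemma eq_dlip (u v : R -> R) : (forall x, X x -> u x = v x) -> dlip d u -> dlip d v.
Proof. by move=> e [K h]; exists K => x y Hx Hy; rewrite -!e//; exact: h. Qed.

Lemma dlip_lin (k l : R) u v : dlip d u -> dlip d v ->
  dlip d (fun x => k * u x + l * v x).
Proof.
move=> [K hK] [M hM]; exists (`|k| * K + `|l| * M) => x y Hx Hy.
have -> : k * u x + l * v x - (k * u y + l * v y) =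
  k * (u x - u y) + l * (v x - v y) by ring.
rewrite (le_trans (ler_normD _ _))// !normrM mulrDl -!mulrA lerD//;
  by rewrite ler_wpM2l// ?hK ?hM.
Qed.

Lemma dlip_bounded u : dlip d u -> exists2 M, 0 <= M & forall x, X x -> `|u x| <= M.
Proof.
move=> [K h]; exists (`|u 0| + `|K|); first by rewrite addr_ge0.
move=> x Hx; rewrite -[u x](subrK (u 0)) (le_trans (ler_normD _ _))// addrC lerD2l.
rewrite (le_trans (h _ _ Hx X0))// (le_trans (ler_norm _))// normrM.
by rewrite (ger0_norm (d_ge0 Hx X0)) ler_piMr// d_le1.
Qed.

Lemma dlipM u v : dlip d u -> dlip d v -> dlip d (fun x => u x * v x).
Proof.
move=> uK vK; have [M M0 uM] := dlip_bounded uK; have [N N0 vN] := dlip_bounded vK.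
move: uK vK => [K hK] [K' hK']; exists (M * K' + N * K) => x y Hx Hy.
have -> : u x * v x - u y * v y = u x * (v x - v y) + v y * (u x - u y) by ring.
rewrite (le_trans (ler_normD _ _))// !normrM mulrDl -!mulrA.
by rewrite lerD// ler_pM// ?uM ?vN ?hK ?hK'.
Qed.

Lemma dlip_cst (k : R) : dlip d (fun=> k).
Proof. by exists 0 => x y _ _; rewrite subrr normr0 mul0r. Qed.

End DLip.

(** * An abstract positive operator [L] with fixed density [h] and invariant functional [I] *)

Section Operator.
Context {R : realType}.
Variable d : R -> R -> R.
Local Notation X := (fun x : R => x \in `[0%R, 1%R]).
Hypothesis d_ge0 : forall x y, X x -> X y -> 0 <= d x y.
Hypothesis d_le1 : forall x y, X x -> X y -> d x y <= 1.
Hypothesis d_sym : forall x y, X x -> X y -> d x y = d y x.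
Hypothesis d_gt0 : 0 < d 0 1.
Local Notation cone := (cone d).
Local Notation dlip := (dlip d).

Variables (G a0 a1 a b : R) (h : R -> R).
Hypotheses (G_ge0 : 0 <= G) (a0_gt0 : 0 < a0) (a0a1 : a0 <= a1) (a1a : a1 < a).
Hypotheses (ab : a <= b) (b_a0 : 1 <= b - a0) (G_a0 : a0 <= G * (b - a0)).
Hypothesis h_cone : cone a0 h.
Hypothesis h_gt0 : forall x, X x -> 0 < h x.
Let Q := expR a1 * ((a + a1) / (a - a1)).
Let eta := (Q - 1) / (Q + 1).

Variable L : (R -> R) -> R -> R.
Hypothesis L_lin : forall (k l : R) u v x, dlip u -> dlip v -> X x ->
  L (fun x => k * u x + l * v x) x = k * L u x + l * L v x.
Hypothesis L_ext : forall u v x, (forall x, X x -> u x = v x) -> X x -> L u x = L v x.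
Hypothesis L_h : forall x, X x -> L h x = h x.
Hypothesis L_cone_a : forall v, cone a v -> cone a1 (L v).
Hypothesis L_cone_b : forall v, cone b v -> cone a (L v).

Variable I : (R -> R) -> R.
Hypothesis I_lin : forall (k l : R) u v, dlip u -> dlip v ->
  I (fun x => k * u x + l * v x) = k * I u + l * I v.
Hypothesis I_le : forall u v, dlip u -> dlip v -> (forall x, X x -> u x <= v x) -> I u <= I v.
Hypothesis I_h : I h = 1.
Hypothesis I_L : forall u, dlip u -> I (L u) = I u.

Let a1_gt0 : 0 < a1. Proof. exact: lt_le_trans a0a1. Qed.
Let a_gt0 : 0 < a. Proof. exact: lt_trans a1a. Qed.
Let b_gt0 : 0 < b. Proof. by have := a0_gt0; have := b_a0; lra. Qed.
Let cge0 (c : R) v x : 0 < c -> cone c v -> X x -> 0 <= v x.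
Proof. by move=> c0 cv Hx; apply: (cone_ge0 _ _ c0 cv Hx). Qed.
Let clip (c : R) v : 0 < c -> cone c v -> dlip v.
Proof. by move=> c0 cv; apply: (cone_dlip _ _ _ _ c0 cv). Qed.
Let hcone_a : cone a h.
Proof.
have a0a := ltW (le_lt_trans a0a1 a1a).
by apply: (cone_le _ _ _ a0_gt0 a0a h_cone).
Qed.
Let hlip : dlip h. Proof. exact: clip a0_gt0 h_cone. Qed.
Let clip_a v : cone a v -> dlip v. Proof. exact: clip. Qed.

Definition cdlip (u : R -> R[i]) :=
  dlip (fun x => complex.Re (u x)) /\ dlip (fun x => complex.Im (u x)).
(** Complexification by real and imaginary parts. By [Re_cL] and [Re_cI] it commutes with rotations,
    so the real part of a rotated function can be fed to the real operator. *)
Definition cL (u : R -> R[i]) (x : R) : R[i] :=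
  (L (fun x => complex.Re (u x)) x +i* L (fun x => complex.Im (u x)) x)%C.
Definition cI (u : R -> R[i]) : R[i] :=
  (I (fun x => complex.Re (u x)) +i* I (fun x => complex.Im (u x)))%C.

Lemma I_ext u v : dlip u -> (forall x, X x -> u x = v x) -> I u = I v.
Proof.
move=> ul e; have vl := eq_dlip e ul.
by apply/le_anti/andP; split; apply: I_le => // x Hx; rewrite e.
Qed.

Lemma eq_cdlip u v : (forall x, X x -> u x = v x) -> cdlip u -> cdlip v.
Proof.
by move=> e [u1 u2]; split; [apply: eq_dlip u1|apply: eq_dlip u2] => x Hx; rewrite e.
Qed.

Lemma dlip_Re u c : cdlip u -> dlip (fun x => complex.Re (c * u x)).
Proof.
move=> [u1 u2]; apply: eq_dlip (dlip_lin (complex.Re c) (- complex.Im c) u1 u2).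
by move=> x _; rewrite complexReM mulNr.
Qed.

Lemma dlip_Im u c : cdlip u -> dlip (fun x => complex.Im (c * u x)).
Proof.
move=> [u1 u2]; apply: eq_dlip (dlip_lin (complex.Re c) (complex.Im c) u2 u1).
by move=> x _; rewrite complexImM.
Qed.

Lemma cdlip_lin c c' u v : cdlip u -> cdlip v -> cdlip (fun x => c * u x + c' * v x).
Proof.
move=> ul vl; split.
  apply: eq_dlip (dlip_lin 1 1 (dlip_Re c ul) (dlip_Re c' vl)).
  by move=> x _; rewrite raddfD /= !mul1r.
apply: eq_dlip (dlip_lin 1 1 (dlip_Im c ul) (dlip_Im c' vl)).
by move=> x _; rewrite [RHS]raddfD /= !mul1r.
Qed.

Lemma cdlipM u v : cdlip u -> cdlip v -> cdlip (fun x => u x * v x).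
Proof.
move=> [u1 u2] [v1 v2].
have M := dlipM d_ge0 d_le1; split.
  apply: eq_dlip (dlip_lin 1 (-1) (M _ _ u1 v1) (M _ _ u2 v2)).
  by move=> x _; rewrite complexReM; ring.
apply: eq_dlip (dlip_lin 1 1 (M _ _ u1 v2) (M _ _ u2 v1)).
by move=> x _; rewrite complexImM; ring.
Qed.

Lemma cdlip_real u : dlip u -> cdlip (fun x => (u x)%:C%C).
Proof. by move=> ul; split => //=; exact: dlip_cst. Qed.

Lemma Re_cL c u x : cdlip u -> X x ->
  complex.Re (c * cL u x) = L (fun x => complex.Re (c * u x)) x.
Proof.
move=> [u1 u2] Hx; rewrite complexReM /= -mulNr -(L_lin _ _ u1 u2 Hx).
by apply: L_ext => // y Hy; rewrite complexReM mulNr.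
Qed.

Lemma Re_cI c u : cdlip u ->
  complex.Re (c * cI u) = I (fun x => complex.Re (c * u x)).
Proof.
move=> [u1 u2]; rewrite complexReM /= -mulNr -(I_lin _ _ u1 u2).
by apply: I_ext => [|y Hy]; [exact: dlip_lin|rewrite complexReM mulNr].
Qed.

Lemma Re_inj (z w : R[i]) :
  (forall c, complex.Re (c * z) = complex.Re (c * w)) -> z = w.
Proof.
move=> H; case: z w H => x y [x' y'] H.
have := H 1; have := H (0 +i* (-1))%C; rewrite !complexReM /=.
by rewrite !mul0r !mul1r !subr0 !sub0r !mulN1r !opprK => -> ->.
Qed.

Lemma cI_lin c c' u v : cdlip u -> cdlip v ->
  cI (fun x => c * u x + c' * v x) = c * cI u + c' * cI v.
Proof.
move=> ul vl; apply: Re_inj => k; rewrite Re_cI; last exact: cdlip_lin.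
rewrite mulrDr ReD !mulrA !Re_cI// -[X in X + _]mul1r -[X in _ + X]mul1r -I_lin;
  [|exact: dlip_Re|exact: dlip_Re].
apply: I_ext => [|x _]; first exact/dlip_Re/cdlip_lin.
by rewrite mulrDr ReD !mulrA !mul1r.
Qed.

Lemma cI_ext u v : cdlip u -> (forall x, X x -> u x = v x) -> cI u = cI v.
Proof. by move=> [u1 u2] e; congr Complex; apply: I_ext => // x Hx; rewrite e. Qed.

Lemma cL_lin c c' u v x : cdlip u -> cdlip v -> X x ->
  cL (fun x => c * u x + c' * v x) x = c * cL u x + c' * cL v x.
Proof.
move=> ul vl Hx; apply: Re_inj => k; rewrite Re_cL//; last exact: cdlip_lin.
rewrite mulrDr ReD !mulrA !Re_cL// -[X in X + _]mul1r -[X in _ + X]mul1r -L_lin//;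
  [|exact: dlip_Re|exact: dlip_Re].
by apply: L_ext => // y _; rewrite mulrDr ReD !mulrA !mul1r.
Qed.

Lemma cL_ext u v x : (forall x, X x -> u x = v x) -> X x -> cL u x = cL v x.
Proof. by move=> e Hx; congr Complex; apply: L_ext => // y Hy; rewrite e. Qed.

Lemma cI_L u : cdlip u -> cI (cL u) = cI u.
Proof. by move=> [u1 u2]; congr Complex; rewrite /= I_L. Qed.

Lemma cI_h : cI (fun x => (h x)%:C%C) = 1.
Proof.
congr Complex => //=.
rewrite (@I_ext _ (fun x => 0 * h x + 0 * h x)); last 2 first.
- exact: dlip_cst.
- by move=> x _; rewrite !mul0r addr0.
by rewrite I_lin// !mul0r addr0.
Qed.

Lemma cabs_cI_le u (M : R) : cdlip u -> (forall x, X x -> cabs (u x) <= M * h x) ->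
  cabs (cI u) <= M.
Proof.
move=> ul uM; apply/cabs_leP => c c1; rewrite Re_cI//.
rewrite -[M]mulr1 -I_h -[leRHS]addr0 -(mul0r (I h)) -I_lin//.
apply: I_le => [||x Hx]; [exact: dlip_Re|exact: dlip_lin|].
rewrite mul0r addr0; apply: le_trans (uM _ Hx).
by apply/(cabs_leP _ _).2.
Qed.

(* [oscle u r]: every rotation of u has oscillation at most r relative to h
   for the order of the cone of parameter a. *)
Definition oscle (u : R -> R[i]) (r : R) := forall c, cabs c = 1 -> exists m,
  cone a (fun x => complex.Re (c * u x) - m * h x) /\
  cone a (fun x => (m + r) * h x - complex.Re (c * u x)).

Lemma oscle_cdlip u r : oscle u r -> cdlip u.
Proof.
have D v m : cone a (fun x => v x - m * h x) -> dlip v.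
  move=> cv; have vl := clip_a cv.
  by apply: eq_dlip (dlip_lin 1 m vl hlip) => x _; ring.
move=> o; split.
  have [m [cm _]] := o 1 cabs1.
  by apply: (D _ m); apply: eq_cone cm => x _; rewrite mul1r.
(* Rotation by [-i] turns the imaginary part into a real part. *)
have i1 : cabs ((0 : R) +i* (-1))%C = 1.
  by rewrite /cabs/= expr0n/= add0r sqrrN expr1n sqrtr1.
have [m [cm _]] := o _ i1.
apply: (D _ m); apply: eq_cone cm => x _.
by rewrite complexReM /= mul0r mulN1r sub0r opprK.
Qed.

Lemma eq_oscle u v r : (forall x, X x -> u x = v x) -> oscle u r -> oscle v r.
Proof.
move=> e o c c1; have [m [h1 h2]] := o c c1; exists m.
by split; [apply: eq_cone h1|apply: eq_cone h2] => x Hx; rewrite e.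
Qed.

Lemma oscle_le u r r' : r <= r' -> oscle u r -> oscle u r'.
Proof.
move=> rr o c c1; have [m [h1 h2]] := o c c1; exists m; split => //.
have rr0 : 0 <= r' - r by rewrite subr_ge0.
have hk := coneZ rr0 hcone_a.
by apply: eq_cone (coneD h2 hk) => x _; ring.
Qed.

Lemma oscleD u v r s : oscle u r -> oscle v s -> oscle (fun x => u x + v x) (r + s).
Proof.
move=> ou ov c c1; have [m [h1 h2]] := ou c c1; have [n [k1 k2]] := ov c c1.
exists (m + n); split.
  by apply: eq_cone (coneD h1 k1) => x _; rewrite mulrDr ReD; ring.
by apply: eq_cone (coneD h2 k2) => x _; rewrite mulrDr ReD; ring.
Qed.

Lemma oscle_h (z : R[i]) : oscle (fun x => z * (h x)%:C%C) 0.
Proof.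
move=> c c1; exists (complex.Re (c * z)).
have e x : complex.Re (c * (z * (h x)%:C%C)) = complex.Re (c * z) * h x.
  by rewrite mulrA mulrC Re_real_mul mulrC.
by split; apply: eq_cone (coneZ (lexx 0) hcone_a) => x _; rewrite e; ring.
Qed.

Lemma oscleZ (z : R[i]) u r : oscle u r -> oscle (fun x => z * u x) (cabs z * r).
Proof.
move=> o.
have [z0|z0] := eqVneq (cabs z) 0.
  rewrite z0 mul0r (cabs_eq0 z0); apply: eq_oscle (oscle_h 0) => x _.
  by rewrite !mul0r.
have zp : 0 < cabs z by rewrite lt_def z0 cabs_ge0.
move=> c c1; have [|m [h1 h2]] := o (c * ((cabs z)^-1%:C%C * z)).
  rewrite !cabsM c1 mul1r cabs_real ger0_norm ?mulVf//.
  by rewrite invr_ge0 ltW.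
have e x : complex.Re (c * (z * u x)) =
    cabs z * complex.Re (c * ((cabs z)^-1%:C%C * z) * u x).
  rewrite -Re_real_mul; congr complex.Re.
  rewrite (_ : (cabs z)%:C%C * _ =
    ((cabs z)%:C%C * (cabs z)^-1%:C%C) * (c * (z * u x))); last by ring.
  by rewrite -rmorphM /= divff// mul1r.
exists (cabs z * m); split.
  by apply: eq_cone (coneZ (ltW zp) h1) => x _; rewrite e; ring.
by apply: eq_cone (coneZ (ltW zp) h2) => x _; rewrite e; ring.
Qed.

(** [hopf_contraction] applies to the images of [Re (c u) - m h] and [(m + r) h - Re (c u)], whose
    sum is [r h] because [h] is fixed. *)
Lemma oscle_L u r : oscle u r -> oscle (cL u) (eta * r).
Proof.
move=> o c c1; have ul := oscle_cdlip o; have [m [h1 h2]] := o c c1.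
have l1 := clip_a h1.
have l2 := clip_a h2.
have [x Hx|n [n1 n2]] := hopf_contraction d_ge0 d_le1 d_sym d_gt0 a0_gt0 a0a1 a1a h_cone h_gt0
  (L_cone_a h1) (L_cone_a h2) (r := r).
  rewrite -[L _ x]mul1r -[X in _ + X]mul1r -L_lin//.
  have := L_lin r 0 hlip hlip Hx; rewrite mul0r addr0 L_h// => <-.
  by apply: L_ext => // y _; ring.
have e x : X x -> L (fun x => complex.Re (c * u x) - m * h x) x =
    complex.Re (c * cL u x) - m * h x.
  move=> Hx; rewrite Re_cL//.
  have := L_lin 1 (- m) (dlip_Re c ul) hlip Hx; rewrite L_h// mul1r mulNr => <-.
  by apply: L_ext => // y _; ring.
exists (m + n); split.
  by apply: eq_cone n1 => x Hx; rewrite e//; ring.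
by apply: eq_cone n2 => x Hx; rewrite e// -/Q -/eta; ring.
Qed.

(* Weaker than cone membership, but all that is needed for [L (phi u)] to have
   small oscillation when the multiplier [phi] is small and Lipschitz. *)
Definition tame (u : R -> R[i]) (U : R) :=
  (forall x, X x -> cabs (u x) <= U * h x) /\
  forall x y, X x -> X y -> cabs (u x - (expR (b * d x y))%:C%C * u y) <=
    U * h y * (expR (b * d x y) - expR (- (a0 * d x y))).

Let hlow x y : X x -> X y -> expR (- (a0 * d x y)) * h y <= h x.
Proof.
move=> Hx Hy; have := h_cone Hy Hx; rewrite (d_sym Hy Hx).
by rewrite -(ler_pM2l (expR_gt0 (- (a0 * d x y)))) mulrA -expRD addNr expR0 mul1r.
Qed.

Lemma tame_h : tame (fun x => (h x)%:C%C) 1.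
Proof.
split=> [x Hx|x y Hx Hy]; first by rewrite cabs_real ger0_norm ?mul1r// ltW// h_gt0.
rewrite (_ : _ - _ = (h x - expR (b * d x y) * h y)%:C%C); last first.
  by rewrite rmorphB rmorphM.
rewrite cabs_real mul1r.
have h1 := h_cone Hx Hy; have h2 := hlow Hx Hy.
have : expR (a0 * d x y) * h y <= expR (b * d x y) * h y.
  apply: ler_wpM2r; first exact/ltW/h_gt0.
  by rewrite ler_expR ler_wpM2r ?d_ge0//; have := b_a0; lra.
by move=> h3; rewrite ler_norml; apply/andP; split; lra.
Qed.

Lemma tameD u v U V : tame u U -> tame v V -> tame (fun x => u x + v x) (U + V).
Proof.
move=> [u1 u2] [v1 v2]; split=> [x Hx|x y Hx Hy].
  by rewrite (le_trans (cabsD _ _))// mulrDl lerD ?u1 ?v1.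
rewrite (_ : u x + v x - _ = (u x - (expR (b * d x y))%:C%C * u y) +
   (v x - (expR (b * d x y))%:C%C * v y)); last by ring.
by rewrite (le_trans (cabsD _ _))// !mulrDl lerD ?u2 ?v2.
Qed.

Lemma eq_tame u v U : (forall x, X x -> u x = v x) -> tame u U -> tame v U.
Proof. by move=> e [u1 u2]; split=> *; rewrite -!e// ?u1 ?u2. Qed.

(* If p is the nonnegative part Re (c u) - m h, then I p <= r and Re (c u) is
   p - I p h, so that only the sign of p(x) - e^(b d) p(y) matters. *)
Lemma oscle_tame u r : oscle u r -> cI u = 0 -> tame u r.
Proof.
move=> o u0; have ul := oscle_cdlip o.
have key c : cabs c = 1 ->
    (forall x, X x -> complex.Re (c * u x) <= r * h x) /\
    (forall x y, X x -> X y ->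
      complex.Re (c * u x) - expR (b * d x y) * complex.Re (c * u y) <=
      r * h y * (expR (b * d x y) - expR (- (a0 * d x y)))).
  move=> c1; have [m [h1 h2]] := o c c1.
  have l1 := clip_a h1.
  have l2 := clip_a h2.
  have p1 x Hx := cge0 a_gt0 h1 (x := x) Hx.
  have p2 x Hx := cge0 a_gt0 h2 (x := x) Hx.
  have Iu : I (fun x => complex.Re (c * u x)) = 0 by rewrite -Re_cI// u0 mulr0.
  (* Both cone elements are nonnegative; as [I u = 0], applying [I] to them brackets [0] between [m]
     and [m + r]. *)
  have m0 : m <= 0.
    rewrite -Iu -[m]mulr1 -I_h -[leLHS]addr0 -(mul0r (I h)) -I_lin//.
    apply: I_le => [||x Hx]; [exact: dlip_lin|exact: dlip_Re|].
    by have := p1 _ Hx; lra.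
  have mr0 : 0 <= m + r.
    rewrite -Iu -[leRHS]mulr1 -I_h -[leRHS]addr0 -(mul0r (I h)) -I_lin//.
    apply: I_le => [||x Hx]; [exact: dlip_Re|exact: dlip_lin|].
    by have := p2 _ Hx; lra.
  split=> [x Hx|x y Hx Hy].
    by have := p2 _ Hx; have := h_gt0 Hx; nra.
  have k1 := h1 _ _ Hx Hy; have k2 := p1 _ Hy.
  have e1 : expR (a * d x y) <= expR (b * d x y).
    by rewrite ler_expR ler_wpM2r ?d_ge0.
  have k3 : (expR (b * d x y) - expR (a * d x y)) *
     (complex.Re (c * u y) - m * h y) >= 0 by rewrite mulr_ge0// subr_ge0.
  have k4 := hlow Hx Hy.
  have k5 : (- m) * (expR (b * d x y) * h y - h x) <=
     r * h y * (expR (b * d x y) - expR (- (a0 * d x y))).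
    apply: (@le_trans _ _ (r * (expR (b * d x y) * h y - h x))).
      rewrite ler_wpM2r//; last by lra.
      have e2 : expR (a0 * d x y) * h y <= expR (b * d x y) * h y.
        apply: ler_wpM2r; first exact/ltW/h_gt0.
        by rewrite ler_expR ler_wpM2r ?d_ge0//; have := b_a0; lra.
      by have := h_cone Hx Hy; lra.
    by rewrite -mulrA ler_wpM2l//; lra.
  by lra.
split=> [x Hx|x y Hx Hy]; apply/cabs_leP => c c1.
  exact: (key c c1).1.
rewrite mulrBr (mulrCA c) ReD complexReN Re_real_mul; exact: (key c c1).2.
Qed.

(** Origin of the constant [1 + 2 G]: [exp(a0 t) - exp(- a0 t)] is at most [2 a0 t exp(a0 t)], and
    [a0 <= G (b - a0)] compares this with [exp(b t) - exp(a0 t)]. *)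
Lemma expR_gap_ratio (t : R) : 0 <= t ->
  expR (b * t) - expR (- (a0 * t)) <= (1 + 2 * G) * (expR (b * t) - expR (a0 * t)).
Proof.
move=> t0.
suff : expR (a0 * t) - expR (- (a0 * t)) <= 2 * G * (expR (b * t) - expR (a0 * t)) by lra.
have e0 := expR_gt0 (a0 * t).
have -> : expR (- (a0 * t)) = expR (a0 * t) * expR (- (2 * a0 * t)).
  by rewrite -expRD; congr expR; ring.
have -> : expR (b * t) = expR (a0 * t) * expR ((b - a0) * t).
  by rewrite -expRD; congr expR; ring.
have h1 := expR_ge1Dx (- (2 * a0 * t)).
have h2 := expR_ge1Dx ((b - a0) * t).
have h3 : a0 * t <= G * (b - a0) * t by rewrite ler_wpM2r.
have h4 : G * ((b - a0) * t) <= G * (expR ((b - a0) * t) - 1) by rewrite ler_wpM2l//; lra.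
set E := expR (a0 * t) in e0 *; set E1 := expR (- _) in h1 *.
set E2 := expR _ in h2 h4 *.
have : E * (1 - E1) <= E * (2 * G * (E2 - 1)) by rewrite ler_pM2l//; lra.
by lra.
Qed.

(** As [b - a0 >= 1], the gap between the two exponentials is at least half of [t exp(b t)]. This
    lets the Lipschitz constant of a multiplier be absorbed by the cone. *)
Lemma expR_gap_le (t : R) : 0 <= t <= 1 ->
  expR (b * t) * t <= 2 * (expR (b * t) - expR (a0 * t)).
Proof.
move=> t01; have h1 := expR_le_div t01; case/andP: t01 => t0 t1.
have e0 := expR_gt0 (b * t).
have -> : expR (a0 * t) = expR (b * t) * expR (- ((b - a0) * t)).
  by rewrite -expRD; congr expR; ring.
rewrite -{2}[expR (b * t)]mulr1 -mulrBr mulrCA ler_pM2l//.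
apply: (le_trans h1); rewrite ler_wpM2l// lerD2l lerN2 ler_expR lerN2.
by rewrite ler_peMl.
Qed.

(** For every unimodular [c], [M h + Re (c phi u)] lies in the wide cone [b], and [L] brings it back
    to the cone [a]; the rotations [c] and [- c] together give oscillation [2 M]. In [M], the term
    in [p] pays for the size of [phi] and the term in [l] for its variation. *)
Lemma oscle_mul (phi u : R -> R[i]) (p l U : R) : 0 <= p -> 0 <= l -> 0 <= U ->
  (forall x, X x -> cabs (phi x) <= p) ->
  (forall x y, X x -> X y -> cabs (phi x - phi y) <= l * d x y) ->
  tame u U -> oscle (cL (fun x => phi x * u x)) (2 * U * ((1 + 2 * G) * p + 2 * l)).
Proof.
move=> p0 l0 U0 phip phil [u1 u2].
pose w x := phi x * u x; pose M := U * ((1 + 2 * G) * p + 2 * l).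
have M0 : 0 <= M by rewrite mulr_ge0// addr_ge0// mulr_ge0// addr_ge0// mulr_ge0.
have key x y : X x -> X y -> cabs (w x - (expR (b * d x y))%:C%C * w y) <=
    M * h y * (expR (b * d x y) - expR (a0 * d x y)).
  move=> Hx Hy; have d0 := d_ge0 Hx Hy; have d1 := d_le1 Hx Hy.
  have hy := ltW (h_gt0 Hy).
  rewrite (_ : _ - _ = phi x * (u x - (expR (b * d x y))%:C%C * u y) +
    (expR (b * d x y))%:C%C * u y * (phi x - phi y)); last by rewrite /w; ring.
  rewrite (le_trans (cabsD _ _))// !cabsM cabs_real (ger0_norm (expR_ge0 _)).
  have k1 : cabs (phi x) * cabs (u x - (expR (b * d x y))%:C%C * u y) <=
      p * (U * h y * ((1 + 2 * G) * (expR (b * d x y) - expR (a0 * d x y)))).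
    rewrite ler_pM ?cabs_ge0 ?phip// (le_trans (u2 _ _ Hx Hy))//.
    by rewrite ler_wpM2l ?expR_gap_ratio// mulr_ge0.
  have k2 : expR (b * d x y) * cabs (u y) * cabs (phi x - phi y) <=
      (U * h y) * l * (2 * (expR (b * d x y) - expR (a0 * d x y))).
    apply: (@le_trans _ _ (U * h y * l * (expR (b * d x y) * d x y))); last first.
      by rewrite ler_wpM2l ?expR_gap_le ?mulr_ge0// d0.
    rewrite (_ : U * h y * l * _ = expR (b * d x y) * (U * h y) * (l * d x y)); last by ring.
    by rewrite ler_pM ?cabs_ge0 ?phil ?mulr_ge0 ?cabs_ge0 ?expR_ge0// ler_wpM2l ?expR_ge0 ?u1.
  by rewrite (le_trans (lerD k1 k2))// /M; lra.
(* Because [h] has the smaller aperture [a0], the function [M h] satisfies the inequality of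
   aperture [b] with exactly the margin consumed in [key]. *)
have hb x y : X x -> X y -> M * h x + M * h y * (expR (b * d x y) - expR (a0 * d x y)) <=
    expR (b * d x y) * (M * h y).
  move=> Hx Hy; have : M * h x <= M * (expR (a0 * d x y) * h y) by rewrite ler_wpM2l ?h_cone.
  by lra.
have cb c : cabs c = 1 -> cone b (fun x => M * h x + complex.Re (c * w x)).
  move=> c1 x y Hx Hy; have := hb _ _ Hx Hy.
  have := (cabs_leP _ _).2 (key _ _ Hx Hy) _ c1.
  rewrite (_ : c * _ = c * w x - (expR (b * d x y))%:C%C * (c * w y)); last by ring.
  by rewrite ReD complexReN Re_real_mul; lra.
have wl : cdlip w.
  have D c : cabs c = 1 -> dlip (fun x => complex.Re (c * w x)).
    move=> c1; apply: eq_dlip (dlip_lin 1 (- M) (clip b_gt0 (cb c c1)) hlip).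
    by move=> x _; ring.
  split; first by apply: eq_dlip (D 1 cabs1) => x _; rewrite mul1r.
  have i1 : cabs ((0 : R) +i* (-1))%C = 1.
    by rewrite /cabs/= expr0n/= add0r sqrrN expr1n sqrtr1.
  by apply: eq_dlip (D _ i1) => x _; rewrite complexReM /= mul0r mulN1r sub0r opprK.
have ca c : cabs c = 1 -> cone a (fun x => M * h x + complex.Re (c * cL w x)).
  move=> c1; apply: eq_cone (L_cone_b (cb c c1)) => x Hx.
  have := L_lin M 1 hlip (dlip_Re c wl) Hx; rewrite L_h// mul1r Re_cL// => <-.
  by apply: L_ext => // y _; rewrite mul1r.
move=> c c1; exists (- M); split.
  by apply: eq_cone (ca c c1) => x _; ring.
have c1' : cabs (- c) = 1 by rewrite cabsN.
by apply: eq_cone (ca _ c1') => x _; rewrite mulNr complexReN -/w /M; ring.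
Qed.

Lemma cdlip_cabs (phi : R -> R[i]) (l : R) :
  (forall x y, X x -> X y -> cabs (phi x - phi y) <= l * d x y) -> cdlip phi.
Proof.
move=> phil.
have D c : cabs c = 1 -> dlip (fun x => complex.Re (c * phi x)).
  move=> c1; have H x y : X x -> X y ->
      complex.Re (c * phi x) - complex.Re (c * phi y) <= l * d x y.
    move=> Hx Hy; rewrite -complexReN -ReD -mulrBr.
    by apply: (cabs_leP _ _).2 => //; exact: phil.
  exists l => x y Hx Hy; rewrite ler_norml H// andbT lerNl opprB.
  by rewrite (d_sym Hx Hy) H.
split; first by apply: eq_dlip (D 1 cabs1) => x _; rewrite mul1r.
have i1 : cabs ((0 : R) +i* (-1))%C = 1.
  by rewrite /cabs/= expr0n/= add0r sqrrN expr1n sqrtr1.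
by apply: eq_dlip (D _ i1) => x _; rewrite complexReM /= mul0r mulN1r sub0r opprK.
Qed.

Lemma cI_real v : dlip v -> cI (fun x => (v x)%:C%C) = (I v)%:C%C.
Proof.
move=> vl; rewrite /cI /=; congr Complex.
rewrite (@I_ext _ (fun x => 0 * h x + 0 * h x)); last 2 first.
- exact: dlip_cst.
- by move=> x _; rewrite !mul0r addr0.
by rewrite I_lin// !mul0r addr0.
Qed.

Lemma cL_real v x : dlip v -> X x -> cL (fun x => (v x)%:C%C) x = (L v x)%:C%C.
Proof.
move=> vl Hx; rewrite /cL /=; congr Complex.
rewrite (@L_ext _ (fun x => 0 * h x + 0 * h x))//.
  by rewrite L_lin// !mul0r addr0.
by move=> y _; rewrite !mul0r addr0.
Qed.

Lemma cabs_cI_mul (phi u : R -> R[i]) (p U : R) : cdlip phi -> cdlip u ->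
  0 <= p -> (forall x, X x -> cabs (phi x) <= p) -> tame u U ->
  cabs (cI (fun x => phi x * u x)) <= p * U.
Proof.
move=> pl ul p0 phip [u1 _]; apply: cabs_cI_le => [|x Hx]; first exact: cdlipM.
by rewrite cabsM -mulrA ler_pM ?cabs_ge0 ?phip ?u1.
Qed.

(** * Correlations and variance of a centred observable *)

Section Perturbation.
Variables (f : R -> R) (nf lf B : R).
Hypotheses (nf_ge0 : 0 <= nf) (lf_ge0 : 0 <= lf).
Hypothesis f_le : forall x, X x -> `|f x| <= nf.
Hypothesis f_lip : forall x y, X x -> X y -> `|f x - f y| <= lf * d x y.
Hypothesis I_fh : I (fun x => f x * h x) = 0.
Hypotheses (B_ge2 : 2 <= B) (B_geG : 1 + 2 * G <= B).
Let F := nf + lf.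
(** [B] times the sum of the geometric series of rate [eta]; the identity [A (1 - eta) = B] makes
    the bounds below stable under one step of their recursions. *)
Let A := B / (1 - eta).

Let Q_ge1 : 1 <= Q.
Proof.
have e1 : 1 <= expR a1 by rewrite -expR0 ler_expR ltW.
have e2 : 1 <= (a + a1) / (a - a1).
  by rewrite ler_pdivlMr ?subr_gt0// mul1r; have := a1_gt0; lra.
by rewrite /Q; nra.
Qed.

Lemma eta_ge0 : 0 <= eta.
Proof. by have := Q_ge1; rewrite /eta => q; apply: divr_ge0; lra. Qed.

Lemma eta_lt1 : eta < 1.
Proof. by have := Q_ge1; rewrite /eta => q; rewrite ltr_pdivrMr; lra. Qed.

Let AE : A * (1 - eta) = B.
Proof. by rewrite /A divfK// subr_eq0 gt_eqF// eta_lt1. Qed.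

Let A_ge2 : 2 <= A.
Proof.
rewrite /A ler_pdivlMr; last by have := eta_lt1; lra.
by have := eta_ge0; have := B_ge2; nra.
Qed.

Let A_ge0 : 0 <= A. Proof. exact: le_trans A_ge2. Qed.

Let F_ge0 : 0 <= F. Proof. exact: addr_ge0. Qed.

Let f_dlip : dlip f. Proof. by exists lf. Qed.
Let dM := dlipM d_ge0 d_le1.
Let fh_dlip : dlip (fun x => f x * h x). Proof. exact: dM. Qed.

(** The function [L (f h) + L^2 (f h) + ... + L^n (f h)], in the recursive form that the oscillation
    estimates use. *)
Definition corr_sum : nat -> R -> R :=
  nat_rect _ (fun=> 0) (fun _ g => L (fun x => g x + f x * h x)).
Local Notation g := corr_sum.

(** Green-Kubo sum truncated at lag [n]: as [I (f L^k (f h))] is the correlation of [f] with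
    [f o T^k], it stands for [E[f^2] + 2 (E[f . f o T] + ... + E[f . f o T^n])]. *)
Definition partial_var (n : nat) : R :=
  I (fun x => f x ^+ 2 * h x) + 2 * I (fun x => f x * g n x).

Lemma oscle_mul_f u U : 0 <= U -> tame u U ->
  oscle (cL (fun x => (f x)%:C%C * u x)) (2 * F * B * U).
Proof.
move=> U0 tu; apply: (oscle_le (r := 2 * U * ((1 + 2 * G) * nf + 2 * lf))); last first.
  apply: oscle_mul => // [x Hx|x y Hx Hy]; first by rewrite cabs_real f_le.
  by rewrite cabs_realB f_lip.
rewrite /F; have h1 : (1 + 2 * G) * nf <= B * nf by rewrite ler_wpM2r.
have h2 : 2 * lf <= B * lf by rewrite ler_wpM2r.
have : U * ((1 + 2 * G) * nf + 2 * lf) <= U * (B * (nf + lf)) by rewrite ler_wpM2l//; lra.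
by lra.
Qed.

Lemma real_dlip v : cdlip (fun x => (v x)%:C%C) -> dlip v.
Proof. by case. Qed.

Lemma tame_real v U : oscle (fun x => (v x)%:C%C) U -> I v = 0 ->
  tame (fun x => (v x)%:C%C) U.
Proof.
move=> o v0; apply: oscle_tame => //.
by rewrite cI_real ?v0//; exact: real_dlip (oscle_cdlip o).
Qed.

Lemma I_mul_le v U : oscle (fun x => (v x)%:C%C) U -> I v = 0 ->
  `|I (fun x => f x * v x)| <= nf * U.
Proof.
move=> o v0; have vl := real_dlip (oscle_cdlip o).
rewrite -cabs_real -cI_real; last exact: dM.
rewrite (@cI_ext _ (fun x => (f x)%:C%C * (v x)%:C%C)); last 2 first.
- exact/cdlip_real/dM.
- by move=> x _; rewrite rmorphM.
apply: cabs_cI_mul => //; [exact: cdlip_real|exact: cdlip_real| |exact: tame_real].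
by move=> x Hx; rewrite cabs_real f_le.
Qed.

(** The bound reproduces itself, [eta (2 F A) + 2 F B = 2 F A]. The zero mean, which [oscle_tame]
    requires, is inherited from the centring of [f]. *)
Lemma corr_sumP n : I (g n) = 0 /\ oscle (fun x => (g n x)%:C%C) (2 * F * A).
Proof.
elim: n => [|n [ih1 ih2]].
  split=> /=.
    rewrite (@I_ext _ (fun x => 0 * h x + 0 * h x)); last 2 first.
    - exact: dlip_cst.
    - by move=> x _; rewrite !mul0r addr0.
    by rewrite I_lin// !mul0r addr0.
  apply: (oscle_le (r := 0)); first by apply: mulr_ge0 => //; apply: mulr_ge0.
  by apply: eq_oscle (oscle_h 0) => x _; rewrite mul0r.
have gl := real_dlip (oscle_cdlip ih2).
have gfl : dlip (fun x => g n x + f x * h x).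
  by apply: eq_dlip (dlip_lin 1 1 gl fh_dlip) => x _; rewrite !mul1r.
split=> /=.
  rewrite I_L// (@I_ext _ (fun x => 1 * g n x + 1 * (f x * h x)))//.
    by rewrite I_lin// ih1 I_fh !mulr0 addr0.
  by move=> x _; rewrite !mul1r.
have o1 := oscle_L ih2.
have o2 := oscle_mul_f ler01 tame_h.
apply: oscle_le (eq_oscle _ (oscleD o1 o2)).
  have -> : 2 * F * B * 1 = 2 * F * (A * (1 - eta)) by rewrite AE mulr1.
  by apply/le_of_eq; ring.
move=> x Hx; rewrite cL_real//.
have -> : cL (fun x => (f x)%:C%C * (h x)%:C%C) x = (L (fun x => f x * h x) x)%:C%C.
  rewrite -cL_real//; apply: cL_ext => // y _; by rewrite rmorphM.
rewrite -rmorphD /=; congr (_%:C)%C.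
rewrite -[X in X + _]mul1r -[X in _ + X]mul1r -L_lin//.
by apply: L_ext => // y _; rewrite !mul1r.
Qed.

Let g_dlip n : dlip (g n).
Proof. exact: real_dlip (oscle_cdlip (corr_sumP n).2). Qed.

(** The increment is [L^(n+1) (f h)]: the first application of [L] gives oscillation [2 F B], each
    further one a factor [eta]. *)
Lemma corr_sum_diffP n : I (fun x => g n.+1 x - g n x) = 0 /\
  oscle (fun x => (g n.+1 x - g n x)%:C%C) (2 * F * B * eta ^+ n).
Proof.
have I0 m : I (fun x => g m.+1 x - g m x) = 0.
  rewrite (@I_ext _ (fun x => 1 * g m.+1 x + (-1) * g m x)).
  - by rewrite I_lin// !(corr_sumP _).1 !mulr0 addr0.
  - apply: eq_dlip (dlip_lin 1 (-1) (g_dlip m.+1) (g_dlip m)) => x _.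
    by rewrite mul1r mulN1r.
  - by move=> x _; rewrite mul1r mulN1r.
split=> //; elim: n => [|n ih].
  rewrite expr0 mulr1; have := oscle_mul_f ler01 tame_h; rewrite mulr1.
  apply: eq_oscle => x Hx /=; rewrite subr0.
  rewrite -cL_real; [|by apply: eq_dlip fh_dlip => y _; rewrite add0r|by []].
  by apply: cL_ext => // y _; rewrite add0r rmorphM.
have o1 := oscle_L ih; apply: oscle_le (eq_oscle _ o1).
  by apply/le_of_eq; rewrite exprS; ring.
have gl m : dlip (fun x => g m x + f x * h x).
  by apply: eq_dlip (dlip_lin 1 1 (g_dlip m) fh_dlip) => x _; rewrite !mul1r.
have dl : dlip (fun x => g n.+1 x - g n x).
  by apply: eq_dlip (dlip_lin 1 (-1) (g_dlip n.+1) (g_dlip n)) => x _; ring.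
move=> x Hx; rewrite cL_real//; congr (_%:C)%C.
change (L (fun x => g n.+1 x - g n x) x =
  L (fun x => g n.+1 x + f x * h x) x - L (fun x => g n x + f x * h x) x).
rewrite -[X in X - _]mul1r -mulN1r -L_lin//.
by apply: L_ext => // y _; ring.
Qed.

Lemma partial_var_diff n : `|partial_var n.+1 - partial_var n| <=
  4 * nf * F * B * eta ^+ n.
Proof.
rewrite /partial_var.
rewrite (_ : _ - _ = 2 * (I (fun x => f x * g n.+1 x) - I (fun x => f x * g n x))); last by ring.
rewrite normrM (ger0_norm (_ : 0 <= 2))//.
have [h1 h2] := corr_sum_diffP n.
have := I_mul_le h2 h1.
rewrite (@I_ext _ (fun x => 1 * (f x * g n.+1 x) + (-1) * (f x * g n x))).
- by rewrite I_lin; [rewrite mul1r mulN1r; lra|exact: dM|exact: dM].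
- exact/dM/(real_dlip (oscle_cdlip h2)).
- by move=> x _; ring.
Qed.

(** The diagonal term is at most [nf^2 <= nf F A / 2], and the correlations contribute
    [4 nf F A]. *)
Lemma partial_var_le n : `|partial_var n| <= 9 / 2 * nf * F * A.
Proof.
rewrite /partial_var (le_trans (ler_normD _ _))//.
have h1 : `|I (fun x => f x ^+ 2 * h x)| <= nf * nf.
  have f2l : dlip (fun x => f x * f x) by exact: dM.
  rewrite -cabs_real -cI_real; last by apply: eq_dlip (dM f2l hlip) => x _.
  apply: cabs_cI_le => [|x Hx]; first by apply/cdlip_real/(eq_dlip _ (dM f2l hlip)).
  rewrite cabs_real normrM (ger0_norm (ltW (h_gt0 Hx))).
  apply: ler_wpM2r; first exact/ltW/h_gt0.
  by rewrite normrX expr2 ler_pM ?f_le.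
have [g0 go] := corr_sumP n; have := I_mul_le go g0.
rewrite normrM (ger0_norm (_ : 0 <= 2))// => h2.
have : nf * nf <= nf * F by rewrite ler_wpM2l// /F lerDl.
have : 2 * (nf * F) <= A * (nf * F) by rewrite ler_wpM2r// mulr_ge0.
by lra.
Qed.

(** * Normalized iterates of the twisted operator *)

Section Characteristic.
Variable t : R.
Hypothesis t_ge0 : 0 <= t.
Let s := t * F * A.
Hypothesis s_le : s <= 8^-1.

Let phi (x : R) : R[i] := cis (t * f x) - 1.
Let psi (x : R) : R[i] := cis_rem2 (t * f x).
Let chi (x : R) : R[i] := cis_rem3 (t * f x).

Definition twist (u : R -> R[i]) : R -> R[i] := cL (fun x => cis (t * f x) * u x).

(** The division is by [growth n], which [norm_iterP] keeps close to [1], hence nonzero, as long as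
    [s <= 1/8]. *)
Definition norm_iter : nat -> R -> R[i] := nat_rect _ (fun x => (h x)%:C%C)
  (fun _ u x => (cI (fun x => cis (t * f x) * u x))^-1 * twist u x).
Definition growth (n : nat) : R[i] := cI (fun x => cis (t * f x) * norm_iter n x).
Local Notation u_ := norm_iter.
Local Notation lam := growth.

Let tf_le x : X x -> `|t * f x| <= t * nf.
Proof. by move=> Hx; rewrite normrM ger0_norm// ler_wpM2l// f_le. Qed.
Let tf_lip x y : X x -> X y -> `|t * f x - t * f y| <= t * lf * d x y.
Proof. by move=> Hx Hy; rewrite -mulrBr normrM ger0_norm// -mulrA ler_wpM2l// f_lip. Qed.

Let phi_le x : X x -> cabs (phi x) <= t * nf.
Proof. by move=> Hx; rewrite (le_trans (cabs_cis_sub1 _)) ?tf_le. Qed.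
Let phi_lip x y : X x -> X y -> cabs (phi x - phi y) <= t * lf * d x y.
Proof.
move=> Hx Hy; rewrite /phi opprB addrA subrK.
by rewrite (le_trans (cabs_cisB _ _)) ?tf_lip.
Qed.
Let psi_le x : X x -> cabs (psi x) <= (t * nf) ^+ 2.
Proof.
move=> Hx; rewrite (le_trans (cabs_cis_rem2 _))//.
by rewrite -real_normK ?num_real// ler_pXn2r ?nnegrE ?tf_le// mulr_ge0.
Qed.
Let psi_lip x y : X x -> X y -> cabs (psi x - psi y) <= (t * nf) * (t * lf) * d x y.
Proof.
move=> Hx Hy; rewrite (le_trans (cabs_cis_rem2B (tf_le Hx) (tf_le Hy)))//.
by rewrite -[leRHS]mulrA; apply: ler_wpM2l; [rewrite mulr_ge0|exact: tf_lip].
Qed.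
Let chi_le x : X x -> cabs (chi x) <= (t * nf) ^+ 3.
Proof.
move=> Hx; rewrite (le_trans (cabs_cis_rem3 _))//.
by rewrite ler_pXn2r ?nnegrE ?tf_le// mulr_ge0.
Qed.

Let phi_cdlip : cdlip phi. Proof. exact: cdlip_cabs phi_lip. Qed.
Let psi_cdlip : cdlip psi. Proof. exact: cdlip_cabs psi_lip. Qed.
Let cis_cdlip : cdlip (fun x => cis (t * f x)).
Proof.
apply: (@cdlip_cabs _ (t * lf)) => x y Hx Hy.
by rewrite (le_trans (cabs_cisB _ _)) ?tf_lip.
Qed.

Let weights p l U : 0 <= p -> 0 <= l -> 0 <= U ->
  2 * U * ((1 + 2 * G) * p + 2 * l) <= 2 * U * (B * (p + l)).
Proof.
move=> p0 l0 U0; apply: ler_wpM2l; first by rewrite mulr_ge0.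
have h1 : (1 + 2 * G) * p <= B * p by rewrite ler_wpM2r.
have h2 : 2 * l <= B * l by rewrite ler_wpM2r.
by lra.
Qed.

Let oscle_phi u U : 0 <= U -> tame u U ->
  oscle (cL (fun x => phi x * u x)) (2 * t * F * B * U).
Proof.
move=> U0 tu; have p0 : 0 <= t * nf by rewrite mulr_ge0.
have l0 : 0 <= t * lf by rewrite mulr_ge0.
apply: oscle_le (oscle_mul p0 l0 U0 phi_le phi_lip tu).
by rewrite (le_trans (weights p0 l0 U0))// /F; apply/le_of_eq; ring.
Qed.

Let oscle_psi u U : 0 <= U -> tame u U ->
  oscle (cL (fun x => psi x * u x)) (2 * t ^+ 2 * nf * F * B * U).
Proof.
move=> U0 tu; have p0 : 0 <= (t * nf) ^+ 2 by rewrite sqr_ge0.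
have l0 : 0 <= (t * nf) * (t * lf) by rewrite !mulr_ge0.
apply: oscle_le (oscle_mul p0 l0 U0 psi_le psi_lip tu).
by rewrite (le_trans (weights p0 l0 U0))// /F; apply/le_of_eq; ring.
Qed.

Let s_ge0 : 0 <= s. Proof. by apply: mulr_ge0 => //; apply: mulr_ge0. Qed.
Let tFB : t * F * B = s * (1 - eta). Proof. by rewrite /s -AE; ring. Qed.
Let e1_gt0 : 0 < 1 - eta. Proof. by rewrite subr_gt0 eta_lt1. Qed.
Let e1_le1 : 1 - eta <= 1. Proof. by rewrite gerBl eta_ge0. Qed.
Let p_ge0 : 0 <= t * nf. Proof. exact: mulr_ge0. Qed.
Let p_le : t * nf <= s * (1 - eta) / 2.
Proof.
have h1 : t * nf <= t * F by rewrite ler_wpM2l// lerDl.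
have h2 : t * F * 2 <= t * F * B by rewrite ler_wpM2l// mulr_ge0.
by rewrite tFB in h2; lra.
Qed.

Let tameS u r : cdlip u -> cI u = 1 -> oscle u r ->
  tame (fun x => u x - (h x)%:C%C) r.
Proof.
move=> ul u1 o; apply: oscle_tame.
  by rewrite -[r]addr0; apply: eq_oscle (oscleD o (oscle_h (-1))) => x _; rewrite mulN1r.
rewrite (@cI_ext _ (fun x => 1 * u x + (-1) * (h x)%:C%C)).
- rewrite cI_lin ?cI_h ?u1; [by ring|by []|exact: cdlip_real].
- by apply: (eq_cdlip _ (cdlip_lin 1 (-1) ul (cdlip_real hlip))) => x _; ring.
- by move=> x _; ring.
Qed.

Let tame1 u r : cdlip u -> cI u = 1 -> oscle u r -> tame u (r + 1).
Proof.
move=> ul u1 o; apply: eq_tame (tameD (tameS ul u1 o) tame_h) => x _.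
by rewrite subrK.
Qed.

Let cI_phi u : cdlip u ->
  cI (fun x => cis (t * f x) * u x) = cI u + cI (fun x => phi x * u x).
Proof.
move=> ul; have ml := cdlipM phi_cdlip ul.
rewrite -[cI u]mul1r -[X in _ + X]mul1r -cI_lin//.
apply: cI_ext => [|x _]; first exact: cdlipM.
by rewrite /phi; ring.
Qed.

(** Centring of [f] removes the linear term of [exp(i t f) - 1], so the integral is of second order
    in [t]. *)
Let cI_phi_h : cI (fun x => phi x * (h x)%:C%C) = cI (fun x => psi x * (h x)%:C%C).
Proof.
have fhl : cdlip (fun x => (f x * h x)%:C%C) by exact: cdlip_real.
have hl := cdlip_real hlip.
have -> : cI (fun x => psi x * (h x)%:C%C) =
    1 * cI (fun x => psi x * (h x)%:C%C) + (0 +i* t)%C * cI (fun x => (f x * h x)%:C%C).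
  by rewrite cI_real// I_fh mulr0 addr0 mul1r.
rewrite -cI_lin//; last exact: cdlipM.
apply: cI_ext => [|x _]; first exact: cdlipM.
rewrite /phi /psi /cis_rem2 (rmorphM _ (f x)) /=.
by rewrite imag_mul; ring.
Qed.

(** [7/4 = 1/4 + 3/2]: with [t nf <= s (1 - eta) / 2], the first part bounds the integral of [psi h]
    and the second that of [phi (u - h)], where [u - h] has size [3 s] relative to [h]. *)
Let growth_eq u r : cdlip u -> cI u = 1 -> oscle u r -> r = 3 * s ->
  cabs (cI (fun x => cis (t * f x) * u x) - 1) <= 7 / 4 * s ^+ 2 * (1 - eta).
Proof.
move=> ul u1 o rE; have ts := tameS ul u1 o.
have hl := cdlip_real hlip.
have dl : cdlip (fun x => u x - (h x)%:C%C).
  by apply: (eq_cdlip _ (cdlip_lin 1 (-1) ul hl)) => x _; ring.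
rewrite cI_phi// u1 addrC addKr.
rewrite (@cI_ext _ (fun x => 1 * (phi x * (h x)%:C%C) + 1 * (phi x * (u x - (h x)%:C%C)))).
- rewrite cI_lin; [|exact: cdlipM|exact: cdlipM]; rewrite !mul1r cI_phi_h.
  apply: (le_trans (cabsD _ _)).
  have k1 := cabs_cI_mul psi_cdlip hl (sqr_ge0 _) psi_le tame_h.
  have k2 := cabs_cI_mul phi_cdlip dl p_ge0 phi_le ts.
  apply: (le_trans (lerD k1 k2)); rewrite rE mulr1.
  have q1 : (t * nf) ^+ 2 <= (s * (1 - eta) / 2) ^+ 2.
    by rewrite ler_pXn2r ?nnegrE// divr_ge0// mulr_ge0// ltW.
  have q2 : t * nf * (3 * s) <= s * (1 - eta) / 2 * (3 * s).
    by rewrite ler_wpM2r// mulr_ge0.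
  have q3 : (s * (1 - eta)) ^+ 2 <= s ^+ 2 * (1 - eta).
    rewrite exprMn ler_wpM2l ?sqr_ge0// expr2.
    by rewrite ler_piMl// ltW.
  by lra.
- exact: cdlipM.
- by move=> x _; ring.
Qed.

Let small_sq : s ^+ 2 <= s / 8.
Proof. by rewrite expr2 ler_wpM2l// (le_trans s_le)//; lra. Qed.

Let growth_neq0 z : cabs (z - 1) <= 7 / 4 * s ^+ 2 * (1 - eta) ->
  1 - 7 / 4 * s ^+ 2 * (1 - eta) <= cabs z /\ 0 < cabs z.
Proof.
move=> h1; have h2 : cabs 1 <= cabs z + cabs (z - 1).
  by rewrite {1}(_ : 1 = z - (z - 1)) ?cabsB//; ring.
rewrite cabs1 in h2.
have h3 : s ^+ 2 * (1 - eta) <= s ^+ 2 * 1 by rewrite ler_wpM2l ?sqr_ge0.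
by have := small_sq; have := s_le; split; lra.
Qed.

(** Stability of the bound [3 s]: a twisted step gives oscillation at most
    [eta (3 s) + 2 s (1 - eta) (3 s + 1)], and normalizing divides by at least
    [1 - 7/4 s^2 (1 - eta)]. This closes when [2 + 6 s + 21/4 s^2 <= 3], true for [s <= 1/8]. *)
Lemma norm_iterP n : [/\ cI (u_ n) = 1, oscle (u_ n) (3 * s) &
  cabs (lam n - 1) <= 7 / 4 * s ^+ 2 * (1 - eta)].
Proof.
have step u : cI u = 1 -> oscle u (3 * s) -> [/\ cI u = 1, oscle u (3 * s) &
    cabs (cI (fun x => cis (t * f x) * u x) - 1) <= 7 / 4 * s ^+ 2 * (1 - eta)].
  by move=> u1 o; split=> //; apply: (growth_eq (oscle_cdlip o) u1 o).
elim: n => [|n [u1 o hl]].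
  apply: step; first exact: cI_h.
  apply: (oscle_le (r := 0)); first exact: mulr_ge0.
  by apply: eq_oscle (oscle_h 1) => x _; rewrite mul1r.
have ul := oscle_cdlip o.
have [lge lgt] := growth_neq0 hl.
have l0 : lam n != 0 by apply: contraTneq lgt => ->; rewrite cabs0 ltxx.
have cl : cdlip (fun x => cis (t * f x) * u_ n x) by exact: cdlipM.
have o' : oscle (twist (u_ n)) (eta * (3 * s) + 2 * t * F * B * (3 * s + 1)).
  have k1 := oscle_L o.
  have k2 := oscle_phi (_ : 0 <= 3 * s + 1) (tame1 ul u1 o).
  apply: eq_oscle (oscleD k1 (k2 _)) => [x Hx|]; last by rewrite addr_ge0// mulr_ge0.
  rewrite -[X in X + _]mul1r -[X in _ + X]mul1r -cL_lin//; last exact: cdlipM.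
  by apply: cL_ext => // y _; rewrite /phi; ring.
apply: step.
  change (cI (fun x => (lam n)^-1 * twist (u_ n) x) = 1).
  have tl := oscle_cdlip o'.
  rewrite (@cI_ext _ (fun x => (lam n)^-1 * twist (u_ n) x + 0 * twist (u_ n) x)).
  - rewrite cI_lin// mul0r addr0 cI_L// -[X in _ * X]/(lam n) mulVf//.
  - by apply: (eq_cdlip _ (cdlip_lin (lam n)^-1 0 tl tl)) => x _; rewrite mul0r addr0.
  - by move=> x _; rewrite mul0r addr0.
apply: oscle_le (oscleZ (lam n)^-1 o').
rewrite cabsV -ler_pdivlMl ?invr_gt0// invrK.
have -> : 2 * t * F * B * (3 * s + 1) = 2 * (s * (1 - eta)) * (3 * s + 1).
  by rewrite -tFB; ring.
have h3 : (1 - 7 / 4 * s ^+ 2 * (1 - eta)) * (3 * s) <= cabs (lam n) * (3 * s).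
  by rewrite ler_wpM2r// mulr_ge0.
apply: le_trans h3.
have h4 : s ^+ 3 <= s / 64.
  rewrite exprS; have : s * s ^+ 2 <= s * (s / 8) by rewrite ler_wpM2l// small_sq.
  by have := small_sq; lra.
have h5 : s * (1 - eta) * (2 + 6 * s + 21 / 4 * s ^+ 2 - 3) <= 0.
  rewrite mulr_ge0_le0//; first by rewrite mulr_ge0// ltW.
  by have := small_sq; have := s_le; lra.
by lra.
Qed.

Lemma twist_iterE n x : X x ->
  iter n twist (fun x => (h x)%:C%C) x = (\prod_(k < n) lam k) * u_ n x.
Proof.
elim: n x => [|n ih] x Hx; first by rewrite big_ord0 mul1r.
have [u1 o hl] := norm_iterP n; have [_ lgt] := growth_neq0 hl.
have l0 : lam n != 0 by apply: contraTneq lgt => ->; rewrite cabs0 ltxx.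
have cl : cdlip (fun x => cis (t * f x) * u_ n x).
  exact/cdlipM/(oscle_cdlip o).
rewrite iterS big_ord_recr /= -[X in _ * X * _]/(lam n) mulrA mulfK//.
rewrite [LHS]/twist (@cL_ext _ (fun x => (\prod_(k < n) lam k) * (cis (t * f x) * u_ n x)
    + 0 * (cis (t * f x) * u_ n x))) //.
  by rewrite cL_lin// mul0r addr0.
by move=> y Hy; rewrite ih//; ring.
Qed.

Lemma cI_twist_iter n :
  cI (iter n twist (fun x => (h x)%:C%C)) = \prod_(k < n) lam k.
Proof.
have [u1 o hl] := norm_iterP n; have ul := oscle_cdlip o.
pose P := \prod_(k < n) lam k.
have cl : cdlip (fun x => P * u_ n x + 0 * u_ n x) by exact: cdlip_lin.
rewrite -(@cI_ext (fun x => P * u_ n x + 0 * u_ n x))//.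
  by rewrite cI_lin// u1 mul0r addr0 mulr1.
by move=> x Hx; rewrite twist_iterE// mul0r addr0.
Qed.

Let it : R[i] := (0 +i* t)%C.
Let rem n (x : R) : R[i] := u_ n x - (h x)%:C%C - it * (g n x)%:C%C.

Let cabs_it : cabs it = t.
Proof. by rewrite /it /cabs /= expr0n/= add0r sqrtr_sqr ger0_norm. Qed.

Let itE (y : R) : ((0 : R) +i* (t * y))%C = it * y%:C%C.
Proof. exact: imag_mul. Qed.

(** [rem n] is the second-order part of [u_ n = h + i t g_n + ...]. One step adds to [L rem] the
    functions [L (psi h)], [L (phi (u_ n - h))] and [(1 - lam n) u_(n+1)], of oscillation at most
    [1], [6] and [21/32] times [s^2 (1 - eta)]; the total stays below [8 s^2 (1 - eta)]. *)
Let remP n : cI (rem n) = 0 /\ oscle (rem n) (8 * s ^+ 2).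
Proof.
have hl := cdlip_real hlip.
have gl m := cdlip_real (g_dlip m).
have remE m x : rem m x = 1 * (1 * u_ m x + (-1) * (h x)%:C%C) + (- it) * (g m x)%:C%C.
  by rewrite /rem; ring.
have reml m : cdlip (rem m).
  have [_ /oscle_cdlip ul _] := norm_iterP m.
  apply: (eq_cdlip (fun x _ => esym (remE m x))).
  by apply: cdlip_lin => //; exact: cdlip_lin.
split.
  have [u1 /oscle_cdlip ul _] := norm_iterP n.
  rewrite (cI_ext (reml n) (fun x _ => remE n x)) cI_lin//; last exact: cdlip_lin.
  by rewrite cI_lin// u1 cI_h cI_real ?(corr_sumP n).1 ?mulr0//; ring.
elim: n => [|n ih].
  apply: (oscle_le (r := 0)); first by rewrite mulr_ge0 ?sqr_ge0.
  by apply: eq_oscle (oscle_h 0) => x _; rewrite /rem /= mul0r subrr sub0r mulr0 oppr0.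
have [u1 o hlam] := norm_iterP n; have ul := oscle_cdlip o.
have [u1' o' _] := norm_iterP n.+1; have ul' := oscle_cdlip o'.
have [_ lgt] := growth_neq0 hlam.
have l0 : lam n != 0 by apply: contraTneq lgt => ->; rewrite cabs0 ltxx.
have dl : cdlip (fun x => u_ n x - (h x)%:C%C).
  by apply: (eq_cdlip _ (cdlip_lin 1 (-1) ul hl)) => x _; ring.
have k1 := oscle_L ih.
have k2 := oscle_psi ler01 tame_h.
have k3 := oscle_phi (mulr_ge0 _ s_ge0) (tameS ul u1 o).
have k4 := oscleZ (1 - lam n) o'.
have k5 := oscle_h (-1).
apply: oscle_le (eq_oscle _ (oscleD (oscleD (oscleD k1 k2) (k3 (ler0n _ 3))) k4)).
  have -> : 2 * t * F * B * (3 * s) = 6 * s ^+ 2 * (1 - eta).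
    have e : 2 * t * F * B = 2 * (s * (1 - eta)) by rewrite -tFB; ring.
    by rewrite e; ring.
  have -> : 2 * t ^+ 2 * nf * F * B * 1 = 2 * (t * nf) * (s * (1 - eta)).
    by rewrite -tFB; ring.
  have h1 : 2 * (t * nf) * (s * (1 - eta)) <= s ^+ 2 * (1 - eta).
    have : t * nf * (s * (1 - eta)) <= s * (1 - eta) / 2 * (s * (1 - eta)).
      by rewrite ler_wpM2r// mulr_ge0// ltW.
    have : (s * (1 - eta)) ^+ 2 <= s ^+ 2 * (1 - eta).
      by rewrite exprMn ler_wpM2l ?sqr_ge0// expr2 ler_piMl// ltW.
    by lra.
  have h2 : cabs (1 - lam n) * (3 * s) <= 21 / 4 * s ^+ 3 * (1 - eta).
    rewrite -cabsN opprB.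
    have := ler_wpM2r (mulr_ge0 (ler0n R 3) s_ge0) hlam; lra.
  have h3 : s ^+ 3 * (1 - eta) <= s ^+ 2 / 8 * (1 - eta).
    rewrite ler_wpM2r ?(ltW e1_gt0)// exprS mulrC.
    by rewrite ler_wpM2l ?sqr_ge0// (le_trans s_le).
  have h4 : 0 <= s ^+ 2 * (1 - eta) by rewrite mulr_ge0 ?sqr_ge0// ltW.
  by lra.
move=> x Hx.
have eg : g n.+1 x = L (g n) x + L (fun x => f x * h x) x.
  rewrite /= -[X in X + _]mul1r -[X in _ + X]mul1r -L_lin//.
  by apply: L_ext => // y _; rewrite !mul1r.
have e1 : cL (rem n) x = cL (u_ n) x - (h x)%:C%C - it * (L (g n) x)%:C%C.
  rewrite (cL_ext (fun y _ => remE n y) Hx) cL_lin//; last exact: cdlip_lin.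
  by rewrite cL_lin// !cL_real// L_h//; ring.
have e2 : cL (fun x => psi x * (h x)%:C%C) x =
    cL (fun x => phi x * (h x)%:C%C) x - it * (L (fun x => f x * h x) x)%:C%C.
  rewrite -cL_real// -mulNr -[X in X + _]mul1r -cL_lin//; [|exact: cdlipM|exact: cdlip_real].
  by apply: cL_ext => // y _; rewrite /psi /phi /cis_rem2 itE rmorphM; ring.
have e3 : cL (fun x => phi x * (u_ n x - (h x)%:C%C)) x =
    cL (fun x => phi x * u_ n x) x - cL (fun x => phi x * (h x)%:C%C) x.
  rewrite -[X in X - _]mul1r -mulN1r -cL_lin//; [|exact: cdlipM|exact: cdlipM].
  by apply: cL_ext => // y _; ring.
have e4 : cL (u_ n) x + cL (fun x => phi x * u_ n x) x = lam n * u_ n.+1 x.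
  rewrite [X in _ = _ * X]/= -/(lam n) mulVKf// /twist.
  rewrite -[X in X + _]mul1r -[X in _ + X]mul1r -cL_lin//; last exact: cdlipM.
  by apply: cL_ext => // y _; rewrite /phi; ring.
have e5 : cL (u_ n) x = lam n * u_ n.+1 x - cL (fun x => phi x * u_ n x) x.
  by rewrite -e4 addrK.
by rewrite e1 e2 e3 e5 /rem eg rmorphD; ring.
Qed.

(** [lam n - 1] is the integral of [phi u_ n]. Inserting [u_ n = h + i t g_n + rem n], with [phi]
    expanded further against [h] and [g_n], leaves [- partial_var n t^2 / 2] and three remainders,
    at most [nf^2], [2 nf F A] and [8 F^2 A^2] times [nf t^3]. *)
Lemma growth_expansion n :
  cabs (lam n - (1 - partial_var n * t ^+ 2 / 2)%:C%C) <=
  10 * (nf * F ^+ 2 * A ^+ 2) * t ^+ 3.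
Proof.
have hl := cdlip_real hlip; have gl := g_dlip n.
have [u1 o _] := norm_iterP n; have ul := oscle_cdlip o.
have [r0 ro] := remP n; have rl := oscle_cdlip ro.
have [g0 go] := corr_sumP n.
have fhl := cdlip_real fh_dlip.
have f2hl : dlip (fun x => f x ^+ 2 * h x).
  by have := dM (dM f_dlip f_dlip) hlip; apply: eq_dlip.
have fgl : dlip (fun x => f x * g n x) by exact: dM.
have chil : cdlip chi.
  have f2l : dlip (fun x => f x * f x) by exact: dM.
  apply: (eq_cdlip _ (cdlip_lin 1 ((t ^+ 2 / 2)%:C%C) psi_cdlip (cdlip_real f2l))) => x _.
  by rewrite /chi /cis_rem3 mul1r -rmorphM; congr (_ + _%:C)%C; ring.
have E : lam n - (1 - partial_var n * t ^+ 2 / 2)%:C%C =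
    cI (fun x => chi x * (h x)%:C%C) + it * cI (fun x => psi x * (g n x)%:C%C) +
    cI (fun x => phi x * rem n x).
  have -> : lam n = 1 + cI (fun x => phi x * u_ n x) by rewrite /growth cI_phi// u1.
  have -> : cI (fun x => phi x * u_ n x) = cI (fun x => psi x * (h x)%:C%C) +
      it * cI (fun x => phi x * (g n x)%:C%C) + cI (fun x => phi x * rem n x).
    rewrite -cI_phi_h.
    rewrite (@cI_ext _ (fun x => 1 * (1 * (phi x * (h x)%:C%C) +
       it * (phi x * (g n x)%:C%C)) + 1 * (phi x * rem n x))).
    - have l1 : cdlip (fun x => phi x * (h x)%:C%C) by exact: cdlipM.
      have l2 : cdlip (fun x => phi x * (g n x)%:C%C) by apply: cdlipM; last exact: cdlip_real.
      have l3 : cdlip (fun x => phi x * rem n x) by exact: cdlipM.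
      by rewrite cI_lin ?cI_lin ?mul1r//; exact: cdlip_lin.
    - exact: cdlipM.
    - by move=> x _; rewrite /rem; ring.
  have -> : cI (fun x => psi x * (h x)%:C%C) = cI (fun x => chi x * (h x)%:C%C)
      - (t ^+ 2 / 2 * I (fun x => f x ^+ 2 * h x))%:C%C.
    rewrite (realCM (t ^+ 2 / 2)) -cI_real// -mulNr -[X in X + _]mul1r -cI_lin//;
      [|exact: cdlipM|exact: cdlip_real].
    apply: cI_ext => [|x _]; first exact: cdlipM.
    by rewrite /chi /cis_rem3 -/(psi x) rmorphM exprMn mulrAC !rmorphM; ring.
  have -> : cI (fun x => phi x * (g n x)%:C%C) = cI (fun x => psi x * (g n x)%:C%C)
      + it * (I (fun x => f x * g n x))%:C%C.
    rewrite -cI_real// -[X in X + _]mul1r -cI_lin//;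
      [|by apply: cdlipM => //; exact: cdlip_real|exact: cdlip_real].
    apply: cI_ext => [|x _]; first by apply: cdlipM => //; exact: cdlip_real.
    by rewrite /phi /psi /cis_rem2 itE rmorphM; ring.
  have it2 : it * it = - (t ^+ 2)%:C%C.
    by rewrite /it {1}/GRing.mul /= expr2; congr Complex; ring.
  rewrite mulrDr mulrA it2 /partial_var mulrDl mulrDl !rmorphB rmorphD !rmorphM /=.
  have -> : (2^-1 : R)%:C%C = 2^-1.
    by rewrite fmorphV rmorph_nat.
  have -> : (2 : R)%:C%C = 2 by rewrite rmorph_nat.
  by field.
rewrite E.
have c1 := cabs_cI_mul chil hl (exprn_ge0 3 p_ge0) chi_le tame_h.
have c2 := cabs_cI_mul psi_cdlip (cdlip_real gl) (sqr_ge0 _) psi_le (tame_real go g0).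
have c3 := cabs_cI_mul phi_cdlip rl p_ge0 phi_le (oscle_tame ro r0).
apply: (le_trans (cabsD _ _)); apply: (le_trans (lerD (cabsD _ _) c3)).
rewrite cabsM cabs_it; apply: (le_trans (lerD (lerD c1 (ler_wpM2l t_ge0 c2)) (lexx _))).
have nfF : nf <= F by rewrite /F lerDl.
have w1 : 0 <= nf * t ^+ 3 by rewrite mulr_ge0// exprn_ge0.
have m1 : nf ^+ 2 <= F ^+ 2 by rewrite ler_pXn2r ?nnegrE.
have m2 : nf * F <= F ^+ 2 by rewrite expr2 ler_wpM2r.
have m3 : 4 <= A ^+ 2 by have := A_ge2; rewrite expr2; nra.
have m4 : 2 * A <= A ^+ 2 by rewrite expr2 ler_wpM2r.
have F2 : 0 <= F ^+ 2 by exact: sqr_ge0.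
have q1 : nf ^+ 2 + 2 * (nf * F) * A + 8 * (F ^+ 2 * A ^+ 2) <= 10 * (F ^+ 2 * A ^+ 2).
  have : F ^+ 2 * 4 <= F ^+ 2 * A ^+ 2 by rewrite ler_wpM2l.
  have : F ^+ 2 * (2 * A) <= F ^+ 2 * A ^+ 2 by rewrite ler_wpM2l.
  have : nf * F * A <= F ^+ 2 * A by rewrite ler_wpM2r.
  by lra.
have := ler_wpM2l w1 q1; rewrite /s; lra.
Qed.

End Characteristic.

Lemma partial_var_dist n m : (n <= m)%N ->
  `|partial_var m - partial_var n| <= 4 * nf * F * A * (eta ^+ n - eta ^+ m).
Proof.
elim: m => [|m ih]; first by rewrite leqn0 => /eqP ->; rewrite !subrr normr0 mulr0.
rewrite leq_eqVlt => /predU1P[->|]; first by rewrite !subrr normr0 mulr0.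
rewrite ltnS => /ih h1; have h2 := partial_var_diff m.
rewrite -(subrK (partial_var m) (partial_var m.+1)) -addrA (le_trans (ler_normD _ _))//.
apply: (le_trans (lerD h2 h1)); apply: le_of_eq.
by rewrite -AE exprS; ring.
Qed.

(** Adding the geometric majorant of the increments makes the sequence monotone and bounded, hence
    convergent; the Cesaro means then identify its limit as [v]. *)
Lemma partial_var_cvg (v : R) :
  (n%:R^-1 * \sum_(0 <= k < n) partial_var k) @[n --> \oo] --> v ->
  partial_var n @[n --> \oo] --> v.
Proof.
move=> hv; pose c := 4 * nf * F * A.
have c0 : 0 <= c by apply: mulr_ge0 => //; apply: mulr_ge0 => //; exact: mulr_ge0.
have lb n : - (9 / 2 * nf * F * A) <= partial_var n + c * eta ^+ n.
  have := partial_var_le n; rewrite ler_norml => /andP[pl _].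
  by rewrite (le_trans pl)// lerDl mulr_ge0// exprn_ge0// eta_ge0.
have ni : nonincreasing_seq (fun n => partial_var n + c * eta ^+ n).
  apply/nonincreasing_seqP => n; have := partial_var_dist (leqnSn n).
  by rewrite ler_norml -/c => /andP[_ pl]; lra.
have cv1 : cvgn (fun n => partial_var n + c * eta ^+ n).
  apply: nonincreasing_is_cvgn => //.
  by exists (- (9 / 2 * nf * F * A)) => _ [n _ <-]; exact: lb.
have eta0 : c * eta ^+ n @[n --> \oo] --> 0.
  rewrite -(mulr0 c); apply: cvgMr => //; apply: cvg_expr.
  by rewrite ger0_norm ?eta_ge0// eta_lt1.
have cv2 : partial_var n @[n --> \oo] --> limn (fun n => partial_var n + c * eta ^+ n).
  set l := limn _.
  rewrite -[l]subr0 (_ : partial_var = (fun n => partial_var n + c * eta ^+ n - c * eta ^+ n)).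
    by apply: cvgB => //; exact: cv1.
  by apply/funext => n; rewrite addrK.
suff -> : v = limn (fun n => partial_var n + c * eta ^+ n) by [].
apply: (cvg_unique _ _ (cesaro cv2)) => //.
(* The Cesaro theorem averages the first [n + 1] terms, whence the shift. *)
rewrite -(cvg_shiftS (fun n => n%:R^-1 * \sum_(0 <= k < n) partial_var k)) in hv.
by move: hv; apply: cvg_trans; apply: near_eq_cvg; near=> n.
Unshelve. all: by end_near. Qed.

Lemma partial_var_lim_dist (v : R) : partial_var n @[n --> \oo] --> v ->
  forall n, `|v - partial_var n| <= 4 * nf * F * A * eta ^+ n.
Proof.
move=> hv n; have c0 : 0 <= 4 * nf * F * A.
  by apply: mulr_ge0 => //; apply: mulr_ge0 => //; exact: mulr_ge0.
have lim : `|partial_var m - partial_var n| @[m --> \oo] --> `|v - partial_var n|.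
  by apply: cvg_norm; apply: cvgB => //; exact: cvg_cst.
apply: (cvgr_to_le lim); near=> m.
have nm : (n <= m)%N by near: m; exact: nbhs_infty_ge.
rewrite (le_trans (partial_var_dist nm))// ler_wpM2l// gerBl exprn_ge0//.
exact: eta_ge0.
Unshelve. all: by end_near. Qed.

Lemma partial_var_lim_le (v : R) : partial_var n @[n --> \oo] --> v ->
  v <= 9 / 2 * nf * F * A.
Proof.
move=> hv; apply: (cvgr_to_le hv); near=> n.
by apply: le_trans (partial_var_le n); exact: ler_norm.
Unshelve. all: by end_near. Qed.

(** The factors are compared with [e = exp(- v t^2 / 2)], while their moduli are bounded with half
    of the decay, [rho = exp(- v t^2 / 4)]: the condition [40 k t <= v] makes the cubic error
    [10 k t^3] at most [v t^2 / 4]. The term in [t^2] sums the discrepancies [v - partial_var m] and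
    does not grow with [n]. *)
Lemma cI_twist_bound (v t : R) (n : nat) : 0 < v -> 0 <= t ->
  (m%:R^-1 * \sum_(0 <= k < m) partial_var k) @[m --> \oo] --> v ->
  40 * (nf * F ^+ 2 * A ^+ 2) * t <= v ->
  cabs (cI (iter n (twist t) (fun x => (h x)%:C%C)) - (expR (- (n%:R * (v * t ^+ 2 / 2))))%:C%C)
  <= 11 / 10 * expR (- (n%:R * (v * t ^+ 2 / 4))) *
     (n%:R * (11 * (nf * F ^+ 2 * A ^+ 2) * t ^+ 3) + nf * F * A ^+ 2 * t ^+ 2).
Proof.
move=> v0 t0 hv tv; have {}hv := partial_var_cvg hv.
have dist := partial_var_lim_dist hv; have vle := partial_var_lim_le hv.
have nFA : 0 < nf * F * A by lra.
have FAt0 : 0 <= t * F * A by apply: mulr_ge0 => //; exact: mulr_ge0.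
(* The threshold on [t] gives [40 (nf F A) s <= v <= 9/2 nf F A], hence [s <= 9/80]. *)
have sle : t * F * A <= 8^-1.
  rewrite -(ler_pM2l nFA).
  have e : 40 * (nf * F ^+ 2 * A ^+ 2) * t = 40 * (nf * F * A * (t * F * A)) by ring.
  by rewrite e in tv; lra.
have nftA : nf * t * A <= t * F * A.
  by rewrite ler_wpM2r// mulrC ler_wpM2l// lerDl.
have nft0 : 0 <= nf * t by exact: mulr_ge0.
have nft : nf * t <= 16^-1.
  have : nf * t * 2 <= nf * t * A by rewrite ler_wpM2l.
  by lra.
have nFt : (nf * t) * (t * F * A) <= 16^-1 * 8^-1 by exact: ler_pM.
set k := nf * F ^+ 2 * A ^+ 2 in tv *.
have k0 : 0 <= k by rewrite /k mulr_ge0 ?sqr_ge0// mulr_ge0 ?sqr_ge0.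
pose th m := `|v - partial_var m|.
(* Geometric sum: [A (1 - eta) = B] turns division by [1 - eta] into a factor [A], and [B >= 2]
   halves the constant. *)
have sum_th : \sum_(m < n) th m <= 2 * nf * F * A ^+ 2.
  have th0 : 0 <= \sum_(m < n) th m by apply: sumr_ge0 => i _; exact: normr_ge0.
  have e : (1 - eta) * \sum_(m < n) th m <= 4 * nf * F * A * (1 - eta ^+ n).
    elim: n {th0} => [|m ih]; first by rewrite big_ord0 mulr0 expr0 subrr mulr0.
    rewrite big_ord_recr /= mulrDr; have := dist m; rewrite -/(th m).
    have e0 : 0 <= 1 - eta by rewrite subr_ge0 ltW// eta_lt1.
    move=> /(ler_wpM2l e0); rewrite exprS; lra.
  have e2 := ler_wpM2l A_ge0 e; rewrite mulrA AE in e2.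
  have e3 : 2 * \sum_(m < n) th m <= B * \sum_(m < n) th m by rewrite ler_wpM2r.
  have e4 : 0 <= A * (nf * F * A) * eta ^+ n.
    by rewrite mulr_ge0 ?exprn_ge0 ?eta_ge0// mulr_ge0// ltW.
  by lra.
rewrite cI_twist_iter//.
have exp_lam m := growth_expansion t0 sle m.
pose e := expR (- (v * t ^+ 2 / 2)); pose rho := expR (- (v * t ^+ 2 / 4)).
(* [11 = 10 + 1]: ten from [growth_expansion], one from replacing [1 - v t^2 / 2] by its
   exponential, an error at most [k t^3] by [vt_sq]. *)
pose w m := th m * t ^+ 2 / 2; pose q m := th m * t ^+ 2 / 2 + 11 * k * t ^+ 3.
have t2 := sqr_ge0 t; have vt2 : 0 <= v * t ^+ 2 := mulr_ge0 (ltW v0) t2.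
have small (z : R) : z <= 9 / 2 * nf * F * A -> z * t ^+ 2 <= 9 / 256.
  by move=> /(ler_wpM2r t2); lra.
have vt_small : v * t ^+ 2 <= 9 / 256 by exact: small.
have vt_sq : (v * t ^+ 2 / 2) ^+ 2 <= k * t ^+ 3.
  have h1 : (v * t ^+ 2 / 2) ^+ 2 <= (9 / 4 * nf * F * A * t ^+ 2) ^+ 2.
    have g1 : 0 <= v * t ^+ 2 / 2 by lra.
    have g2 : v * t ^+ 2 / 2 <= 9 / 4 * nf * F * A * t ^+ 2 by have := ler_wpM2r t2 vle; lra.
    by rewrite ler_pXn2r ?nnegrE// (le_trans g1).
  have h2 : (nf * t) * (k * t ^+ 3) <= 16^-1 * (k * t ^+ 3).
    by rewrite ler_wpM2r// mulr_ge0 ?exprn_ge0.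
  have h3 : (9 / 4 * nf * F * A * t ^+ 2) ^+ 2 = 81 / 16 * ((nf * t) * (k * t ^+ 3)).
    by rewrite /k; field.
  have : 0 <= k * t ^+ 3 by rewrite mulr_ge0 ?exprn_ge0.
  by lra.
have pv_small m : partial_var m * t ^+ 2 <= 9 / 256.
  by apply: small; apply: le_trans (partial_var_le m); exact: ler_norm.
have kt3 : 10 * k * t ^+ 3 <= v * t ^+ 2 / 4.
  by have := ler_wpM2r t2 tv; lra.
have kt0 : 0 <= k * t ^+ 3 by rewrite mulr_ge0 ?exprn_ge0.
have w0 m : 0 <= w m by rewrite /w divr_ge0// mulr_ge0 ?normr_ge0.
have q0 m : 0 <= q m by rewrite addr_ge0 ?w0//; lra.
have th_le m : `|(v - partial_var m) * t ^+ 2 / 2| = w m.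
  by rewrite (normrM _ 2^-1) (normrM _ (t ^+ 2)) (ger0_norm t2) (ger0_norm (_ : 0 <= 2^-1)).
have P := @prod_telescope_le R (growth t) e rho w q _ _ w0 q0 _ _ n.
have {P} : rho * cabs (\prod_(k < n) growth t k - (e ^+ n)%:C%C) <=
    rho ^+ n * expR (\sum_(k < n) w k) * \sum_(k < n) q k.
  apply: P.
  - by rewrite expR_ge0/= /e /rho ler_expR; lra.
  - have h1 : rho <= expR 0 by rewrite /rho ler_expR; lra.
    by rewrite expR0 in h1.
  - move=> m; rewrite -[growth t m](subrK (1 - partial_var m * t ^+ 2 / 2)%:C%C).
    rewrite (le_trans (cabsD _ _))// (le_trans (lerD (exp_lam m) (lexx _)))//.
    rewrite cabs_real ger0_norm; last by have := pv_small m; lra.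
    rewrite /rho -expRD; apply: le_trans (expR_ge1Dx _).
    have := th_le m; have := ler_norm ((v - partial_var m) * t ^+ 2 / 2).
    by move=> h1 h2; rewrite h2 in h1; rewrite -/k; lra.
  - move=> m; rewrite -(subrK (1 - partial_var m * t ^+ 2 / 2)%:C%C (growth t m)) -addrA.
    rewrite (le_trans (cabsD _ _))// (le_trans (lerD (exp_lam m) (lexx _)))// cabs_realB.
    have x0 : 0 <= v * t ^+ 2 / 2 by lra.
    have h1 := expRN_taylor x0.
    have h2 : `|1 - partial_var m * t ^+ 2 / 2 - e| <= w m + k * t ^+ 3.
      rewrite -(th_le m) (_ : _ - e = (v - partial_var m) * t ^+ 2 / 2 +
        (1 - v * t ^+ 2 / 2 - e)); last by ring.
      by rewrite (le_trans (ler_normD _ _))// lerD2l (le_trans h1).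
    by rewrite /q -/(w m) -/k; lra.
have en : e ^+ n = expR (- (n%:R * (v * t ^+ 2 / 2))).
  by rewrite /e -expRM_natl mulrN.
have rn : rho ^+ n = expR (- (n%:R * (v * t ^+ 2 / 4))).
  by rewrite /rho -expRM_natl mulrN.
rewrite en rn => P.
have sum_w : \sum_(m < n) w m <= 64^-1.
  rewrite /w -mulr_suml -mulr_suml.
  have h1 := ler_wpM2r t2 sum_th.
  have h2 : (nf * t * A) * (t * F * A) <= 8^-1 * 8^-1.
    by apply: ler_pM => //; [exact: mulr_ge0|exact: le_trans nftA sle].
  by lra.
have sum_q : \sum_(m < n) q m <= n%:R * (11 * k * t ^+ 3) + nf * F * A ^+ 2 * t ^+ 2.
  rewrite /q big_split /= sumr_const card_ord -[X in _ + X]mulr_natl addrC lerD2l.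
  rewrite -mulr_suml -mulr_suml.
  have := ler_wpM2r t2 sum_th; lra.
have rho_gt0 : 0 < rho := expR_gt0 _.
(* The power of [rho] owed by [prod_telescope_le] is repaid here: the exponents together are at most
   [1/64 + 9/1024 = 25/1024]. *)
have fin : expR (\sum_(m < n) w m) <= rho * (11 / 10).
  have h1 : expR (\sum_(m < n) w m + v * t ^+ 2 / 4) <= 11 / 10.
    have h2 : \sum_(m < n) w m + v * t ^+ 2 / 4 <= 25 / 1024 by lra.
    apply: (@le_trans _ _ (expR (25 / 1024))); first by rewrite ler_expR.
    have h3 := expR_ge1Dx (- (25 / 1024 : R)).
    rewrite -[X in expR X]opprK expRN -[leLHS]mul1r ler_pdivrMr ?expR_gt0//.
    by lra.
  rewrite -ler_pdivrMl// /rho expRN invrK -expRD addrC; exact: h1.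
rewrite -(ler_pM2l rho_gt0); apply: (le_trans P).
set E := expR (- (n%:R * _)).
have E0 : 0 <= E := expR_ge0 _.
rewrite (_ : rho * _ = E * (rho * (11 / 10)) * (n%:R * (11 * k * t ^+ 3) +
  nf * F * A ^+ 2 * t ^+ 2)); last by ring.
apply: ler_pM => //; [by rewrite mulr_ge0 ?expR_ge0|by apply: sumr_ge0|].
by rewrite ler_wpM2l.
Qed.

End Perturbation.

End Operator.

(** * Esseen's smoothing inequality *)

Section Trig.
Context {R : realType}.
Implicit Types x y : R.

Lemma norm_sin_le x : `|sin x| <= `|x|.
Proof.
have H y : 0 <= y -> `|sin y| <= y.
  move=> y0.
  have [|c] := @MVT_segment _ sin cos 0 y y0 (fun z _ => is_derive_sin z).
    exact/continuous_subspaceT/continuous_sin.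
  move=> _; rewrite sin0 !subr0 => ->; rewrite normrM (ger0_norm y0).
  by rewrite ler_piMl// ler_norml cos_geN1 cos_le1.
have [x0|/ltW x0] := leP 0 x; first by rewrite (ger0_norm x0) H.
by rewrite -normrN -sinN -(normrN x) (ger0_norm (_ : 0 <= - x)) ?oppr_ge0// H// oppr_ge0.
Qed.

(** Two successive integrations from [0] of [sin z <= z]. *)
Lemma sin_ge_cubic x : 0 <= x -> x - x ^+ 3 / 6 <= sin x.
Proof.
have nd (f f' : R -> R) : (forall z : R, is_derive z 1 f (f' z)) -> f 0 = 0 ->
    (forall z : R, 0 <= z -> 0 <= f' z) -> forall z : R, 0 <= z -> 0 <= f z.
  move=> df f0 f'0 z z0.
  have [|c] := @MVT_segment _ f f' 0 z z0 (fun z _ => df z).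
    apply: continuous_subspaceT => w; apply: differentiable_continuous.
    by apply/derivable1_diffP; have [] := df w.
  rewrite in_itv/= => /andP[c0 _]; rewrite f0 !subr0 => ->.
  by rewrite mulr_ge0// f'0.
have h1 (z : R) : 0 <= z -> 0 <= z - sin z.
  move=> z0; have := norm_sin_le z; rewrite (ger0_norm z0) subr_ge0.
  by apply: le_trans; exact: ler_norm.
have h2 : forall z : R, 0 <= z -> 0 <= cos z - 1 + z ^+ 2 / 2.
  apply: (nd _ (fun z => z - sin z)) => //.
    move=> z; rewrite (_ : (fun z => _) = cos - cst 1 + 2^-1 \*: (id ^+ 2)); last first.
      apply/funext => w; transitivity (cos w - 1 + 2^-1 * w ^+ 2); last by [].
      by ring.
    by apply: is_derive_eq; rewrite /GRing.scale /=; field.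
  by rewrite cos0 subrr expr0n/= mul0r addr0.
have h3 : forall z : R, 0 <= z -> 0 <= sin z - z + z ^+ 3 / 6.
  apply: (nd _ (fun z => cos z - 1 + z ^+ 2 / 2)) => //.
    move=> z; rewrite (_ : (fun z => _) = sin - id + 6^-1 \*: (id ^+ 3)); last first.
      apply/funext => w; transitivity (sin w - w + 6^-1 * w ^+ 3); last by [].
      by ring.
    by apply: is_derive_eq; rewrite /GRing.scale /=; field.
  by rewrite sin0 subrr expr0n/= mul0r addr0.
by move=> x0; have := h3 x x0; lra.
Qed.

Lemma measurable_sin : measurable_fun [set: R] (@sin R).
Proof. by apply: continuous_measurable_fun; exact: continuous_sin. Qed.

Lemma measurable_cos : measurable_fun [set: R] (@cos R).
Proof. by apply: continuous_measurable_fun; exact: continuous_cos. Qed.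

End Trig.

Lemma integrable_scale d (T : measurableType d) (R : realType)
    (mu : {measure set T -> \bar R}) (D : set T) (k : R) (f : T -> R) : measurable D ->
  mu.-integrable D (EFin \o f) -> mu.-integrable D (EFin \o (fun x => k * f x)).
Proof.
move=> mD fi; rewrite (_ : _ \o _ = (fun x => k%:E * (EFin \o f) x)%E) //.
exact: integrableZl.
Qed.

Lemma integrable_diff d (T : measurableType d) (R : realType)
    (mu : {measure set T -> \bar R})
    (D : set T) (f g : T -> R) : measurable D -> mu.-integrable D (EFin \o f) ->
  mu.-integrable D (EFin \o g) -> mu.-integrable D (EFin \o (fun x => f x - g x)).
Proof.
move=> mD fi gi; rewrite (_ : _ \o _ = (fun x => (EFin \o f) x - (EFin \o g) x)%E) //.
exact: integrableB.
Qed.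

Lemma measurable_le_nat d (T : measurableType d) (R : realType) (f : T -> R) (z : R) :
  measurable_fun [set: T] f -> measurable_fun [set: T] (fun y => (f y <= z)%R%:R : R).
Proof.
move=> mf; rewrite (_ : (fun y => _) = \1_[set y | f y <= z]); last first.
  apply/funext => y; rewrite indicE; congr ((nat_of_bool _)%:R).
  by apply/idP/idP; rewrite inE.
apply: measurable_indic; rewrite -[X in measurable X]setTI.
exact: measurable_fun_le.
Qed.

Section FTC.
Context {R : realType}.
Let mu := @lebesgue_measure R.

Lemma integral_is_derive (f F : R -> R) (a b : R) : a <= b ->
  (forall x : R, is_derive x 1 F (f x)) -> continuous f ->
  (\int[mu]_(x in `[a, b]) (f x)%:E = (F b - F a)%:E)%E.
Proof.
rewrite le_eqVlt => /predU1P[->|ab] dF cf.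
  by rewrite set_itv1 integral_set1 subrr.
rewrite (continuous_FTC2 ab (continuous_subspaceT cf) (F := F))//.
  have cF x : {for x, continuous F}.
    apply: differentiable_continuous; apply/derivable1_diffP.
    by have [] := dF x.
  split; first by move=> x _; have [] := dF x.
  - exact/cvg_at_right_filter/cF.
  - exact/cvg_at_left_filter/cF.
by move=> x _; rewrite derive1E; apply: derive_val.
Qed.

Lemma Rintegral_is_derive (f F : R -> R) (a b : R) : a <= b ->
  (forall x : R, is_derive x 1 F (f x)) -> continuous f ->
  \int[mu]_(x in `[a, b]) f x = F b - F a.
Proof. by move=> ab dF cf; rewrite /Rintegral (integral_is_derive ab dF cf). Qed.

End FTC.

(** * The Fejer kernel and its primitive *)

Section FejerKernel.
Context {R : realType}.
Let mu := @lebesgue_measure R.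
Implicit Types (s x y z : R).

Local Notation U := (`]0%R, 1%R]%classic : set R).

(** The unnormalized kernel [(1 - cos y) / y^2], as a cosine integral over frequencies in the unit
    interval: smoothing by it involves characteristic functions at those frequencies only. *)
Definition fejer (y : R) : R := \int[mu]_(s in U) ((1 - s) * cos (s * y)).
Definition fejer_prim (y : R) : R := \int[mu]_(s in U) ((1 - s) * (sin (s * y) / s)).

Let mU : measurable U. Proof. exact: measurable_itv. Qed.

Let muU : mu U = 1%E.
Proof. by rewrite /mu lebesgue_measure_itv /= lte_fin ltr01 sube0. Qed.

Let intU (f : R -> R) (M : R) : measurable_fun U f -> (forall s, U s -> `|f s| <= M) ->
  mu.-integrable U (EFin \o f).
Proof.
move=> mf fM; apply: (@le_integrable _ _ _ mu U mU (EFin \o f) (EFin \o cst M)).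
- exact/measurable_EFinP.
- move=> s Us /=; rewrite lee_fin (le_trans (fM _ Us))//; exact: ler_norm.
- apply/integrableP; split; first exact/measurable_EFinP/measurable_cst.
  rewrite (_ : (fun x => _) = cst (`|M|%:E))//.
  by rewrite integral_cst// [X in (_ * X)%E]muU mule1 ltry.
Qed.

Lemma measurable_invr : measurable_fun [set: R] (fun s : R => s^-1).
Proof.
rewrite (_ : (fun s => s^-1) = (fun s => s * (s ^+ 2) `^ (-1))); last first.
  apply/funext => s; rewrite powR_inv1 ?sqr_ge0//.
  by have [->|s0] := eqVneq s 0; rewrite ?invr0 ?mul0r// expr2 invfM mulVKf.
apply: measurable_funM => //.
apply: (measurableT_comp (measurable_powR (-1))); exact: exprn_measurable.
Qed.

Let mprim y : measurable_fun U (fun s => (1 - s) * (sin (s * y) / s)).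
Proof.
apply: measurable_funTS; apply: measurable_funM; first exact: measurable_funB.
apply: measurable_funM; last exact: measurable_invr.
apply: measurableT_comp; last exact: measurable_funM.
exact: measurable_sin.
Qed.

Let mfej y : measurable_fun U (fun s => (1 - s) * cos (s * y)).
Proof.
apply: measurable_funTS; apply: measurable_funM; first exact: measurable_funB.
apply: measurableT_comp; last exact: measurable_funM.
exact: measurable_cos.
Qed.

Let Ub s : U s -> 0 < s /\ s <= 1.
Proof. by rewrite /= in_itv/= => /andP. Qed.

Let fej_bd y s : U s -> `|(1 - s) * cos (s * y)| <= 1.
Proof.
move=> /Ub[s0 s1]; rewrite normrM ger0_norm ?subr_ge0//.
have : `|cos (s * y)| <= 1 by rewrite ler_norml cos_geN1 cos_le1.
by have := normr_ge0 (cos (s * y)); nra.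
Qed.

Lemma norm_sin_div_le s y : 0 < s -> `|sin (s * y) / s| <= `|y|.
Proof.
move=> s0; rewrite normrM normfV (gtr0_norm s0) ler_pdivrMr//.
by rewrite (le_trans (norm_sin_le _))// normrM (gtr0_norm s0) mulrC.
Qed.

Let prim_bd y s : U s -> `|(1 - s) * (sin (s * y) / s)| <= `|y|.
Proof.
move=> /Ub[s0 s1]; rewrite normrM ger0_norm ?subr_ge0//.
by rewrite -[leRHS]mul1r ler_pM ?subr_ge0 ?norm_sin_div_le// gerBl ltW.
Qed.

Let ifej y : mu.-integrable U (EFin \o (fun s => (1 - s) * cos (s * y))).
Proof. by apply: (@intU _ 1) => // s; exact: fej_bd. Qed.

Let iprim y : mu.-integrable U (EFin \o (fun s => (1 - s) * (sin (s * y) / s))).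
Proof. by apply: (@intU _ `|y|) => // s; exact: prim_bd. Qed.

Lemma integrable_fejer_prim y :
  mu.-integrable U (EFin \o (fun s => (1 - s) * (sin (s * y) / s))).
Proof. exact: iprim. Qed.

Let d_prim s (y : R) : U s ->
  is_derive y 1 (fun y => (1 - s) * (sin (s * y) / s)) ((1 - s) * cos (s * y)).
Proof.
move=> /Ub[s0 s1].
rewrite (_ : (fun y => _) = ((1 - s) / s) \*: (sin \o ( *%R s))); last first.
  by apply/funext => z; transitivity ((1 - s) / s * sin (s * z)) => //; ring.
have d1 : is_derive y 1 ( *%R s) s.
  rewrite (_ : *%R s = s \*: (@id R)); last by apply/funext.
  by apply: is_derive_eq; rewrite /GRing.scale/= mulr1.
have d2 := @is_derive1_comp R sin ( *%R s) y _ _ (is_derive_sin (s * y)) d1.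
by apply: is_derive_eq; rewrite /GRing.scale /=; field; rewrite gt_eqF.
Qed.

Lemma is_derive_fejer_prim (y : R) : is_derive y 1 fejer_prim (fejer y).
Proof.
pose f (y s : R) := (1 - s) * (sin (s * y) / s).
have Iy : `](y - 1), (y + 1)[%classic y by rewrite /= in_itv/=; apply/andP; split; lra.
have D x s : U s -> partial1of2 f x s = (1 - s) * cos (s * x).
  by move=> Us; rewrite partial1of2E; exact: (@derive_val _ _ _ _ _ _ _ (d_prim x Us)).
have h1 x : `](y - 1), (y + 1)[%classic x -> mu.-integrable U (EFin \o f x).
  by move=> _; exact: iprim.
have h2 x s : `](y - 1), (y + 1)[%classic x -> U s -> derivable (f ^~ s) x 1.
  by move=> _ Us; have [] := d_prim x Us.
have h3 x s : `](y - 1), (y + 1)[%classic x -> U s -> `|partial1of2 f x s| <= cst 1 s.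
  by move=> _ Us; rewrite D// fej_bd.
have h4 : mu.-integrable U (EFin \o cst (1 : R)).
  by apply: (@intU (cst 1) 1) => // s _; rewrite /= normr1.
have h5 := @derivable_under_integral R _ _ mu f U mU y _ _ Iy h1 h2 (cst 1) (fun=> ler01) h4 h3.
apply: DeriveDef => //; rewrite -derive1E.
rewrite (@differentiation_under_integral R _ _ mu f U mU y _ _ Iy h1 h2 (cst 1) (fun=> ler01) h4 h3).
by apply: eq_Rintegral => s; rewrite inE => Us; rewrite -D.
Qed.

Lemma continuous_fejer : continuous fejer.
Proof.
move=> y; apply: (@continuity_under_integral R _ _ mu (fun y s => (1 - s) * cos (s * y)) U mU
  (y - 1) (y + 1) _ _ (cst 1)).
- by move=> x _; exact: ifej.
- apply: aeW => s Us x _; apply: cvgM; first exact: cvg_cst.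
  apply: (cvg_comp ( *%R s) cos); last exact: continuous_cos.
  exact: mulrl_continuous.
- by apply: (@intU (cst 1) 1) => // s _; rewrite /= normr1.
- by move=> x _; apply: aeW => s Us; exact: fej_bd.
- by rewrite inE/= in_itv/=; apply/andP; split; lra.
Qed.

Lemma fejerE y : y != 0 -> fejer y = (1 - cos y) / y ^+ 2.
Proof.
move=> y0; rewrite /fejer Rintegral_itv_obnd_cbnd; last exact: ifej.
have cc : continuous (fun s => (1 - s) * cos (s * y)).
  move=> s; apply: cvgM; first by apply: cvgB; [exact: cvg_cst|exact: cvg_id].
  apply: (cvg_comp ( *%R ^~ y) cos); last exact: continuous_cos.
  exact: mulrr_continuous.
have dd (s : R) : is_derive s 1 (fun s => (1 - s) * (sin (s * y) / y) - cos (s * y) / y ^+ 2)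
    ((1 - s) * cos (s * y)).
  have d1 : is_derive s 1 ( *%R^~ y) y.
    rewrite (_ : *%R^~ y = y \*: (@id R)); last first.
      by apply/funext => z; rewrite /GRing.scale /= mulrC.
    by apply: is_derive_eq; rewrite /GRing.scale/= mulr1.
  have d2 := @is_derive1_comp R sin ( *%R^~ y) s _ _ (is_derive_sin (s * y)) d1.
  have d3 := @is_derive1_comp R cos ( *%R^~ y) s _ _ (is_derive_cos (s * y)) d1.
  rewrite (_ : (fun s => _) = (cst 1 - @id R) * (y^-1 \*: (sin \o *%R^~ y)) -
      (y ^- 2) \*: (cos \o *%R^~ y)); last first.
    apply/funext => z; transitivity ((1 - z) * (y^-1 * sin (z * y)) - y ^- 2 * cos (z * y)) => //.
    by ring.
  apply: is_derive_eq; rewrite /GRing.scale /=.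
  rewrite -[LHS]/((1 - s) * (y^-1 * (cos (s * y) * y)) + y^-1 * sin (s * y) * (0 - 1)
    - y ^- 2 * (- sin (s * y) * y)).
  by field.
rewrite (Rintegral_is_derive ler01 dd cc) !mul1r !mul0r subrr mul0r sin0 cos0 mul0r mulr0.
by ring.
Qed.

Lemma fejer_ge0 y : 0 <= fejer y.
Proof.
have [->|y0] := eqVneq y 0.
  apply: Rintegral_ge0 => s /Ub[s0 s1].
  by rewrite mulr0 cos0 mulr1 subr_ge0.
by rewrite fejerE// divr_ge0 ?sqr_ge0// subr_ge0 cos_le1.
Qed.

Lemma fejerN y : fejer (- y) = fejer y.
Proof. by apply: eq_Rintegral => s _; rewrite mulrN cosN. Qed.

Lemma fejer_primN y : fejer_prim (- y) = - fejer_prim y.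
Proof.
rewrite -[RHS]mulN1r -RintegralZl//; apply: eq_Rintegral => s _.
by rewrite mulrN sinN; ring.
Qed.

Lemma integral_fejer_itv a b : a <= b ->
  (\int[mu]_(y in `[a, b]) (fejer y)%:E = (fejer_prim b - fejer_prim a)%:E)%E.
Proof. by move=> ab; apply: integral_is_derive => // y; [exact: is_derive_fejer_prim|exact: continuous_fejer]. Qed.

(** [sin(2 s) / s >= 2 - 4/3 s^2], integrated against [1 - s]. By symmetry this gives the lower
    bound [16/9] for the mass, in place of the exact value [pi]. *)
Lemma fejer_prim_ge : 8 / 9 <= fejer_prim 2.
Proof.
have cc : continuous (fun s : R => (1 - s) * (2 - 4 / 3 * s ^+ 2)).
  move=> s; apply: cvgM; first by apply: cvgB; [exact: cvg_cst|exact: cvg_id].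
  by apply: cvgB; [exact: cvg_cst|apply: cvgM; [exact: cvg_cst|exact: exprn_continuous]].
have dd (s : R) : is_derive s 1 (fun s => 2 * s - s ^+ 2 - 4 / 9 * s ^+ 3 + s ^+ 4 / 3)
    ((1 - s) * (2 - 4 / 3 * s ^+ 2)).
  rewrite (_ : (fun s => _) = 2 \*: (@id R) - (@id R) ^+ 2 - (4 / 9) \*: (@id R) ^+ 3 +
     3^-1 \*: (@id R) ^+ 4); last first.
    apply/funext => z; transitivity (2 * z - z ^+ 2 - 4 / 9 * z ^+ 3 + 3^-1 * z ^+ 4) => //.
    by ring.
  by apply: is_derive_eq; rewrite /GRing.scale /=; field.
have := Rintegral_is_derive ler01 dd cc; rewrite !expr0n/= !expr1n.
have ii : mu.-integrable U (EFin \o (fun s : R => (1 - s) * (2 - 4 / 3 * s ^+ 2))).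
  apply: (@intU _ 2) => [|s Us].
    by apply: measurable_funTS; exact: continuous_measurable_fun.
  have [s0 s1] := Ub Us; rewrite normrM ger0_norm ?subr_ge0//.
  have s2 : s ^+ 2 <= 1 by rewrite expr_le1// ltW.
  have s20 := sqr_ge0 s.
  have : `|2 - 4 / 3 * s ^+ 2| <= 2 by rewrite ler_norml; apply/andP; split; lra.
  by have := normr_ge0 (2 - 4 / 3 * s ^+ 2); nra.
rewrite -Rintegral_itv_obnd_cbnd// => e.
have -> : 8 / 9 = \int[mu]_(s in U) ((1 - s) * (2 - 4 / 3 * s ^+ 2)).
  by rewrite e; field.
apply: le_Rintegral => //.
move=> s /Ub[s0 s1]; rewrite ler_wpM2l ?subr_ge0// ler_pdivlMr//.
apply: (le_trans _ (sin_ge_cubic _)); last by rewrite mulr_ge0// ltW.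
by apply: le_of_eq; field.
Qed.

(** [1 - cos y <= 2], so the kernel is below [2 / y^2]. *)
Lemma fejer_tail z : 0 < z ->
  (\int[mu]_(y in `[z, +oo[) (fejer y)%:E <= (2 / z)%:E)%E.
Proof.
move=> z0.
have cinv (x : R) : z <= x -> {for x, continuous (fun y : R => 2 / y ^+ 2)}.
  move=> zx; apply: cvgM; first exact: cvg_cst.
  apply: cvgV; last exact: exprn_continuous.
  by rewrite expf_neq0// gt_eqF// (lt_le_trans z0).
have cw : {within `[z, +oo[, continuous (fun y : R => 2 / y ^+ 2)}.
  apply: continuous_in_subspaceT => x; rewrite inE/= in_itv/= andbT; exact: cinv.
have dd (x : R) : z < x -> is_derive x 1 (fun y : R => - 2 / y) (2 / x ^+ 2).
  move=> zx; have x0 : x != 0 by rewrite gt_eqF// (lt_trans z0).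
  have dV := @is_deriveV R (@id R) x 1 1 x0 (is_derive_id _ _).
  rewrite (_ : (fun y => _) = (- 2) \*: (fun y : R => y^-1)); last by apply/funext.
  apply: is_derive_eq; rewrite /GRing.scale /=; field.
  exact: x0.
have e := @ge0_continuous_FTC2y R (fun y => 2 / y ^+ 2) (fun y => - 2 / y) z 0 _ cw _ _ _ _.
apply: (@le_trans _ _ (\int[mu]_(y in `[z, +oo[) (2 / y ^+ 2)%:E)%E).
  apply: ge0_le_integral => //=.
  - by move=> y _; rewrite lee_fin fejer_ge0.
  - by apply/measurable_EFinP; apply: measurable_funTS; apply: continuous_measurable_fun; exact: continuous_fejer.
  - apply/measurable_EFinP; apply: measurable_funTS; apply: measurable_funM => //.
    apply: (measurableT_comp measurable_invr); exact: exprn_measurable.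
  - move=> y; rewrite in_itv/= andbT => zy; have y0 : 0 < y by exact: lt_le_trans zy.
    rewrite lee_fin fejerE ?gt_eqF// ler_wpM2r ?invr_ge0 ?sqr_ge0//.
    by have := cos_geN1 y; lra.
rewrite e.
- by rewrite sub0e -EFinN lee_fin mulNr opprK.
- by move=> y zy; rewrite divr_ge0 ?sqr_ge0.
- rewrite -[X in _ --> X](mulr0 (- 2)); apply: cvgM; first exact: cvg_cst.
  apply: (proj2 (@gtr0_cvgV0 R R +oo%R _ id _)); first exact: nbhs_pinfty_gt.
  exact: cvg_id.
- by move=> x zx; have [] := dd x zx.
- apply: cvg_at_right_filter; apply: cvgM; first exact: cvg_cst.
  by apply: cvgV; [rewrite gt_eqF|exact: cvg_id].
- move=> x; rewrite in_itv/= andbT => zx; rewrite derive1E.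
  by apply: derive_val; exact: dd.
Qed.

Lemma measurable_fejer : measurable_fun [set: R] fejer.
Proof. by apply: continuous_measurable_fun; exact: continuous_fejer. Qed.

End FejerKernel.

Section FejerMass.
Context {R : realType}.
Let mu := @lebesgue_measure R.
Implicit Types (y z : R).

Let mfejE (D : set R) : measurable_fun D (fun y : R => (fejer y)%:E).
Proof. by apply: measurable_funTS; apply/measurable_EFinP; exact: measurable_fejer. Qed.

Lemma fejer_tails e : 0 < e ->
  (\int[mu]_(y in ~` `[(- e)%R, e]) (fejer y)%:E <= (4 / e)%:E)%E.
Proof.
move=> e0; have eE : ~` `[(- e), e]%classic `<=` `]-oo, (- e)]%classic `|` `[e, +oo[%classic.
  move=> y /=; rewrite !in_itv/= andbT => /negP; rewrite negb_and -!ltNge.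
  by move=> /orP[|] /ltW; [left|right].
apply: (@le_trans _ _ (\int[mu]_(y in `]-oo, (- e)%R] `|` `[e, +oo[) (fejer y)%:E)%E).
  apply: ge0_subset_integral => //; first exact: measurableC.
  - exact: measurableU.
  - exact: mfejE.
  - by move=> y _; rewrite lee_fin fejer_ge0.
rewrite ge0_integral_setU//=; last 3 first.
- exact: mfejE.
- by move=> y _; rewrite lee_fin fejer_ge0.
- apply/disj_setPS => y [/=]; rewrite !in_itv/= andbT => h1 h2.
  by move: (le_trans h2 h1); rewrite leNgt => /negP; apply; lra.
rewrite ge0_integration_by_substitutionNy.
- rewrite (_ : 4 / e = 2 / e + 2 / e); last by ring.
  rewrite EFinD; apply: leeD; last exact: fejer_tail.
  under eq_integral do rewrite /= fejerN; exact: fejer_tail.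
- exact/continuous_subspaceT/continuous_fejer.
- by move=> y _; exact: fejer_ge0.
Qed.

Definition fejer_mass : \bar R := (\int[mu]_y (fejer y)%:E)%E.

Lemma fejer_mass_fin : fejer_mass \is a fin_num.
Proof.
rewrite ge0_fin_numE; last by apply: integral_ge0 => y _; rewrite lee_fin fejer_ge0.
rewrite /fejer_mass -(setUv `[(- 1)%R, 1%R]%classic) ge0_integral_setU//=; last 4 first.
- exact: measurableC.
- exact: mfejE.
- by move=> y _; rewrite lee_fin fejer_ge0.
- exact/disj_setPCl.
rewrite integral_fejer_itv; last by lra.
by rewrite lte_add_pinfty ?ltry// (le_lt_trans (fejer_tails ltr01))// ltry.
Qed.

Lemma fejer_mass_ge : 16 / 9 <= fine fejer_mass.
Proof.
rewrite -lee_fin fineK ?fejer_mass_fin//.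
apply: (@le_trans _ _ (\int[mu]_(y in `[(- 2)%R, 2%R]) (fejer y)%:E)%E); last first.
  by apply: ge0_subset_integral => //; [exact: mfejE|move=> y _; rewrite lee_fin fejer_ge0].
rewrite integral_fejer_itv; last by lra.
by rewrite fejer_primN lee_fin; have := @fejer_prim_ge R; lra.
Qed.

Lemma integrable_fejer : mu.-integrable [set: R] (EFin \o fejer).
Proof.
apply/integrableP; split; first exact: mfejE.
under eq_integral do rewrite /= ger0_norm ?fejer_ge0//.
by rewrite -ge0_fin_numE ?fejer_mass_fin//; apply: integral_ge0 => y _; rewrite lee_fin fejer_ge0.
Qed.

Lemma fejer_cdf z :
  (\int[mu]_(y in `]-oo, z]) (fejer y)%:E =
   \int[mu]_(y in `]-oo, 0%R]) (fejer y)%:E + (fejer_prim z)%:E)%E.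
Proof.
have prim0 : fejer_prim (0 : R) = 0.
  by have := fejer_primN (0 : R); rewrite oppr0 => h; lra.
have split x y : x <= y -> (\int[mu]_(u in `]-oo, y]) (fejer u)%:E =
    \int[mu]_(u in `]-oo, x]) (fejer u)%:E + (fejer_prim y - fejer_prim x)%:E)%E.
  move=> xy; rewrite -integral_fejer_itv//.
  rewrite -(@integral_itv_obnd_cbnd R x (BRight y) (EFin \o fejer))//.
  rewrite -ge0_integral_setU//=.
  - by congr integral; rewrite -itv_bndbnd_setU// bnd_simp.
  - exact: mfejE.
  - by move=> u _; rewrite lee_fin fejer_ge0.
  - apply/disj_setPS => u [/=]; rewrite !in_itv/= => h1 /andP[h2 _].
    by move: (lt_le_trans h2 h1); rewrite ltxx.
have fin x : (\int[mu]_(u in `]-oo, x]) (fejer u)%:E)%E \is a fin_num.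
  rewrite ge0_fin_numE; last by apply: integral_ge0 => y _; rewrite lee_fin fejer_ge0.
  apply: (@le_lt_trans _ _ fejer_mass).
    by apply: ge0_subset_integral => //; [exact: mfejE|move=> y _; rewrite lee_fin fejer_ge0].
  by rewrite -ge0_fin_numE ?fejer_mass_fin//; apply: integral_ge0 => y _; rewrite lee_fin fejer_ge0.
have [z0|/ltW z0] := leP 0 z.
  by rewrite (split 0 z)// prim0 subr0.
rewrite (split z 0)// prim0 sub0r -addeA -EFinD addNr adde0//.
Qed.

(* The shift by [e] makes L a lower bound on the whole of [-e, e], so that only
   the total mass and the tails of the kernel matter. *)
Lemma fejer_average_ge (D : R -> R) (e L M : R) : 0 < e -> 0 <= L + M ->
  measurable_fun [set: R] D ->
  (forall y, `|D y| <= M) -> (forall y, `|y| <= e -> L <= D y) ->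
  L * fine fejer_mass - (L + M) * (4 / e) <= \int[mu]_y (fejer y * D y).
Proof.
move=> e0 LM mD DM DL; pose E : set R := ~` `[(- e), e]%classic.
have mE : measurable E by exact: measurableC.
have iD : mu.-integrable [set: R] (EFin \o (fun y => fejer y * D y)).
  apply: (@le_integrable _ _ _ mu setT measurableT _ (EFin \o (fun y => M * fejer y))).
  - by apply/measurable_EFinP; apply: measurable_funM => //; exact: measurable_fejer.
  - move=> y _ /=; rewrite lee_fin normrM mulrC (le_trans _ (ler_norm _))//.
    by rewrite (ger0_norm (fejer_ge0 y)) ler_wpM2r ?fejer_ge0.
  - by apply: integrable_scale => //; exact: integrable_fejer.
have iE : mu.-integrable [set: R] (EFin \o (fun y => fejer y * \1_E y)).
  apply: (@le_integrable _ _ _ mu setT measurableT _ (EFin \o fejer)).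
  - by apply/measurable_EFinP; apply: measurable_funM => //; exact: measurable_fejer.
  - move=> y _ /=; rewrite lee_fin normrM ler_piMr//.
    by rewrite indicE; case: (_ \in _); rewrite ?normr1 ?normr0.
  - exact: integrable_fejer.
have tailE : \int[mu]_y (fejer y * \1_E y) <= 4 / e.
  rewrite -lee_fin (le_trans _ (fejer_tails e0))//.
  rewrite /Rintegral fineK; last exact: integrable_fin_num.
  rewrite [leRHS]integral_mkcond; apply/le_of_eq.
  apply: eq_integral => y _; rewrite /patch indicE.
  by case: ifPn => _; rewrite ?mulr1 ?mulr0.
apply: (@le_trans _ _ (\int[mu]_y (L * fejer y - (L + M) * (fejer y * \1_E y)))).
  rewrite RintegralB//; [|exact: (integrable_scale _ measurableT integrable_fejer)|exact: (integrable_scale _ measurableT iE)].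
  rewrite !RintegralZl//; last exact: integrable_fejer.
  rewrite lerB// ler_wpM2l//.
apply: le_Rintegral => //.
  apply: integrable_diff => //.
    exact: (integrable_scale _ measurableT integrable_fejer).
  exact: (integrable_scale _ measurableT iE).
move=> y _; have f0 := fejer_ge0 y; rewrite indicE.
case: (boolP (y \in E)) => [|yE] /=.
  move=> _; rewrite mulr1; have := DM y; rewrite ler_norml => /andP[h _].
  have := ler_wpM2l f0 h; lra.
rewrite !mulr0 subr0 mulrC ler_wpM2l// DL//.
move: yE; rewrite notin_setE /E /= => /contrapT; rewrite in_itv/=.
by rewrite ler_norml.
Qed.

End FejerMass.

(** * Laws given by a density and a random variable; smoothing *)

Section WeightedLaw.
Context {R : realType}.
Let mu := @lebesgue_measure R.
Implicit Types (h W v : R -> R) (x y z : R).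

Definition pdensity h := [/\ forall x, 0 <= h x, measurable_fun [set: R] h &
  (\int[mu]_x (h x)%:E = 1)%E].

Definition wmean h v : R := \int[mu]_x (v x * h x).
(** Distribution function of the random variable [W] under the density [h]. Both the Birkhoff sum
    under the Gibbs density and the normal law take this form. *)
Definition wcdf h W z : R := wmean h (fun y => (W y <= z)%R%:R).

Lemma pdensity_integrable h : pdensity h -> mu.-integrable [set: R] (EFin \o h).
Proof.
move=> [h0 mh h1]; apply/integrableP; split; first exact/measurable_EFinP.
under eq_integral do rewrite /= ger0_norm//.
by rewrite h1 ltry.
Qed.

Lemma wmean_integrable h v (M : R) : pdensity h -> measurable_fun [set: R] v ->
  (forall x, `|v x| <= M) -> mu.-integrable [set: R] (EFin \o (fun x => v x * h x)).
Proof.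
move=> hp mv vM; have [h0 mh h1] := hp.
apply: (@le_integrable _ _ _ mu setT measurableT _ (EFin \o (fun y => M * h y))).
- by apply/measurable_EFinP; exact: measurable_funM.
- move=> y _ /=; rewrite lee_fin normrM (le_trans _ (ler_norm _))//.
  by rewrite (ger0_norm (h0 y)) ler_wpM2r.
- by apply: integrable_scale => //; exact: pdensity_integrable.
Qed.

Lemma wmean_cst h (c : R) : pdensity h -> wmean h (fun=> c) = c.
Proof.
move=> hp; rewrite /wmean RintegralZl//; last exact: pdensity_integrable.
by have [_ _ h1] := hp; rewrite /Rintegral h1 mulr1.
Qed.

Lemma le_wmean h v v' (M M' : R) : pdensity h ->
  measurable_fun [set: R] v -> (forall x, `|v x| <= M) ->
  measurable_fun [set: R] v' -> (forall x, `|v' x| <= M') ->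
  (forall x, v x <= v' x) -> wmean h v <= wmean h v'.
Proof.
move=> hp mv vM mv' vM' vv'; apply: le_Rintegral => //.
- exact: wmean_integrable hp mv vM.
- exact: wmean_integrable hp mv' vM'.
- by move=> x _; have [h0 _ _] := hp; rewrite ler_wpM2r.
Qed.

Let le_bd (b : bool) : `|b%:R : R| <= 1.
Proof. by case: b; rewrite ?normr1 ?normr0. Qed.

Lemma wcdf_bounds h W z : pdensity h -> measurable_fun [set: R] W ->
  0 <= wcdf h W z <= 1.
Proof.
move=> hp mW; have [h0 _ _] := hp; apply/andP; split.
  by apply: Rintegral_ge0 => x _; rewrite mulr_ge0.
rewrite -[leRHS](wmean_cst 1 hp).
apply: (le_wmean hp (M := 1) (M' := 1)) => //; first exact: measurable_le_nat.
  by move=> x; rewrite normr1.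
by move=> x; rewrite lern1; case: (_ <= _).
Qed.

Lemma wcdf_homo h W : pdensity h -> measurable_fun [set: R] W ->
  {homo wcdf h W : x y / x <= y}.
Proof.
move=> hp mW x y xy.
apply: (le_wmean hp (M := 1) (M' := 1)) => //; try exact: measurable_le_nat.
move=> w; rewrite ler_nat; case: (boolP (W w <= x)) => //= h1.
by rewrite (le_trans h1).
Qed.

Let N0 : R := fine (\int[mu]_(y in `]-oo, 0%R]) (fejer y)%:E)%E.

Let N0E : ((\int[mu]_(y in `]-oo, 0%R]) (fejer y)%:E) = N0%:E)%E.
Proof.
rewrite fineK// ge0_fin_numE; last by apply: integral_ge0 => y _; rewrite lee_fin fejer_ge0.
apply: (@le_lt_trans _ _ (@fejer_mass R)).
  apply: ge0_subset_integral => //; last by move=> y _; rewrite lee_fin fejer_ge0.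
  by apply/measurable_EFinP; exact: measurable_fejer.
rewrite -ge0_fin_numE ?fejer_mass_fin//.
by apply: integral_ge0 => y _; rewrite lee_fin fejer_ge0.
Qed.

Lemma fejer_prim_bounded z : `|fejer_prim z| <= fine (@fejer_mass R).
Proof.
have mass_ge0 : (0 <= @fejer_mass R)%E.
  by apply: integral_ge0 => y _; rewrite lee_fin fejer_ge0.
have H x : 0 <= N0 + fejer_prim x <= fine (@fejer_mass R).
  have := fejer_cdf x; rewrite N0E -EFinD => e.
  rewrite -!lee_fin -e fineK ?fejer_mass_fin//; apply/andP; split.
    by apply: integral_ge0 => y _; rewrite lee_fin fejer_ge0.
  apply: ge0_subset_integral => //; last by move=> y _; rewrite lee_fin fejer_ge0.
  by apply/measurable_EFinP; exact: measurable_fejer.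
have prim0 : fejer_prim (0 : R) = 0.
  by have := fejer_primN (0 : R); rewrite oppr0 => e; lra.
have := H 0; have := H z; rewrite prim0 addr0 => /andP[? ?] /andP[? ?].
by rewrite ler_norml; apply/andP; split; lra.
Qed.

Lemma measurable_fejer_prim : measurable_fun [set: R] (@fejer_prim R).
Proof.
apply: continuous_measurable_fun => x; apply: differentiable_continuous.
by apply/derivable1_diffP; have [] := is_derive_fejer_prim x.
Qed.

(** Tonelli on the region [W w + y <= x]: the inner integral in [y] is the kernel's distribution
    function at [x - W w]. Its value [N0] at [0] is left unevaluated, since it cancels between two
    laws. *)
Lemma fejer_smoothing h W x : pdensity h -> measurable_fun [set: R] W ->
  \int[mu]_y (fejer y * wcdf h W (x - y)) = N0 + wmean h (fun w => fejer_prim (x - W w)).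
Proof.
move=> hp mW; have [h0 mh h1] := hp.
pose f (p : R * R) : \bar R := (fejer p.1 * (h p.2 * (W p.2 + p.1 <= x)%R%:R))%:E.
have mf : measurable_fun [set: (measurableTypeR R * measurableTypeR R)%type] f.
  apply/measurable_EFinP; apply: measurable_funM.
    exact: (measurableT_comp measurable_fejer measurable_fst).
  apply: measurable_funM; first exact: (measurableT_comp mh measurable_snd).
  apply: measurable_le_nat; apply: measurable_funD; last exact: measurable_fst.
  exact: (measurableT_comp mW measurable_snd).
have f0 p : (0 <= f p)%E.
  by rewrite lee_fin !mulr_ge0 ?fejer_ge0.
have := fubini_tonelli (m1 := mu) (m2 := mu) f mf f0.
have e1 y : (\int[mu]_w f (y, w) = (fejer y * wcdf h W (x - y))%:E)%E.
  rewrite /f /=; under eq_integral do rewrite EFinM.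
  rewrite ge0_integralZl//; last 3 first.
  - apply/measurable_EFinP; apply: measurable_funM => //; apply: measurable_le_nat.
    exact: measurable_funD.
  - by move=> w _; rewrite lee_fin mulr_ge0.
  - by rewrite lee_fin fejer_ge0.
  rewrite EFinM; congr (_ * _)%E; rewrite /wcdf /wmean /Rintegral fineK.
    apply: eq_integral => w _; rewrite mulrC; congr (_ * _)%:E.
    by rewrite lerBrDr.
  apply: integrable_fin_num => //.
  apply: (wmean_integrable (M := 1)) => //; exact: measurable_le_nat.
under eq_integral do rewrite e1.
have e2 w : (\int[mu]_y f (y, w) = (h w * (N0 + fejer_prim (x - W w)))%:E)%E.
  rewrite /f /=; under eq_integral do rewrite mulrCA EFinM.
  rewrite ge0_integralZl//; last 3 first.
  - apply/measurable_EFinP; apply: measurable_funM; first exact: measurable_fejer.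
    by apply: measurable_le_nat; exact: measurable_funD.
  - by move=> y _; rewrite lee_fin mulr_ge0 ?fejer_ge0.
  - by rewrite lee_fin.
  rewrite EFinM; congr (_ * _)%E.
  rewrite EFinD -N0E -fejer_cdf [RHS]integral_mkcond.
  apply: eq_integral => y _; rewrite /patch.
  rewrite (_ : (y \in `]-oo, (x - W w)]%classic) = (W w + y <= x)).
    by case: ifPn => _; rewrite ?mulr1 ?mulr0.
  rewrite [W w + _]addrC -lerBrDr.
  by apply/idP/idP; rewrite inE/= in_itv.
under [X in _ = X -> _]eq_integral do rewrite e2.
rewrite /Rintegral => ->.
have mp : measurable_fun [set: R] (fun w => fejer_prim (x - W w)).
  apply: (measurableT_comp measurable_fejer_prim).
  exact: measurable_funB.
have ip : mu.-integrable [set: R] (EFin \o (fun w => fejer_prim (x - W w) * h w)).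
  apply: (wmean_integrable (M := fine (@fejer_mass R))) => // w.
  exact: fejer_prim_bounded.
rewrite -/(Rintegral _ _ _) -[N0 in RHS](wmean_cst N0 hp) /wmean -RintegralD//.
  by apply: eq_Rintegral => w _; ring.
by apply: integrable_scale => //; exact: pdensity_integrable.
Qed.

Local Notation U := (`]0%R, 1%R]%classic : set R).

(** Fubini between frequency and space. The singularity at frequency zero is controlled by
    [|sin(s u) / s| <= |u|], which is why [W] must have a first moment. *)
Lemma wmean_fejer_prim h W x : pdensity h -> measurable_fun [set: R] W ->
  mu.-integrable [set: R] (EFin \o (fun w => W w * h w)) ->
  mu.-integrable U (EFin \o (fun s => (1 - s) / s * wmean h (fun w => sin (s * (x - W w))))) /\
  wmean h (fun w => fejer_prim (x - W w)) =
    \int[mu]_(s in U) ((1 - s) / s * wmean h (fun w => sin (s * (x - W w)))).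
Proof.
move=> hp mW iW; have [h0 mh h1] := hp.
pose k (p : R * R) : R := \1_U p.2 * ((1 - p.2) * (sin (p.2 * (x - W p.1)) / p.2)) * h p.1.
have mU : measurable U by exact: measurable_itv.
have mk : measurable_fun [set: (measurableTypeR R * measurableTypeR R)%type] k.
  have m1 := @measurable_fst _ _ (measurableTypeR R) (measurableTypeR R).
  have m2 := @measurable_snd _ _ (measurableTypeR R) (measurableTypeR R).
  apply: measurable_funM; last exact: (measurableT_comp mh).
  apply: measurable_funM; first by apply: (measurableT_comp _ m2); exact: measurable_indic.
  apply: measurable_funM; first exact: measurable_funB.
  apply: measurable_funM; last exact: (measurableT_comp (@measurable_invr R)).
  apply: (measurableT_comp (@measurable_sin R)); apply: measurable_funM => //.
  by apply: measurable_funB => //; exact: (measurableT_comp mW).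
have kle p : `|k p| <= \1_U p.2 * (`|x - W p.1| * h p.1).
  rewrite /k indicE; case: (boolP (p.2 \in U)) => [|_]; last first.
    by rewrite !mul0r normr0.
  rewrite inE/= in_itv/= => /andP[s0 s1]; rewrite !mul1r normrM (ger0_norm (h0 _)).
  rewrite ler_wpM2r// normrM ger0_norm ?subr_ge0//.
  rewrite -[leRHS]mul1r ler_pM ?subr_ge0 ?norm_sin_div_le// gerBl ltW//.
have ixW : mu.-integrable [set: R] (EFin \o (fun w => `|x - W w| * h w)).
  have i1 : mu.-integrable [set: R] (EFin \o (fun w => x * h w - W w * h w)).
    by apply: integrable_diff => //; apply: integrable_scale => //; exact: pdensity_integrable.
  have := integrable_abse i1; congr (integrable _ _ _); apply/funext => w.
  by rewrite /= -mulrBl normrM (ger0_norm (h0 w)).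
have U1 : (\int[mu]_s (\1_U s)%:E = 1)%E.
  rewrite integral_indic// setIT.
  by have := @lebesgue_measure_itv R `]0, 1]%R => /= ->; rewrite lte_fin ltr01 sube0.
have ik : (mu \x mu)%E.-integrable setT (EFin \o k).
  apply/integrable12ltyP; first exact/measurable_EFinP.
  apply: (@le_lt_trans _ _ (\int[mu]_w (`|x - W w| * h w)%:E)%E); last first.
    have /integrableP[_] := ixW; apply: le_lt_trans; apply: le_of_eq.
    by apply: eq_integral => w _; rewrite /= (ger0_norm (mulr_ge0 (normr_ge0 _) (h0 _))).
  apply: ge0_le_integral => //.
  - by move=> w _; apply: integral_ge0.
  - apply: (@measurable_fun_fubini_tonelli_F _ _ (measurableTypeR R) (measurableTypeR R) R mu
      (fun p => `|(EFin \o k) p|%E)) => //.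
    by apply: measurableT_comp => //; exact/measurable_EFinP.
  - apply/measurable_EFinP; apply: measurable_funM => //.
    by apply: measurableT_comp => //; exact: measurable_funB.
  - move=> w _.
    apply: (@le_trans _ _ (\int[mu]_s ((`|x - W w| * h w)%:E * (\1_U s)%:E))%E).
      apply: ge0_le_integral => //.
      + apply: measurableT_comp => //; apply/measurable_EFinP.
        exact: (measurableT_comp mk (pair1_measurable w)).
      + by apply: emeasurable_funM => //; apply/measurable_EFinP; exact: measurable_indic.
      + by move=> s _; rewrite /= -EFinM lee_fin (le_trans (kle _))//= mulrC.
    rewrite ge0_integralZl//; last 2 first.
    - by apply/measurable_EFinP; exact: measurable_indic.
    - by rewrite lee_fin mulr_ge0.
    by rewrite U1 mule1.
have e1 w : (\int[mu]_s (k (w, s))%:E = (fejer_prim (x - W w) * h w)%:E)%E.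
  have ip := integrable_fejer_prim (x - W w).
  transitivity (\int[mu]_(s in U) ((h w)%:E * ((1 - s) * (sin (s * (x - W w)) / s))%:E))%E.
    rewrite [RHS]integral_mkcond; apply: eq_integral => s _.
    rewrite /k /patch indicE /=; case: ifPn => _; last by rewrite !mul0r.
    by rewrite -EFinM mul1r mulrC.
  rewrite integralZl// mulrC EFinM; congr (_ * _)%E.
  by rewrite /fejer_prim /Rintegral fineK//; exact: integrable_fin_num.
have e2 s : (\int[mu]_w (k (w, s))%:E =
    (\1_U s * ((1 - s) / s * wmean h (fun w => sin (s * (x - W w)))))%:E)%E.
  have ms : measurable_fun [set: R] (fun w => sin (s * (x - W w))).
    apply: (measurableT_comp (@measurable_sin R)); apply: measurable_funM => //.
    exact: measurable_funB.
  have isin : mu.-integrable [set: R] (EFin \o (fun w => sin (s * (x - W w)) * h w)).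
    by apply: (wmean_integrable (M := 1)) => // w; rewrite ler_norml sin_geN1 sin_le1.
  transitivity (\int[mu]_w ((\1_U s * ((1 - s) / s))%:E * (sin (s * (x - W w)) * h w)%:E))%E.
    by apply: eq_integral => w _; rewrite /k -EFinM /=; congr _%:E; ring.
  rewrite (mulrA (\1_U s) ((1 - s) / s)) [RHS]EFinM; apply: etrans (integralZl measurableT isin _) _.
  congr (_ * _)%E.
  by rewrite /wmean /Rintegral fineK//; exact: integrable_fin_num.
have := Fubini ik.
rewrite /=; under eq_integral do rewrite e1.
under [X in _ = X -> _]eq_integral do rewrite e2.
move=> e; split.
  apply/integrable_mkcond => //.
  have mfk := measurable_int _ ik.
  have iG : mu.-integrable [set: R] (fubini_G mu (EFin \o k)).
    apply/integrableP; split; first exact: (measurable_fubini_G ik).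
    have ltk := (integrable21ltyP mu mu mfk).1 ik.
    apply: le_lt_trans ltk.
    apply: ge0_le_integral => //.
    - apply: measurableT_comp => //; exact: (measurable_fubini_G ik).
    - apply: (@measurable_fun_fubini_tonelli_G _ _ (measurableTypeR R) (measurableTypeR R) R mu
        (fun p => `|(EFin \o k) p|%E)) => //.
      exact: measurableT_comp.
    - move=> s _; apply: le_abse_integral => //.
      exact: (measurableT_comp mfk (pair2_measurable s)).
  move: iG; congr (integrable _ _ _); apply/funext => s.
  rewrite /fubini_G /= e2 /patch indicE.
  by case: ifPn => _; rewrite ?mul1r ?mul0r.
rewrite /wmean /Rintegral e [in RHS]integral_mkcond; congr fine.
apply: eq_integral => s _; rewrite /patch indicE.
by case: ifPn => _; rewrite ?mul1r ?mul0r.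
Qed.

Lemma fejer_smoothing_diff h1 W1 h2 W2 (q : R -> R) x : pdensity h1 -> pdensity h2 ->
  measurable_fun [set: R] W1 -> measurable_fun [set: R] W2 ->
  mu.-integrable [set: R] (EFin \o (fun w => W1 w * h1 w)) ->
  mu.-integrable [set: R] (EFin \o (fun w => W2 w * h2 w)) ->
  mu.-integrable U (EFin \o q) ->
  (forall s, U s -> `|wmean h1 (fun w => sin (s * (x - W1 w))) -
                      wmean h2 (fun w => sin (s * (x - W2 w)))| <= s * q s) ->
  `|\int[mu]_y (fejer y * (wcdf h1 W1 (x - y) - wcdf h2 W2 (x - y)))| <=
    \int[mu]_(s in U) q s.
Proof.
move=> p1 p2 m1 m2 i1 i2 iq H; have mU : measurable U by exact: measurable_itv.
have icdf h W : pdensity h -> measurable_fun [set: R] W ->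
    mu.-integrable [set: R] (EFin \o (fun y => fejer y * wcdf h W (x - y))).
  move=> hp mW.
  apply: (@le_integrable _ _ _ mu setT measurableT _ (EFin \o fejer)).
  - apply/measurable_EFinP; apply: measurable_funM; first exact: measurable_fejer.
    apply: (measurableT_comp (nondecreasing_measurable measurableT _)).
      exact: (wcdf_homo hp mW).
    exact: measurable_funB.
  - move=> y _ /=; rewrite lee_fin normrM ler_piMr//.
    by have /andP[a0 a1] := wcdf_bounds (x - y) hp mW; rewrite ger0_norm.
  - exact: integrable_fejer.
have [k1 e1] := wmean_fejer_prim x p1 m1 i1; have [k2 e2] := wmean_fejer_prim x p2 m2 i2.
have -> : \int[mu]_y (fejer y * (wcdf h1 W1 (x - y) - wcdf h2 W2 (x - y))) =
    \int[mu]_(s in U) ((1 - s) / s * wmean h1 (fun w => sin (s * (x - W1 w))) -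
                       (1 - s) / s * wmean h2 (fun w => sin (s * (x - W2 w)))).
  rewrite RintegralB// -e1 -e2.
  transitivity (\int[mu]_y (fejer y * wcdf h1 W1 (x - y) - fejer y * wcdf h2 W2 (x - y))).
    by apply: eq_Rintegral => y _; rewrite mulrBr.
  rewrite RintegralB//; [|exact: icdf|exact: icdf].
  by rewrite !fejer_smoothing//; ring.
have id := integrable_diff (mu := mu) (measurable_itv _) k1 k2.
apply: le_trans (le_normr_Rintegral (mu := mu) (measurable_itv _) id) _.
apply: le_Rintegral => //.
  by have := integrable_norm id; congr (integrable _ _ _); apply/funext.
move=> s Us; rewrite -mulrBr normrM; have := Us; rewrite /= in_itv/= => /andP[s0 s1].
have c0 : 0 <= (1 - s) / s by apply: divr_ge0; rewrite ?subr_ge0//; exact: ltW.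
rewrite (ger0_norm c0).
have q0 : 0 <= q s by rewrite -(pmulr_rge0 _ s0) (le_trans _ (H s Us)).
apply: le_trans (_ : (1 - s) / s * (s * q s) <= _).
  by apply: ler_wpM2l => //; exact: H.
by rewrite mulrA divfK ?gt_eqF// ler_piMl// gerBl ltW.
Qed.

(* Esseen's inequality with the Fejer kernel.  The extremal point is moved by
   [e], a quarter of the range on which the difference can only halve. *)
Lemma esseen h1 W1 h2 W2 (q : R -> R) (m : R) : 0 < m -> pdensity h1 -> pdensity h2 ->
  measurable_fun [set: R] W1 -> measurable_fun [set: R] W2 ->
  mu.-integrable [set: R] (EFin \o (fun w => W1 w * h1 w)) ->
  mu.-integrable [set: R] (EFin \o (fun w => W2 w * h2 w)) ->
  (forall x y, x <= y -> wcdf h2 W2 y - wcdf h2 W2 x <= m * (y - x)) ->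
  mu.-integrable U (EFin \o q) ->
  (forall s x, U s -> `|wmean h1 (fun w => sin (s * (x - W1 w))) -
                      wmean h2 (fun w => sin (s * (x - W2 w)))| <= s * q s) ->
  forall x, `|wcdf h1 W1 x - wcdf h2 W2 x| <=
    9 / 8 * (\int[mu]_(s in U) q s + 24 * m).
Proof.
move=> m0 p1 p2 m1 m2 i1 i2 lip2 iq H x.
pose D y := wcdf h1 W1 y - wcdf h2 W2 y.
pose E := [set z | exists y, z = `|D y|].
have D1 y : `|D y| <= 1.
  have /andP[a0 a1] := wcdf_bounds y p1 m1; have /andP[b0 b1] := wcdf_bounds y p2 m2.
  by rewrite /D ler_norml; apply/andP; split; lra.
have hE : has_sup E.
  by split; [exists `|D x|; exists x|exists 1 => _ [y ->]].
have DE y : `|D y| <= sup E by apply: sup_upper_bound => //; exists y.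
have E0 : 0 <= sup E := le_trans (normr_ge0 _) (DE x).
set B := \int[mu]_(s in U) q s.
have B0 : 0 <= B.
  apply: Rintegral_ge0 => // s Us; have := Us; rewrite /= in_itv/= => /andP[s0 _].
  by rewrite -(pmulr_rge0 _ s0) (le_trans _ (H s 0 Us)).
have mass := @fejer_mass_ge R.
apply: le_trans (DE x) _; rewrite leNgt; apply/negP => EB.
set r := sup E in E0 EB.
have r0 : 0 < r by apply: le_lt_trans EB; apply: mulr_ge0; lra.
pose ep := (r - 9 / 8 * (B + 24 * m)) / 4.
have ep0 : 0 < ep by rewrite /ep; lra.
have [_ [x1 ->] Dx1] := sup_adherent ep0 hE.
(* Within distance [2 e] on one side of [x1] the second law changes by at most [m (2 e) = r / 2],
   while the first moves in the favourable direction; the difference keeps its sign and size at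
   least [L]. *)
pose e := r / (4 * m).
have e0 : 0 < e by rewrite divr_gt0// mulr_gt0.
pose L := r / 2 - ep.
have eE : m * (2 * e) = r / 2 by rewrite /e; field; exact/lt0r_neq0.
(* Origin of [24]: [L + r <= 3 r / 2] and [4 / e = 16 m / r]. *)
have LM : (L + r) * (4 / e) <= 24 * m.
  have -> : (L + r) * (4 / e) = (L + r) * 16 * m / r.
    by rewrite /e; field; rewrite !lt0r_neq0.
  rewrite ler_pdivrMr//; have : 0 <= ep * m by rewrite mulr_ge0 ?ltW.
  rewrite /L; nra.
have L0 : 0 <= L by rewrite /L /ep; lra.
(* Both signs of [D x1] end here: [16/9 L], that is [8/9 (r - 2 ep)], would be at most [B + 24 m],
   against the choice of [ep] as a quarter of the excess of [r]. *)
have concl : L * fine (@fejer_mass R) - (L + r) * (4 / e) <= B -> False.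
  move=> h; have Lmass : L * (16 / 9) <= L * fine (@fejer_mass R) by rewrite ler_wpM2l.
  have : L * (16 / 9) <= B + 24 * m.
    apply: le_trans Lmass _; apply: le_trans (_ : B + (L + r) * (4 / e) <= _).
      by rewrite -lerBlDr.
    by rewrite lerD2l.
  by move: ep0; clear; rewrite /L /ep; lra.
have mc h W : pdensity h -> measurable_fun [set: R] W -> forall z,
    measurable_fun [set: R] (fun y => wcdf h W (z - y)).
  move=> hp mW z; apply: (measurableT_comp (nondecreasing_measurable measurableT _)).
    exact: (wcdf_homo hp mW).
  exact: measurable_funB.
have key z := fejer_smoothing_diff p1 p2 m1 m2 i1 i2 iq (fun s => H s z).
have Lr : 0 <= L + r by lra.
have [D0|D0] := leP 0 (D x1).
  apply: concl.
  apply: le_trans (le_trans (ler_norm _) (key (x1 + e))).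
  apply: fejer_average_ge => //.
  - by apply: measurable_funB; exact: mc.
  - by move=> y; exact: DE.
  - move=> y; rewrite ler_norml => /andP[ye1 ye2].
    have h1' : wcdf h1 W1 x1 <= wcdf h1 W1 (x1 + e - y) by apply: wcdf_homo => //; lra.
    have h2' : wcdf h2 W2 (x1 + e - y) - wcdf h2 W2 x1 <= m * (x1 + e - y - x1).
      by apply: lip2; lra.
    have h3' : m * (x1 + e - y - x1) <= m * (2 * e) by apply: ler_wpM2l; lra.
    move: Dx1; rewrite ger0_norm// -/r /D /L; lra.
apply: concl.
(* For a negative difference the two laws exchange roles and the window lies to the left of [x1]. *)
have := key (x1 - e); rewrite -normrN => /(le_trans (ler_norm _)).
rewrite (_ : - _ = \int[mu]_y (fejer y * (wcdf h2 W2 (x1 - e - y) - wcdf h1 W1 (x1 - e - y)))).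
  apply: le_trans; apply: fejer_average_ge => //.
  - by apply: measurable_funB; exact: mc.
  - by move=> y; rewrite distrC; exact: DE.
  - move=> y; rewrite ler_norml => /andP[ye1 ye2].
    have h1' : wcdf h1 W1 (x1 - e - y) <= wcdf h1 W1 x1 by apply: wcdf_homo => //; lra.
    have h2' : wcdf h2 W2 x1 - wcdf h2 W2 (x1 - e - y) <= m * (x1 - (x1 - e - y)).
      by apply: lip2; lra.
    have h3' : m * (x1 - (x1 - e - y)) <= m * (2 * e) by apply: ler_wpM2l; lra.
    move: Dx1; rewrite ltr0_norm// -/r /D /L; lra.
rewrite -mulN1r -RintegralZl//.
  by apply: eq_Rintegral => y _; ring.
apply: (@le_integrable _ _ _ mu setT measurableT _ (EFin \o fejer)).
- apply/measurable_EFinP; apply: measurable_funM; first exact: measurable_fejer.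
  by apply: measurable_funB; exact: mc.
- by move=> y _ /=; rewrite lee_fin normrM ler_piMr//; exact: D1.
- exact: integrable_fejer.
Qed.

End WeightedLaw.

(** * The normal density *)

Section NormalLaw.
Context {R : realType}.
Let mu := @lebesgue_measure R.
Implicit Types (F g : R -> R) (t p x y z : R).

(** Dominated convergence along the intervals [[-n, n]], so decay along the integers suffices. *)
Lemma Rintegral_derive0 F g : (forall x : R, is_derive x 1 F (g x)) -> continuous g ->
  mu.-integrable [set: R] (EFin \o g) ->
  F n%:R @[n --> \oo] --> (0 : R) -> F (- n%:R) @[n --> \oo] --> (0 : R) ->
  \int[mu]_x g x = 0.
Proof.
move=> dF cg ig F1 F2.
pose g_ n x : \bar R := (g x * \1_(`[- n%:R, n%:R]%classic : set R) x)%:E.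
have mg : measurable_fun [set: R] g by exact: continuous_measurable_fun.
have mg_ n : measurable_fun [set: R] (g_ n).
  by apply/measurable_EFinP; apply: measurable_funM => //; exact: measurable_indic.
have gg : {ae mu, forall x, [set: R] x -> g_ ^~ x @ \oo --> (EFin \o g) x}.
  apply: aeW => x _; apply: cvg_near_cst.
  apply: filterS (nbhs_infty_ger `|x|) => n xn; rewrite /g_ indicE mem_set ?mulr1//=.
  by rewrite in_itv/= -ler_norml.
have gb : {ae mu, forall x n, [set: R] x -> (`|g_ n x| <= (abse \o (EFin \o g)) x)%E}.
  apply: aeW => x n _; rewrite /g_ /= lee_fin normrM indicE.
  by rewrite ler_piMr// normr_nat; case: (_ \in _).
have [_ _ H] := @dominated_convergence _ _ _ mu _ measurableT _ _ _ mg_ (measurable_int _ ig) gg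
  (integrable_abse ig) gb.
have e n : (\int[mu]_x g_ n x = (F n%:R - F (- n%:R))%:E)%E.
  have nn : - n%:R <= n%:R :> R by rewrite (@le_trans _ _ 0)// ?oppr_le0.
  rewrite -(integral_is_derive nn dF cg) [RHS]integral_mkcond.
  apply: eq_integral => x _; rewrite /g_ /patch indicE.
  by case: (x \in _); rewrite ?mulr1 ?mulr0.
have H0 : (\int[mu]_x g_ n x @[n --> \oo] --> (0 : R)%:E)%E.
  apply/fine_cvgP; split; first by apply: nearW => n; rewrite e.
  rewrite (_ : _ \o _ = fun n : nat => F n%:R - F (- n%:R)); last first.
    by apply/funext => n; rewrite /= e.
  by rewrite -[X in _ --> X](subrr (0 : R)); exact: cvgB.
by rewrite /Rintegral -(cvg_unique _ H0 H).
Qed.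

Definition gauss_pdf x : R := (Num.sqrt (2 * pi))^-1 * expR (- (x ^+ 2) / 2).

Let peakE : Num.sqrt (1 ^+ 2 * pi *+ 2) = Num.sqrt (2 * pi) :> R.
Proof. by rewrite expr1n mul1r mulr_natl. Qed.

Lemma gauss_pdfE : gauss_pdf = normal_pdf 0 1.
Proof.
rewrite normal_pdfE ?oner_neq0//; apply/funext => x.
by rewrite /gauss_pdf /normal_peak /normal_fun peakE subr0 expr1n.
Qed.

Lemma pdensity_gauss : pdensity gauss_pdf.
Proof.
rewrite gauss_pdfE; split.
- by move=> x; exact: normal_pdf_ge0.
- exact: measurable_normal_pdf.
- by apply: integral_normal_pdf; exact: oner_neq0.
Qed.

Let peak_gt0 : 0 < (Num.sqrt (2 * pi))^-1 :> R.
Proof. by rewrite invr_gt0 sqrtr_gt0 mulr_gt0 ?pi_gt0. Qed.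

Lemma gauss_pdf_le x : gauss_pdf x <= 1 / 2.
Proof.
rewrite gauss_pdfE (le_trans (normal_pdf_ub _ _ _)) ?oner_neq0//.
rewrite /normal_peak peakE div1r lef_pV2 ?posrE//; last first.
  by rewrite sqrtr_gt0 mulr_gt0 ?pi_gt0.
rewrite -[leLHS](ger0_norm (_ : 0 <= 2))// -sqrtr_sqr ler_sqrt//.
  by rewrite expr2 ler_pM2l// pi_ge2.
by rewrite mulr_ge0 ?pi_ge0.
Qed.

Lemma is_derive_gauss x : is_derive x 1 gauss_pdf (- x * gauss_pdf x).
Proof.
have d1 : is_derive x 1 (fun x : R => - (x ^+ 2) / 2) (- x).
  rewrite (_ : (fun _ => _) = (- 2^-1) \*: (id ^+ 2)); last first.
    by apply/funext => z; transitivity (- 2^-1 * z ^+ 2) => //; ring.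
  by apply: is_derive_eq; rewrite /GRing.scale/=; field.
have d2 := @is_derive1_comp R expR (fun x => - (x ^+ 2) / 2) x _ _ (is_derive_expR _) d1.
have d3 : is_derive x 1 gauss_pdf ((Num.sqrt (2 * pi))^-1 *: (expR (- (x ^+ 2) / 2) * - x)).
  rewrite (_ : gauss_pdf = (Num.sqrt (2 * pi))^-1 \*: (expR \o (fun x => - (x ^+ 2) / 2)))//.
  exact: is_deriveZ.
by apply: is_derive_eq d3 _; rewrite /GRing.scale/= /gauss_pdf; ring.
Qed.

Lemma continuous_gauss : continuous gauss_pdf.
Proof. by rewrite gauss_pdfE; apply: continuous_normal_pdf; exact: oner_neq0. Qed.

(** [|y| <= 1 + y^2 / 4 <= exp(y^2 / 4)], so the integrand is dominated by a multiple of the normal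
    density of variance [2]. *)
Lemma integrable_id_gauss : mu.-integrable [set: R] (EFin \o (fun x => x * gauss_pdf x)).
Proof.
have s0 : Num.sqrt 2 != 0 :> R by rewrite sqrtr_eq0 -ltNge.
have ip := @integrable_normal_pdf R 0 (Num.sqrt 2).
pose K : R := (normal_peak (Num.sqrt 2))^-1.
apply: (@le_integrable _ _ _ mu setT measurableT _
  (EFin \o (fun y => (Num.sqrt (2 * pi))^-1 * K * normal_pdf 0 (Num.sqrt 2) y))).
- apply/measurable_EFinP; apply: measurable_funM => //.
  by have [] := pdensity_gauss.
- move=> y _ /=; rewrite lee_fin normrM.
  have g0 : 0 <= gauss_pdf y by have [] := pdensity_gauss.
  rewrite (ger0_norm g0) (le_trans _ (ler_norm _))//.
  rewrite normal_pdfE// mulrA divfK; last by rewrite gt_eqF// normal_peak_gt0.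
  rewrite /gauss_pdf mulrCA ler_pM2l// /normal_fun subr0 sqr_sqrtr//.
  apply: (@le_trans _ _ (expR (y ^+ 2 / 4) * expR (- y ^+ 2 / 2))).
    rewrite ler_wpM2r ?expR_ge0// (le_trans _ (expR_ge1Dx _))//.
    have := sqr_ge0 (`|y| / 2 - 1); rewrite sqrrB exprMn real_normK ?num_real//; lra.
  by rewrite -expRD ler_expR; lra.
- by apply: (integrable_scale _ measurableT).
Qed.

Let gaussn : gauss_pdf n%:R @[n --> \oo] --> (0 : R).
Proof.
have h : 2 * n.+1%:R^-1 @[n --> \oo] --> (0 : R).
  by rewrite -[X in _ --> X](mulr0 2); apply: cvgM (@cvg_harmonic R); exact: cvg_cst.
apply: (@squeeze_cvgr _ _ _ _ (fun=> 0) (fun n => 2 * n.+1%:R^-1)) => //; last exact: cvg_cst.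
apply: nearW => n; apply/andP; split; first by have [] := pdensity_gauss.
rewrite /gauss_pdf (@le_trans _ _ (expR (- (n%:R ^+ 2) / 2)))//.
  rewrite ler_piMl ?expR_ge0// invf_le1 ?sqrtr_gt0 ?mulr_gt0 ?pi_gt0//.
  rewrite -[leLHS]sqrtr1 ler_sqrt//; first by have := pi_ge2 R; lra.
  by rewrite mulr_ge0 ?pi_ge0.
rewrite mulNr expRN -[leRHS]invrK invf_div lef_pV2 ?posrE ?expR_gt0//.
  rewrite (le_trans _ (expR_ge1Dx _))//.
  have := sqr_ge0 (n%:R - 1 : R); rewrite sqrrB -natr1; have : 0 <= n%:R :> R by [].
  by have := sqr_ge0 (n%:R : R); lra.
Qed.

Let gaussN x : gauss_pdf (- x) = gauss_pdf x.
Proof. by rewrite /gauss_pdf sqrrN. Qed.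

Let sin_aff t p : measurable_fun [set: R] (fun w => sin (t * w + p)).
Proof.
apply: (measurableT_comp (@measurable_sin R)); exact: measurable_funD.
Qed.

Let cos_aff t p : measurable_fun [set: R] (fun w => cos (t * w + p)).
Proof.
apply: (measurableT_comp (@measurable_cos R)); exact: measurable_funD.
Qed.

Let sin_le1' x : `|sin x| <= 1. Proof. by rewrite ler_norml sin_geN1 sin_le1. Qed.
Let cos_le1' x : `|cos x| <= 1. Proof. by rewrite ler_norml cos_geN1 cos_le1. Qed.

Let isin t p : mu.-integrable [set: R] (EFin \o (fun w => sin (t * w + p) * gauss_pdf w)).
Proof. exact: (wmean_integrable (M := 1) pdensity_gauss). Qed.

Let icos t p :
  mu.-integrable [set: R] (EFin \o (fun w => cos (t * w + p) * (w * gauss_pdf w))).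
Proof.
apply: (@le_integrable _ _ _ mu setT measurableT _ (EFin \o (fun x => x * gauss_pdf x))).
- apply/measurable_EFinP; apply: measurable_funM; first exact: cos_aff.
  by have [_ mg _] := pdensity_gauss; exact: measurable_funM.
- by move=> w _ /=; rewrite lee_fin normrM ler_piMl.
- exact: integrable_id_gauss.
Qed.

Let d_aff (s t p : R) : is_derive s 1 (fun s : R => t * s + p) t.
Proof.
rewrite (_ : (fun _ => _) = t \*: id + cst p); last by apply/funext.
by apply: is_derive_eq; rewrite /GRing.scale/= mulr1 addr0.
Qed.

Let parts t p :
  \int[mu]_w (cos (t * w + p) * (w * gauss_pdf w)) =
  - t * \int[mu]_w (sin (t * w + p) * gauss_pdf w).
Proof.
pose F w := - (cos (t * w + p) * gauss_pdf w).
have dF (w : R) : is_derive w 1 F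
    (cos (t * w + p) * (w * gauss_pdf w) + t * (sin (t * w + p) * gauss_pdf w)).
  have d1 := @is_derive1_comp R cos _ w _ _ (is_derive_cos _) (d_aff w t p).
  have d2 := is_derive_gauss w.
  rewrite (_ : F = - ((cos \o (fun s => t * s + p)) * gauss_pdf)); last by apply/funext.
  by apply: is_derive_eq; rewrite /GRing.scale/=; ring.
have cF (w : R) : {for w, continuous (fun w => t * w + p)}.
  apply: differentiable_continuous; apply/derivable1_diffP.
  by have [] := d_aff w t p.
have lim (s : R^nat) : (forall n, gauss_pdf (s n) = gauss_pdf n%:R) ->
    F (s n) @[n --> \oo] --> (0 : R).
  move=> sn; suff : `|F (s n)| @[n --> \oo] --> (0 : R) by exact: norm_cvg0.
  apply: (@squeeze_cvgr _ _ _ _ (fun=> 0) (fun n => gauss_pdf n%:R)).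
  - apply: nearW => n; rewrite normr_ge0 /F normrN normrM sn.
    have g0 : 0 <= gauss_pdf n%:R by have [] := pdensity_gauss.
    by rewrite (ger0_norm g0) ler_piMl.
  - exact: cvg_cst.
  - exact: gaussn.
have := Rintegral_derive0 dF.
have -> : \int[mu]_w (cos (t * w + p) * (w * gauss_pdf w) + t * (sin (t * w + p) * gauss_pdf w)) =
   \int[mu]_w (cos (t * w + p) * (w * gauss_pdf w)) + t * \int[mu]_w (sin (t * w + p) * gauss_pdf w).
  rewrite RintegralD//; last exact: (integrable_scale _ measurableT).
  by rewrite RintegralZl.
have ig : mu.-integrable [set: R] (EFin \o (fun w =>
   cos (t * w + p) * (w * gauss_pdf w) + t * (sin (t * w + p) * gauss_pdf w))).
  have := integrableD measurableT (icos t p) (integrable_scale t measurableT (isin t p)).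
  by congr (integrable _ _ _); apply/funext.
move=> /(_ _ ig) h; have := h _ (lim (fun n => n%:R) _) (lim (fun n => - n%:R) _).
move=> /(_ _ _ _)/= h2; rewrite mulNr; apply/eqP; rewrite -subr_eq0 opprK; apply/eqP.
apply: h2 => //; move=> w; apply: (@cvgD _ R^o).
  apply: cvgM; first by apply: (cvg_comp _ _ (cF w)); exact: continuous_cos.
  by apply: cvgM; [exact: cvg_id|exact: continuous_gauss].
apply: cvgM; first exact: cvg_cst.
apply: cvgM; first by apply: (cvg_comp _ _ (cF w)); exact: continuous_sin.
exact: continuous_gauss.
Qed.

(** Differentiation under the integral and [parts] give [psi' = - t psi], so [psi exp(t^2 / 2)] is
    constant. The free phase [p] covers sine and cosine at once. *)
Lemma wmean_gauss_sin t p :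
  wmean gauss_pdf (fun w => sin (t * w + p)) = sin p * expR (- (t ^+ 2) / 2).
Proof.
pose psi t := \int[mu]_w (sin (t * w + p) * gauss_pdf w).
have dpsi (s : R) : is_derive s 1 psi (- s * psi s).
  pose f (y w : R) := sin (y * w + p) * gauss_pdf w.
  pose B := `]s - 1, s + 1[%classic.
  have Is : B s by rewrite /B /= in_itv/=; apply/andP; split; lra.
  have df (y w : R) : is_derive y 1 (f ^~ w) (cos (y * w + p) * (w * gauss_pdf w)).
    have d1 := @is_derive1_comp R sin _ y _ _ (is_derive_sin _) (d_aff y w p).
    have d2 : is_derive y 1 (f ^~ w) (gauss_pdf w *: (cos (w * y + p) * w)).
      rewrite (_ : f ^~ w = gauss_pdf w \*: (sin \o (fun s => w * s + p))).
        exact: is_deriveZ.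
      by apply/funext => z; rewrite /f /= mulrC (mulrC z).
    by apply: is_derive_eq d2 _; rewrite /GRing.scale/= (mulrC y); ring.
  have D y w : partial1of2 f y w = cos (y * w + p) * (w * gauss_pdf w).
    by rewrite partial1of2E; exact: (@derive_val _ _ _ _ _ _ _ (df y w)).
  have h1 y : B y -> mu.-integrable [set: R] (EFin \o f y) by move=> _; exact: isin.
  have h2 y w : B y -> [set: R] w -> derivable (f ^~ w) y 1 by move=> _ _; have [] := df y w.
  have h3 y w : B y -> [set: R] w -> `|partial1of2 f y w| <= `|w * gauss_pdf w|.
    by move=> _ _; rewrite D normrM ler_piMl.
  have h4 : mu.-integrable [set: R] (EFin \o (fun w => `|w * gauss_pdf w|)).
    exact: integrable_norm integrable_id_gauss.
  have h0 w : 0 <= `|w * gauss_pdf w| by [].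
  have h5 := @derivable_under_integral R _ _ mu f _ measurableT s _ _ Is h1 h2 _ h0 h4 h3.
  apply: DeriveDef => //; rewrite -derive1E.
  rewrite (@differentiation_under_integral R _ _ mu f _ measurableT s _ _ Is h1 h2 _ h0 h4 h3).
  by rewrite -parts; apply: eq_Rintegral => w _; rewrite D.
have dchi (s : R) : is_derive s 1 (fun s => psi s * expR (s ^+ 2 / 2)) 0.
  have d1 : is_derive s 1 (fun x : R => x ^+ 2 / 2) s.
    rewrite (_ : (fun _ => _) = 2^-1 \*: (id ^+ 2)); last first.
      by apply/funext => z; transitivity (2^-1 * z ^+ 2) => //; ring.
    by apply: is_derive_eq; rewrite /GRing.scale/=; field.
  have d2 := @is_derive1_comp R expR (fun x => x ^+ 2 / 2) s _ _ (is_derive_expR _) d1.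
  have := is_deriveM (dpsi s) d2.
  by move/is_derive_eq; apply; rewrite /GRing.scale/=; ring.
have := is_derive_0_is_cst t 0 dchi.
rewrite expr0n/= mul0r expR0 mulr1 /psi.
under [X in _ = X -> _]eq_Rintegral do rewrite mul0r add0r.
rewrite -/(wmean _ _) -/(wmean _ _) (wmean_cst _ pdensity_gauss) => <-.
by rewrite -mulrA -expRD mulNr addrN expR0 mulr1.
Qed.

(** Scaling by [T] brings the frequency cut-off to [1], the range of the kernel. *)
Lemma wcdf_gauss T z : 0 < T -> wcdf gauss_pdf (fun w => T * w) (T * z) = std_normal_cdf z.
Proof.
move=> T0; rewrite /wcdf /wmean /std_normal_cdf.
transitivity (\int[mu]_(y in `]-oo, z]) gauss_pdf y).
  rewrite /Rintegral [in RHS]integral_mkcond; congr fine; apply: eq_integral => y _.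
  rewrite /patch ler_pM2l// (_ : (y \in _) = (y <= z)); last first.
    by apply/idP/idP; rewrite inE/= in_itv.
  by case: (y <= z); rewrite ?mul1r ?mul0r.
rewrite /gauss_pdf RintegralZl//.
have := integrable_scale (mu := mu) (Num.sqrt (2 * pi)) (measurable_itv `]-oo, z])
  (integrableS (mu := mu) measurableT (measurable_itv _) (@subsetT _ _)
    (pdensity_integrable pdensity_gauss)).
congr (integrable _ _ _); apply/funext => y.
by rewrite /= /gauss_pdf mulrA divff ?mul1r// gt_eqF// sqrtr_gt0 mulr_gt0 ?pi_gt0.
Qed.

Lemma std_normal_cdf_lip x y : x <= y -> std_normal_cdf y - std_normal_cdf x <= (y - x) / 2 :> R.
Proof.
move=> xy; rewrite -!(wcdf_gauss _ ltr01) /wcdf /wmean.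
have ic z : mu.-integrable [set: R]
    (EFin \o (fun w => (1 * w <= 1 * z)%R%:R * gauss_pdf w)).
  apply: (wmean_integrable (M := 1) pdensity_gauss); last by move=> w; rewrite normr_nat lern1; case: (_ <= _).
  apply: measurable_le_nat; exact: measurable_funM.
rewrite -RintegralB//.
apply: (@le_trans _ _ (\int[mu]_w (2^-1 * \1_(`]x, y]%classic : set R) w))).
  apply: le_Rintegral => //.
  - exact: integrable_diff.
  - apply: (integrable_scale (mu := mu)) => //; exact: integrable_indic_itv.
  - move=> w _; rewrite !mul1r indicE -mulrBl.
    have g0 : 0 <= gauss_pdf w by have [] := pdensity_gauss.
    have -> : ((w <= y)%R%:R - (w <= x)%R%:R : R) = (w \in `]x, y]%classic)%:R.
      have -> : (w \in `]x, y]%classic) = (x < w) && (w <= y).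
        by apply/idP/idP; rewrite inE/= in_itv.
      case: (leP w x) => [wx|_]; last by rewrite subr0.
      by rewrite (le_trans wx xy) subrr.
    by rewrite mulrC -div1r; apply: ler_wpM2r => //; exact: gauss_pdf_le.
rewrite RintegralZl//; last exact: integrable_indic_itv.
rewrite mulrC ler_wpM2r// /Rintegral integral_indic//= setIT lebesgue_measure_itv/= lte_fin.
by case: ifPn => [//|_]; rewrite /= subr_ge0.
Qed.

End NormalLaw.

(** * Ruelle operators *)

Section Ruelle.
Context {R : realType}.
Variable d : R -> R -> R.
Local Notation X := (fun x : R => x \in `[0%R, 1%R]).
Hypothesis d_ge0 : forall x y, X x -> X y -> 0 <= d x y.
Hypothesis d_le1 : forall x y, X x -> X y -> d x y <= 1.
Hypothesis d_sym : forall x y, X x -> X y -> d x y = d y x.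
Hypothesis d_gt0 : 0 < d 0 1.
Variables (wt br : nat -> R -> R) (K G r : R).
Hypotheses (G_gt0 : 0 < G) (r_ge0 : 0 <= r).
Hypothesis wt_ge0 : forall n x, 0 <= wt n x.
Hypothesis wt_lip : forall n x y, X x -> X y -> wt n x <= expR (G * d x y) * wt n y.
Hypothesis br_in : forall n x, X x -> X (br n x).
Hypothesis br_lip : forall n x y, X x -> X y -> d (br n x) (br n y) <= r * d x y.
Hypothesis wt_sum : forall x N, X x -> \sum_(0 <= n < N) wt n x <= K.

Definition ruelle_terms (u : R -> R) (x : R) : R^nat := fun n => wt n x * u (br n x).
(** An ordinary limit over branches enumerated by natural numbers, so that signed functions need no
    splitting into positive and negative parts. *)
Definition ruelle (u : R -> R) (x : R) : R := limn (series (ruelle_terms u x)).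

Lemma ruelle_cvg u x (M : R) : (forall y, X y -> `|u y| <= M) -> X x ->
  cvgn (series (ruelle_terms u x)).
Proof.
move=> uM Xx; apply: normed_cvg; apply: nondecreasing_is_cvgn.
  by apply: nondecreasing_series => n _ _ /=.
exists (K * M) => _ [N _ <-]; rewrite /series /=.
have M0 : 0 <= M := le_trans (normr_ge0 _) (uM x Xx).
apply: (@le_trans _ _ (\sum_(0 <= n < N) wt n x * M)).
  apply: ler_sum => n _; rewrite normrM (ger0_norm (wt_ge0 _ _)).
  by rewrite ler_wpM2l// uM// br_in.
by rewrite -mulr_suml ler_wpM2r// wt_sum.
Qed.

Let dcvg u x : dlip d u -> X x -> cvgn (series (ruelle_terms u x)).
Proof.
by move=> ul Xx; have [M _ uM] := dlip_bounded d_ge0 d_le1 ul; exact: ruelle_cvg uM Xx.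
Qed.

Lemma ruelle_lin (k l : R) u v x : dlip d u -> dlip d v -> X x ->
  ruelle (fun x => k * u x + l * v x) x = k * ruelle u x + l * ruelle v x.
Proof.
move=> ul vl Xx; apply/cvg_lim => //.
rewrite (_ : series _ = fun n => k * series (ruelle_terms u x) n + l * series (ruelle_terms v x) n).
  by apply: cvgD; apply: cvgM; [exact: cvg_cst|exact: dcvg|exact: cvg_cst|exact: dcvg].
apply/funext => n; rewrite /series /= !mulr_sumr -big_split; apply: eq_bigr => i _ /=.
by rewrite /ruelle_terms; ring.
Qed.

Lemma ruelle_ext u v x : (forall x, X x -> u x = v x) -> X x -> ruelle u x = ruelle v x.
Proof.
move=> uv Xx; rewrite /ruelle; congr (limn (series _)); apply/funext => n.
by rewrite /ruelle_terms uv// br_in.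
Qed.

(** In each term the weight contributes aperture [G], and composition with a contracting branch
    turns [c] into [c r]; the inequality passes to the limit. *)
Lemma ruelle_cone (c : R) u : 0 < c -> cone d c u -> cone d (G + c * r) (ruelle u).
Proof.
move=> c0 cu x y Xx Xy; have ul := cone_dlip d_ge0 d_le1 d_sym d_gt0 c0 cu.
have u0 z : X z -> 0 <= u z by move=> Xz; exact: (cone_ge0 d_sym d_gt0 c0 cu Xz).
have cy : expR ((G + c * r) * d x y) * series (ruelle_terms u y) n @[n --> \oo] -->
    expR ((G + c * r) * d x y) * ruelle u y.
  by apply: cvgM; [exact: cvg_cst|exact: dcvg].
apply: (ler_cvg_to (dcvg ul Xx) cy).
apply: nearW => n; rewrite /series /= mulr_sumr; apply: ler_sum => i _.
rewrite /ruelle_terms mulrDl expRD mulrACA.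
have h1 := wt_lip i Xx Xy; have h2 := cu _ _ (br_in i Xx) (br_in i Xy).
apply: ler_pM => //; first exact/u0/br_in.
apply: (le_trans h2); rewrite ler_wpM2r ?u0 ?br_in// ler_expR.
by rewrite -mulrA ler_pM2l// br_lip.
Qed.

Lemma lip_cone (u : R -> R) (k m : R) : 0 < m ->
  (forall x y, X x -> X y -> `|u x - u y| <= k * d x y) ->
  (forall x, X x -> m <= u x) -> cone d (`|k| / m) u.
Proof.
move=> m0 uk um x y Xx Xy; have d0 := d_ge0 Xx Xy.
have uy : 0 < u y := lt_le_trans m0 (um y Xy).
apply: (@le_trans _ _ ((1 + `|k| / m * d x y) * u y)); last first.
  by rewrite ler_pM2r// expR_ge1Dx.
have h1 : `|k| * d x y <= `|k| * d x y * (u y / m).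
  by apply: ler_peMr; [exact: mulr_ge0|rewrite ler_pdivlMr// mul1r um].
have h2 : k * d x y <= `|k| * d x y by rewrite ler_wpM2r// ler_norm.
have := le_trans (ler_norm _) (uk x y Xx Xy).
have -> : (1 + `|k| / m * d x y) * u y = u y + `|k| * d x y * (u y / m) by ring.
lra.
Qed.

(** [u + (M + 1)] is at least [1], hence in a cone, as are constants; [ruelle u] is a linear
    combination of the images of two cone elements, which are Lipschitz by [cone_dlip]. *)
Lemma ruelle_dlip u : dlip d u -> dlip d (ruelle u).
Proof.
move=> ul; have [M M0 uM] := dlip_bounded d_ge0 d_le1 ul; have [k uk] := ul.
pose c := `| `|k| + 1 | / (1 : R).
have c0 : 0 < c by rewrite /c divr1 normr_gt0 gt_eqF// ltr_wpDl.
have vcone : cone d c (fun x => 1 * u x + (M + 1) * 1).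
  apply: lip_cone => //.
    move=> x y Xx Xy; rewrite (_ : _ - _ = u x - u y); last by ring.
    apply: (le_trans (uk x y Xx Xy)); apply: ler_wpM2r; first exact: d_ge0.
    by rewrite (le_trans (ler_norm k))// lerDl.
  by move=> x Xx; have := uM x Xx; rewrite ler_norml => /andP[]; lra.
have ccone : cone d c (fun=> 1).
  move=> x y Xx Xy; rewrite mulr1 -expR0 ler_expR; apply: mulr_ge0; first exact: ltW.
  exact: d_ge0.
have lip1 v : cone d c v -> dlip d (ruelle v).
  move=> vc; have kc := ruelle_cone c0 vc.
  have Gc : 0 < G + c * r by rewrite ltr_wpDr// mulr_ge0// ltW.
  by apply: (cone_dlip _ _ _ _ Gc kc).
have ul1 := dlip_cst d (1 : R).
have ul2 := dlip_lin 1 (M + 1) ul ul1.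
apply: eq_dlip (dlip_lin 1 (- (M + 1)) (lip1 _ vcone) (lip1 _ ccone)) => x Xx.
by rewrite ruelle_lin//; ring.
Qed.

Lemma ruelle_nneseries u x : dlip d u -> (forall y, X y -> 0 <= u y) -> X x ->
  (\sum_(n <oo) (wt n x * u (br n x))%:E = (ruelle u x)%:E)%E.
Proof.
move=> ul u0 Xx; rewrite /ruelle -EFin_lim; last exact: dcvg.
congr (limn _); apply/funext => n /=.
by rewrite /series /= sumEFin.
Qed.

(** A fixed function of aperture [c] also has aperture [G + c r]. Under iteration the apertures
    converge to [G / (1 - r)], and the cone inequality is closed. *)
Lemma ruelle_fixed_cone (h : R -> R) (c : R) : 0 < c -> r < 1 ->
  cone d c h -> (forall x, X x -> ruelle h x = h x) -> cone d (G / (1 - r)) h.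
Proof.
move=> c0 r1 ch hE.
pose k n := G / (1 - r) + r ^+ n * (c - G / (1 - r)).
have r1' : 1 - r != 0 by rewrite gt_eqF// subr_gt0.
have kc n : 0 < k n /\ cone d (k n) h.
  elim: n => [|n [kn0 IH]].
    by rewrite /k expr0 mul1r addrC subrK.
  have e : G + k n * r = k n.+1 by rewrite /k exprS; field.
  split; first by rewrite -e ltr_wpDr// mulr_ge0// ltW.
  by rewrite -e; apply: eq_cone (ruelle_cone kn0 IH) => x Xx; exact: hE.
move=> x y Xx Xy.
have lim : expR (k n * d x y) * h y @[n --> \oo] --> expR (G / (1 - r) * d x y) * h y.
  apply: cvgM; last exact: cvg_cst.
  apply: (cvg_comp _ expR); last exact: continuous_expR.
  apply: cvgM; last exact: cvg_cst.
  rewrite -[X in _ --> X]addr0 /k; apply: cvgD; first exact: cvg_cst.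
  rewrite -(mul0r (c - G / (1 - r))); apply: cvgM; last exact: cvg_cst.
  by apply: cvg_expr; rewrite ger0_norm.
apply: (@closed_cvg _ _ _ _ _ (fun z => h x <= z) _ _ _ lim).
  exact: closed_ge.
by apply: nearW => n; have [_] := kc n; apply.
Qed.

End Ruelle.

(** * Change of variables along a branch *)

Section Transport.
Import HBNNSimple.
Context d d' (T : measurableType d) (T' : measurableType d') {R : realType}.
Variables (mu : {measure set T -> \bar R}) (nu : {measure set T' -> \bar R}).

Lemma integral_transport (E : set T) (w : T' -> R) (s : T' -> T) : measurable E ->
  (forall y, 0 <= w y) -> measurable_fun [set: T'] w -> measurable_fun [set: T'] s ->
  (forall A, measurable A -> mu (E `&` A) = \int[nu]_y (w y * \1_A (s y))%:E)%E ->
  forall F : T -> \bar R, measurable_fun [set: T] F -> (forall x, (0 <= F x)%E) ->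
  (\int[mu]_(x in E) F x = \int[nu]_y ((w y)%:E * F (s y)))%E.
Proof.
move=> mE w0 mw ms ind F mF F0.
pose h := nnsfun_approx measurableT mF.
have hF x : (h n x)%:E @[n --> \oo] --> F x by exact: cvg_nnsfun_approx.
have hnd x : {homo (fun n => h n x) : n m / (n <= m)%N >-> n <= m}.
  by move=> m n mn; exact/lefP/nd_nnsfun_approx.
have -> : (\int[mu]_(x in E) F x = limn (fun n => \int[mu]_(x in E) (h n x)%:E))%E.
  rewrite -monotone_convergence//.
  - by apply: eq_integral => x _; apply/esym/cvg_lim => //; exact: hF.
  - by move=> n; apply/measurable_EFinP; apply: measurable_funTS; exact: measurable_funP.
  - by move=> n x _; rewrite lee_fin.
  - by move=> x _ m n mn; rewrite lee_fin hnd.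
have -> : (\int[nu]_y ((w y)%:E * F (s y)) =
    limn (fun n => \int[nu]_y ((w y)%:E * (h n (s y))%:E)))%E.
  rewrite -monotone_convergence//.
  - apply: eq_integral => y _; apply/esym/cvg_lim => //.
    by apply: cvgeZl => //; exact: hF.
  - move=> n; apply/measurable_EFinP; apply: measurable_funM => //.
    exact: measurableT_comp.
  - by move=> n y _; rewrite -EFinM lee_fin mulr_ge0.
  - by move=> y _ m n mn; rewrite -!EFinM lee_fin ler_wpM2l// hnd.
congr (limn _); apply/funext => n.
set v := finmap.enum_fset (fset_set (range (h n))).
pose A (i : 'I_(size v)) := h n @^-1` [set v`_i].
have mA i : measurable (A i) by rewrite -[A i]setTI; exact: measurable_funP.
have v0 (i : 'I_(size v)) : 0 <= v`_i.
  have : v`_i \in v by rewrite mem_nth.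
  rewrite in_fset_set; last exact: fimfunP.
  by move=> /set_mem[x _ <-].
transitivity (\int[mu]_(x in E) (\sum_(i < (size v)) (v`_i * \1_(A i) x)%:E))%E.
  by apply: eq_integral => x _; rewrite fimfunEord sumEFin.
rewrite ge0_integral_sum//; last 2 first.
- by move=> i; apply/measurable_EFinP; apply: measurable_funM => //; exact: measurable_indic.
- by move=> i x _; rewrite lee_fin mulr_ge0.
transitivity (\int[nu]_y (\sum_(i < (size v)) (v`_i * (w y * \1_(A i) (s y)))%:E))%E; last first.
  apply: eq_integral => y _; rewrite fimfunEord sumEFin -EFinM mulr_sumr.
  by congr _%:E; apply: eq_bigr => i _; rewrite mulrCA.
have mind (i : 'I_(size v)) : measurable_fun [set: T'] (fun y => w y * \1_(A i) (s y)).
  by apply: measurable_funM => //; apply: measurableT_comp.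
rewrite ge0_integral_sum//; last 2 first.
- by move=> i; apply/measurable_EFinP; exact: measurable_funM.
- by move=> i x _; rewrite lee_fin !mulr_ge0.
apply: eq_bigr => i _; under eq_integral do rewrite EFinM.
under [RHS]eq_integral do rewrite EFinM.
rewrite !ge0_integralZl//; last 5 first.
- by apply/measurable_EFinP.
- by move=> y _; rewrite lee_fin mulr_ge0.
- by rewrite lee_fin.
- by apply/measurable_EFinP; exact: measurable_indic.
- by rewrite lee_fin.
by congr (_ * _)%E; rewrite -ind// integral_indic// setIC.
Qed.

End Transport.

Section Rays.
Context {R : realType}.
Let mu := @lebesgue_measure R.
Variables (w s : R -> R).
Hypotheses (w0 : forall y, 0 <= w y) (mw : measurable_fun [set: R] w).
Hypothesis ms : measurable_fun [set: R] s.

Let m2 (A : set (measurableTypeR R)) : \bar R := (\int[mu]_(y in s @^-1` A) (w y)%:E)%E.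

Let m2_0 : m2 set0 = 0%E.
Proof. by rewrite /m2 preimage_set0 integral_set0. Qed.

Let m2_ge0 A : (0 <= m2 A)%E.
Proof. by apply: integral_ge0 => y _; rewrite lee_fin. Qed.

Let m2_sigma : semi_sigma_additive m2.
Proof.
move=> /= A mA tA mUA; rewrite /m2 preimage_bigcup ge0_integral_bigcup//.
- by apply: is_cvg_ereal_nneg_natsum_cond => n _ _; exact: m2_ge0.
- by move=> k; have := ms measurableT (mA k); rewrite setTI.
- by apply: measurable_funTS; exact/measurable_EFinP.
- by move=> y _; rewrite lee_fin.
- apply/trivIsetP => i j _ _ ij; rewrite -preimage_setI.
  by have /trivIsetP/(_ i j I I ij) -> := tA; rewrite preimage_set0.
Qed.

HB.instance Definition _ := isMeasure.Build _ _ _ m2 m2_0 m2_ge0 m2_sigma.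

(** Open left rays generate the Borel sets and are stable under intersection, so the restricted
    Lebesgue measure and the image measure [m2] agree once they agree on rays; [mu E] finite makes
    them finite on an exhausting sequence of rays. *)
Lemma integral_transport_rays (E : set R) : measurable E -> (mu E < +oo)%E ->
  (forall x, mu (E `&` `]-oo, x[) = \int[mu]_(y in s @^-1` `]-oo, x[) (w y)%:E)%E ->
  forall F : R -> \bar R, measurable_fun [set: R] F -> (forall x, (0 <= F x)%E) ->
  (\int[mu]_(x in E) F x = \int[mu]_y ((w y)%:E * F (s y)))%E.
Proof.
move=> mE finE rays F mF F0; apply: integral_transport => // A mA.
transitivity (m2 A); last first.
  rewrite /m2 [LHS]integral_mkcond; apply: eq_integral => y _.
  rewrite /patch indicE (_ : (y \in s @^-1` A) = (s y \in A)); last first.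
    by apply/idP/idP => /set_mem h; exact/mem_set.
  by case: (_ \in A); rewrite ?mulr1 ?mulr0.
transitivity (mrestr mu mE A); first by rewrite /mrestr setIC.
apply: (@measure_unique _ R (measurableTypeR R) (@RGenInftyO.G R) (fun n => `]-oo, n%:R[%classic)
  _ _ _ _ (mrestr mu mE) m2) => //.
- exact: RGenInftyO.measurableE.
- move=> _ _ [x ->] [y ->]; exists (Num.min x y); apply/seteqP; split => z /=.
    by rewrite !in_itv/= lt_min => -[-> ->].
  by rewrite !in_itv/= lt_min => /andP[-> ->].
- by move=> n; exists n%:R.
- apply/seteqP; split => // x _.
  exists (Num.bound `|x : R|) => //=; rewrite in_itv/=.
  exact: le_lt_trans (ler_norm (x : R)) (archi_boundP (normr_ge0 _)).
- by move=> _ [x ->]; rewrite /= /mrestr setIC; exact: rays.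
- move=> n; apply: le_lt_trans finE; rewrite /= /mrestr.
  apply: le_measure; [|exact: mem_set|exact: subIsetr].
  by apply: mem_set; apply: measurableI => //; exact: measurable_itv.
Qed.

End Rays.

Lemma within_unit_itv (R : realType) (s : R -> R) (a b : R) :
  {within `[0, 1], continuous s} -> (forall z, z \in `]0, 1[ -> s z \in `[a, b]) ->
  forall y, y \in `[0, 1] -> s y \in `[a, b].
Proof.
move=> cs inab y.
have [_ h0 h1] := (continuous_within_itvP _ (@ltr01 R)).1 cs.
rewrite in_itv/= !le_eqVlt => /andP[/predU1P[<- _|y0 /predU1P[->|y1]]].
- apply: (@closed_cvg _ R _ _ s (`[a, b]%classic : set R) _ _ _ h0); first exact: itv_closed.
  near=> z; apply: inab; rewrite in_itv/=; apply/andP; split; near: z.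
    exact: nbhs_right_gt.
  exact: nbhs_right_lt.
- apply: (@closed_cvg _ R _ _ s (`[a, b]%classic : set R) _ _ _ h1); first exact: itv_closed.
  near=> z; apply: inab; rewrite in_itv/=; apply/andP; split; near: z.
    exact: nbhs_left_gt.
  exact: nbhs_left_lt.
- by apply: inab; rewrite in_itv/= y0.
Unshelve. all: by end_near. Qed.

Section Branch.
Context {R : realType}.
Let mu := @lebesgue_measure R.
Variables (T s g : R -> R) (a b e : R).
Hypothesis e_sign : e = 1 \/ e = -1.
Hypothesis dT : {in `]a, b[, forall x : R, derivable T x 1}.
Hypothesis T'0 : {in `]a, b[, forall x, derive1 T x != 0}.
Hypothesis monoT : {in `]a, b[ &, forall x y, x < y -> e * T x < e * T y}.
Hypothesis ontoT : T @` `]a, b[ = `]0, 1[%classic.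
Hypothesis TK : {in `]a, b[, cancel T s}.
Hypothesis cs : {within `[0, 1], continuous s}.
Hypothesis gE : {in `]0, 1[, forall y, g y = - ln `|derive1 T (s y)|}.
Hypothesis cg : {within `[0, 1], continuous g}.

Let sP y : y \in `]0, 1[ -> (s y \in `]a, b[) /\ (T (s y) = y).
Proof.
move=> y01; have : (T @` `]a, b[) y by rewrite ontoT.
by move=> [x /= xab <-]; rewrite TK.
Qed.

Let ab : a < b.
Proof.
have h : (1 / 2 : R) \in `]0, 1[ by rewrite in_itv/=; lra.
have [] := sP h; rewrite in_itv/= => /andP[h1 h2] _; exact: lt_trans h2.
Qed.

Let ee : e * e = 1.
Proof. by case: e_sign => ->; rewrite ?mulr1// mulrNN mulr1. Qed.

Let ne : `|e| = 1.
Proof. by case: e_sign => ->; rewrite ?normrN1 ?normr1. Qed.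

Let eT'_gt0 x : x \in `]a, b[ -> 0 < e * derive1 T x.
Proof.
move=> xab; rewrite lt_neqAle eq_sym mulf_neq0 ?T'0//=; last first.
  by rewrite -normr_eq0 ne oner_eq0.
rewrite -derive1Ml; last exact: dT.
apply: (@incr_derive1_ge0_itv _ _ false true a b _ _ monoT xab).
by move=> z /set_mem zab; apply: derivableZ; exact: dT.
Qed.

(** Inverse function theorem. The sign [e] of the branch relates [1 / |T'| = exp g] to the
    derivative of [s], so both orientations share one formula. *)
Let ds (y : R) : y \in `]0, 1[ -> is_derive y 1 s (e * expR (g y)).
Proof.
move=> y01; have [sab Ts] := sP y01.
have -> : e * expR (g y) = (derive1 T (s y))^-1.
  have T0 := T'0 sab; have eT := eT'_gt0 sab.
  rewrite gE// expRN lnK ?posrE ?normr_gt0//.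
  have -> : `|derive1 T (s y)| = e * derive1 T (s y).
    by rewrite -[LHS]mul1r -ne -normrM ger0_norm// ltW.
  by rewrite invfM mulrA divff ?mul1r// -normr_eq0 ne oner_eq0.
rewrite -[y in is_derive y]Ts; apply: is_derive_inverse.
- have := near_in_itvoo sab; apply: filterS => z zab; exact: TK.
- have := near_in_itvoo sab; apply: filterS => z zab.
  by apply: differentiable_continuous; apply/derivable1_diffP; exact: dT.
- by apply: DeriveDef; [exact: dT|rewrite derive1E].
- exact: T'0.
Qed.

Let within_itv (u : R -> R) c c' : 0 <= c -> c' <= 1 ->
  {within `[0, 1], continuous u} -> {within `[c, c'], continuous u}.
Proof.
move=> c0 c1; apply: continuous_subspaceW => z /=; rewrite !in_itv/= => /andP[h1 h2].
by rewrite (le_trans c0 h1) (le_trans h2 c1).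
Qed.

Let ftc c c' : 0 <= c -> c <= c' -> c' <= 1 ->
  (\int[mu]_(y in `[c, c']) (expR (g y))%:E = (e * s c' - e * s c)%:E)%E.
Proof.
move=> c0; rewrite le_eqVlt => /predU1P[<- _|cc' c1].
  by rewrite set_itv1 integral_set1 subrr.
have in01 y : y \in `]c, c'[ -> y \in `]0, 1[.
  by rewrite !in_itv/= => /andP[h1 h2]; rewrite (le_lt_trans c0 h1) (lt_le_trans h2 c1).
have dF (y : R) : y \in `]0, 1[ -> is_derive y 1 (fun y => e * s y) (expR (g y)).
  move=> y01; rewrite (_ : (fun _ => _) = e \*: s); last by apply/funext.
  have := is_deriveZ e (ds y01); move/is_derive_eq; apply.
  by rewrite /GRing.scale/= mulrA ee mul1r.
rewrite EFinB; apply: (continuous_FTC2 cc' (F := fun y => e * s y)).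
- apply: within_continuous_comp; last exact: (within_itv c0 c1 cg).
  by move=> y _; exact: continuous_expR.
- have [_ h1 h2] := (continuous_within_itvP _ cc').1 (within_itv c0 c1 cs).
  split.
  + by move=> y /in01 y01; have [] := dF y y01.
  + by apply: cvgM => //; exact: cvg_cst.
  + by apply: cvgM => //; exact: cvg_cst.
- by move=> y /in01 y01; rewrite derive1E; exact: (@derive_val _ _ _ _ _ _ _ (dF y y01)).
Qed.

Let mono c c' : 0 <= c -> c <= c' -> c' <= 1 -> e * s c <= e * s c'.
Proof.
move=> c0 cc' c1; rewrite -subr_ge0 -lee_fin -(ftc c0 cc' c1).
by apply: integral_ge0 => y _; rewrite lee_fin expR_ge0.
Qed.

Let s_ab y : 0 <= y <= 1 -> a <= s y <= b.
Proof.
move=> y01; have := @within_unit_itv _ s a b cs _ y; rewrite !in_itv/=; apply => //.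
by move=> z /sP[]; rewrite !in_itv/= => /andP[/ltW-> /ltW->].
Qed.

Let Tin x : x \in `]a, b[ -> T x \in `]0, 1[.
Proof. by move=> xab; have : (T @` `]a, b[) (T x) by [exists x]; rewrite ontoT. Qed.

Let s_bounds x : x \in `]a, b[ -> e * s 0 <= e * x <= e * s 1.
Proof.
move=> xab; have := Tin xab; rewrite in_itv/= => /andP[t0 t1].
have h1 := mono (lexx 0) (ltW t0) (ltW t1); have h2 := mono (ltW t0) (ltW t1) (lexx 1).
by rewrite TK// in h1 h2; rewrite h1 h2.
Qed.

Let eq_left z : a <= z <= b -> (forall x, x \in `]a, b[ -> z <= x) -> z = a.
Proof.
move=> /andP[az zb] H; apply/eqP; rewrite eq_le az andbT leNgt; apply/negP => az'.
have : z <= (a + z) / 2 by apply: H; rewrite in_itv/=; apply/andP; split; lra.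
by move: az'; lra.
Qed.

Let eq_right z : a <= z <= b -> (forall x, x \in `]a, b[ -> x <= z) -> z = b.
Proof.
move=> /andP[az zb] H; apply/eqP; rewrite eq_le zb/= leNgt; apply/negP => zb'.
have : (z + b) / 2 <= z by apply: H; rewrite in_itv/=; apply/andP; split; lra.
by move: zb'; lra.
Qed.

(** By monotonicity of [e s] the end values enclose the whole branch interval, and by continuity
    they stay in [[a, b]]. *)
Let s_ends : (e = 1 /\ s 0 = a /\ s 1 = b) \/ (e = -1 /\ s 0 = b /\ s 1 = a).
Proof.
have z0 : a <= s 0 <= b by apply: s_ab; rewrite lexx ler01.
have z1 : a <= s 1 <= b by apply: s_ab; rewrite lexx ler01.
case: e_sign => e1; [left|right]; split=> //; split.
- by apply: eq_left => // x /s_bounds; rewrite e1 !mul1r => /andP[].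
- by apply: eq_right => // x /s_bounds; rewrite e1 !mul1r => /andP[].
- by apply: eq_right => // x /s_bounds; rewrite e1 !mulN1r !lerN2 => /andP[].
- by apply: eq_left => // x /s_bounds; rewrite e1 !mulN1r !lerN2 => /andP[].
Qed.

(* In both orientations [s^-1 ]-oo, x[] is the part of ]0, 1[ on one side of a
   point [c], and the fundamental theorem of calculus gives its weight. *)
Let ray_preimage x : exists c, [/\ 0 <= c <= 1,
  forall y, y \in `]0, 1[ -> (s y < x) = (e * y < e * c) &
  mu (`]a, b[ `&` `]-oo, x[) = (s c - a)%:E].
Proof.
have muE u : a <= u <= b -> (forall z, z \in `]a, b[ -> (z < x) = (z < u)) ->
    mu (`]a, b[ `&` `]-oo, x[) = (u - a)%:E.
  move=> /andP[au ub] H; have -> : `]a, b[ `&` `]-oo, x[ = `]a, u[%classic.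
    apply/seteqP; split => z /=; rewrite !in_itv/=.
      by move=> [zab zx]; rewrite -H ?in_itv// zx andbT; have /andP[] := zab.
    move=> /andP[az zu]; have zab : a < z < b by rewrite az (lt_le_trans zu ub).
    by split=> //; rewrite H ?in_itv.
  rewrite /mu lebesgue_measure_itv/= lte_fin; case: ltP => // ua.
  by rewrite (@le_anti _ _ a u) ?au ?ua// subrr.
have far y : y \in `]0, 1[ -> [/\ 0 < y, y < 1, a < s y & s y < b].
  by move=> y01; have [+ _] := sP y01; move: y01; rewrite !in_itv/= => /andP[? ?] /andP[].
have [xa|ax] := leP x a.
  exists ((1 - e) / 2); case: s_ends => -[-> [s0 s1]].
    rewrite subrr mul0r; split; first by rewrite lexx ler01.
      move=> y /far[y0 y1 asy _]; rewrite !mul1r; transitivity false; first by apply/negP; lra.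
      by apply/esym/negP; lra.
    rewrite s0; apply: muE => [|z]; first by rewrite lexx ltW.
    by rewrite in_itv/= => /andP[az _]; rewrite [RHS]ltNge [LHS]ltNge (le_trans xa) ?ltW.
  rewrite opprK (_ : (1 + 1) / 2 = 1) ?divff//; split; first by rewrite lexx ler01.
    move=> y /far[y0 y1 asy _]; transitivity false; first by apply/negP; lra.
    by apply/esym/negP; lra.
  rewrite s1; apply: muE => [|z]; first by rewrite lexx ltW.
  by rewrite in_itv/= => /andP[az _]; rewrite [RHS]ltNge [LHS]ltNge (le_trans xa) ?ltW.
have [bx|xb] := leP b x.
  exists ((1 + e) / 2); case: s_ends => -[-> [s0 s1]].
    rewrite (_ : (1 + 1) / 2 = 1) ?divff//; split; first by rewrite lexx ler01.
      move=> y /far[y0 y1 _ sb]; transitivity true; lra.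
    rewrite s1; apply: muE => [|z]; first by rewrite lexx ltW.
    by rewrite in_itv/= => /andP[_ zb]; rewrite zb (lt_le_trans zb).
  rewrite subrr mul0r; split; first by rewrite lexx ler01.
    move=> y /far[y0 y1 _ sb]; transitivity true; lra.
  rewrite s0; apply: muE => [|z]; first by rewrite lexx ltW.
  by rewrite in_itv/= => /andP[_ zb]; rewrite zb (lt_le_trans zb).
have xab : x \in `]a, b[ by rewrite in_itv/= ax xb.
exists (T x); split.
- by have := Tin xab; rewrite in_itv/= => /andP[/ltW-> /ltW->].
- move=> y y01; have [sab Ts] := sP y01; rewrite -{2}Ts.
  have [|xs|->] := ltgtP (s y) x.
  + by move=> sx; rewrite monoT.
  + by apply/esym/negP; have := monoT xab sab xs => h1 h2; have := lt_trans h1 h2; rewrite ltxx.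
  + by rewrite ltxx.
- by rewrite TK//; apply: muE => //; rewrite !ltW.
Qed.

(** The weight and the inverse branch are set to zero outside the open unit interval to become Borel
    on the line; [ray_preimage] and [ftc] then verify the hypothesis on rays. *)
Lemma branch_transport (F : R -> \bar R) : measurable_fun [set: R] F ->
  (forall x, (0 <= F x)%E) ->
  (\int[mu]_(x in `]a, b[) F x = \int[mu]_(y in `]0%R, 1%R[) ((expR (g y))%:E * F (s y)))%E.
Proof.
move=> mF F0.
pose U : set R := `]0, 1[%classic.
have mU : measurable U by exact: measurable_itv.
have mrestr (u : R -> R) : {within `[0, 1], continuous u} -> measurable_fun [set: R] (u \_ U).
  move=> cu; apply/(measurable_restrict _ mU measurableT); rewrite setTI.
  apply: (@measurable_funS _ _ (measurableTypeR R) (measurableTypeR R) `[0, 1]%classic).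
  - exact: measurable_itv.
  - exact: subset_itvW.
  - exact: subspace_continuous_measurable_fun.
pose w := (expR \o g) \_ U; pose s' := s \_ U.
have w0 y : 0 <= w y by rewrite /w /patch; case: ifP => // _; exact: expR_ge0.
have wE y : y \in `]0, 1[ -> w y = expR (g y).
  by move=> y01; rewrite /w /patch mem_set.
have s'E y : y \in `]0, 1[ -> s' y = s y.
  by move=> y01; rewrite /s' /patch mem_set.
have wN y : y \notin `]0, 1[ -> w y = 0.
  by move=> y01; rewrite /w /patch memNset//=; exact/negP.
rewrite (integral_transport_rays (w := w) (s := s') w0 _ _ _ _ _ mF F0).
- rewrite [RHS]integral_mkcond; apply: eq_integral => y _; rewrite /patch.
  case: ifPn => [/set_mem y01|/negP y01]; first by rewrite wE// s'E.
  by rewrite wN ?mul0e//; apply/negP => h; apply: y01; exact/mem_set.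
- apply: mrestr; apply: within_continuous_comp; last exact: cg.
  by move=> y _; exact: continuous_expR.
- exact: mrestr.
- exact: measurable_itv.
- by rewrite /= lebesgue_measure_itv/=; case: ifP => // _; rewrite ltry.
move=> x.
have [c [/andP[c0 c1] H E]] := ray_preimage x; apply: etrans E _.
have mexpg (D : set R) : measurable D -> D `<=` `[0%R, 1%R]%classic -> measurable_fun D (fun y => (expR (g y))%:E).
  move=> mD D01; apply/measurable_EFinP; apply: (measurableT_comp (@measurable_expR R)).
  apply: (@measurable_funS _ _ (measurableTypeR R) (measurableTypeR R) `[0, 1]%classic) => //.
  exact: subspace_continuous_measurable_fun.
pose V : set R := `]0, 1[ `&` [set y : R | e * y < e * c].
transitivity (\int[mu]_(y in V) (expR (g y))%:E)%E; last first.
  rewrite [LHS]integral_mkcond [RHS]integral_mkcond; apply: eq_integral => y _; rewrite /patch.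
  have [y01|y01] := boolP (y \in `]0, 1[).
    have -> : (y \in s' @^-1` `]-oo, x[) = (y \in V).
      apply/idP/idP => /set_mem/= h; apply/mem_set => /=.
        by split=> //=; move: h; rewrite s'E// in_itv/= H.
      by move: h; rewrite /V /= s'E// [in X in _ -> X]in_itv/= H// => -[].
    by rewrite wE.
  rewrite wN// memNset; first by case: ifP.
  by move=> -[y01' _]; move: y01; rewrite y01'.
have [[e1 [s0 s1]]|[e1 [s0 s1]]] := s_ends.
  have -> : V = `]0, c[%classic.
    rewrite /V e1; apply/seteqP; split => y /=; rewrite !in_itv/= !mul1r; first by move=> [/andP[-> _] ->].
    by move=> /andP[y0 yc]; rewrite y0 yc (lt_le_trans yc c1).
  rewrite -(integral_itv_bndoo true false) ?ftc// ?e1 ?mul1r ?s0//.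
  by apply: mexpg; [exact: measurable_itv|apply: subset_itv; rewrite bnd_simp].
have -> : V = `]c, 1[%classic.
  rewrite /V e1; apply/seteqP; split => y /=; rewrite !in_itv/= !mulN1r ltrN2; first by move=> [/andP[_ ->] ->].
  by move=> /andP[cy y1]; rewrite y1 cy (le_lt_trans c0 cy).
rewrite -(integral_itv_bndoo true false) ?ftc// ?e1 ?mulN1r ?s1 ?opprK 1?addrC//.
by apply: mexpg; [exact: measurable_itv|apply: subset_itv; rewrite bnd_simp].
Qed.

End Branch.

(** * The operator of a full-branch map *)

Section Metric.
Context {R : realType}.
Variable d : R -> R -> R.
Hypothesis dm : compatible_metric d.
Local Notation X := (fun x : R => x \in `[0%R, 1%R]).

Let X0 : X 0. Proof. by rewrite /= in_itv/= lexx ler01. Qed.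
Let X1 : X 1. Proof. by rewrite /= in_itv/= lexx ler01. Qed.

Lemma unit_metric_ge0 x y : X x -> X y -> 0 <= d x y.
Proof. by move=> Xx Xy; have /andP[] := dist_bounds dm Xx Xy. Qed.

Lemma unit_metric_le1 x y : X x -> X y -> d x y <= 1.
Proof. by move=> Xx Xy; have /andP[] := dist_bounds dm Xx Xy. Qed.

Lemma unit_metric_sym x y : X x -> X y -> d x y = d y x.
Proof. by move=> Xx Xy; exact: (dist_sym dm). Qed.

Lemma metric_gt0 x y : X x -> X y -> x != y -> 0 < d x y.
Proof.
move=> Xx Xy xy; rewrite lt_neqAle unit_metric_ge0// andbT eq_sym.
by apply/eqP => /(dist_eq0 dm Xx Xy)/eqP; rewrite (negbTE xy).
Qed.

Lemma unit_metric_gt0_01 : 0 < d 0 1.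
Proof. by apply: metric_gt0 => //; rewrite eq_sym oner_neq0. Qed.

Lemma lip_seminormP (u : R -> R) (k : R) x y : (lip_seminorm d u <= k%:E)%E ->
  X x -> X y -> `|u x - u y| <= k * d x y.
Proof.
move=> uk Xx Xy; have [->|xy] := eqVneq x y.
  by rewrite subrr normr0 ((dist_eq0 dm Xy Xy).2 erefl) mulr0.
rewrite -ler_pdivrMr ?metric_gt0// -lee_fin (le_trans _ uk)//.
by apply: ereal_sup_ubound; exists x, y.
Qed.

Lemma lip_seminorm_ge0 (u : R -> R) : (0 <= lip_seminorm d u)%E.
Proof.
apply: (@le_trans _ _ (`|u 0 - u 1| / d 0 1)%:E).
  by rewrite lee_fin divr_ge0// ltW// unit_metric_gt0_01.
apply: ereal_sup_ubound; exists 0, 1; split => //.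
by rewrite eq_sym oner_neq0.
Qed.

Lemma lipschitz_le (u : R -> R) x y : is_lipschitz d u -> X x -> X y ->
  `|u x - u y| <= fine (lip_seminorm d u) * d x y.
Proof.
move=> ul; apply: lip_seminormP; rewrite fineK// ge0_fin_numE//.
exact: lip_seminorm_ge0.
Qed.

Lemma lipschitz_dlip (u : R -> R) : is_lipschitz d u -> dlip d u.
Proof. by move=> ul; exists (fine (lip_seminorm d u)) => x y; exact: lipschitz_le. Qed.

(** Compatibility of [d] with the usual topology enters here: the preimage of an open set is
    [d]-open in the unit interval, hence relatively open. *)
Lemma dlip_continuous (u : R -> R) : dlip d u -> {within `[0, 1], continuous u}.
Proof.
move=> [k uk]; apply/continuousP => B oB; apply/open_subspaceP.
set A := `[0, 1] `&` u @^-1` B.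
have A01 : A `<=` `[0, 1] by exact: subIsetl.
have [|U oU AU] := (dist_topology dm A01).1.
  move=> x [/= x01 Bux].
  have [e /= e0 eB] := (nbhs_ballP _ _).1 (open_nbhs_nbhs (conj oB Bux)).
  have k0 : 0 < `|k| + 1 by rewrite ltr_wpDl.
  exists (e / (`|k| + 1)); first by rewrite divr_gt0.
  move=> y y01; rewrite ltr_pdivlMr// => dxy; split => //=; apply: eB.
  rewrite /ball/=; apply: le_lt_trans (uk x y x01 y01) _; apply: le_lt_trans dxy.
  rewrite mulrC ler_wpM2l ?unit_metric_ge0// (le_trans (ler_norm _))// lerDl//.
by exists U => //; apply: etrans (setIC _ _) _; rewrite [RHS]setIC; exact: esym AU.
Qed.

Lemma sup_normP (u : R -> R) x : dlip d u -> X x -> `|u x| <= fine (sup_norm u).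
Proof.
move=> ul Xx; have [M M0 uM] := dlip_bounded unit_metric_ge0 unit_metric_le1 ul.
rewrite -lee_fin fineK; last first.
  rewrite ge0_fin_numE.
    apply: (@le_lt_trans _ _ M%:E); last exact: ltry.
    by apply: ge_ereal_sup => _ [y y01 <-]; rewrite lee_fin uM.
  apply: (@le_trans _ _ `|u x|%:E); first by rewrite lee_fin.
  by apply: ereal_sup_ubound; exists x.
by apply: ereal_sup_ubound; exists x.
Qed.

(** A positive minimum on the compact interval converts a Lipschitz bound into a log-Lipschitz
    one. *)
Lemma pos_dlip_cone (u : R -> R) : dlip d u -> (forall x, X x -> 0 < u x) ->
  exists2 c, 0 < c & cone d c u.
Proof.
move=> ul u0; have [z z01 uz] := EVT_min ler01 (dlip_continuous ul).
have [k uk] := ul; have k0 : 0 < `|k| + 1 by rewrite ltr_wpDl.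
exists (`| `|k| + 1 | / u z); first by rewrite divr_gt0 ?u0// normr_gt0 gt_eqF.
apply: lip_cone => //; [exact: unit_metric_ge0|exact: u0|].
move=> x y Xx Xy; apply: le_trans (uk x y Xx Xy) _; apply: ler_wpM2r.
  exact: unit_metric_ge0.
by rewrite (le_trans (ler_norm _))// lerDl.
Qed.

End Metric.

Lemma esum_pickle (R : realType) (J : countType) (a : J -> \bar R) :
  (forall j, (0 <= a j)%E) ->
  (\esum_(j in [set: J]) a j = \sum_(n <oo) oapp a 0 (@pickle_inv J n))%E.
Proof.
move=> a0; rewrite nneseries_esumT; last by move=> n; case: pickle_inv.
have inj : set_inj [set: J] (@pickle J) by move=> x y _ _; exact: (pcan_inj pickleK).
transitivity (\esum_(n in pickle @` [set: J]) oapp a 0 (@pickle_inv J n))%E.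
  by rewrite esum_image//; apply: eq_esum => j _; rewrite pickleK_inv.
rewrite esum_mkcond; apply: eq_esum => n _; case: ifPn => // /negP nJ.
case E : (@pickle_inv J n) => [j|] //=; case: nJ; apply/mem_set; exists j => //.
by have := @pickle_invK J n; rewrite E.
Qed.

(** * The transfer operator of the given map and its duality *)

Section System.
Context {R : realType} {J : countType}.
Variables (d : R -> R -> R) (T : R -> R) (a b : J -> R) (sigma_ gs : J -> R -> R).
Variables (gamma G : R) (h0 : R -> R).
Hypothesis dm : compatible_metric d.
Hypothesis fb : full_branch_map T a b sigma_ gs.
Hypothesis ea : expanding_assumptions d sigma_ gs gamma G.
Hypothesis gd : gibbs_density d sigma_ gs h0.
Local Notation X := (fun x : R => x \in `[0%R, 1%R]).
Let mu := @lebesgue_measure R.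

(** Codes naming no branch get weight [0], the constant inverse branch [0] and an empty domain: they
    contribute nothing and still satisfy the distortion and contraction bounds. *)
Definition weight (n : nat) (x : R) : R := oapp (fun j => expR (gs j x)) 0 (@pickle_inv J n).
Definition inv_branch (n : nat) (x : R) : R := oapp (fun j => sigma_ j x) 0 (@pickle_inv J n).
Definition branch_dom (n : nat) : set R :=
  oapp (fun j => `]a j, b j[%classic) set0 (@pickle_inv J n).

Let L := ruelle weight inv_branch.
Let d_ge0 := unit_metric_ge0 dm.
Let d_le1 := unit_metric_le1 dm.
Let d_sym := unit_metric_sym dm.
Let d_gt0 := unit_metric_gt0_01 dm.

Let X0 : X 0. Proof. by rewrite /= in_itv/= lexx ler01. Qed.

Lemma weight_ge0 n x : 0 <= weight n x.
Proof. by rewrite /weight; case: pickle_inv => //= j; exact: expR_ge0. Qed.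

Lemma weight_lip n x y : X x -> X y -> weight n x <= expR (G * d x y) * weight n y.
Proof.
move=> Xx Xy; rewrite /weight; case: pickle_inv => [j|] /=; last by rewrite mulr0.
rewrite -expRD ler_expR -lerBlDr; apply: le_trans (ler_norm _) _.
apply: (lip_seminormP dm) => //; apply: le_trans (potential_lipschitz ea).
by apply: ereal_sup_ubound; exists j.
Qed.

Lemma branch_sub j : `]a j, b j[ `<=` `[0%R, 1%R]%classic.
Proof.
have [S _ ->] := branch_cover fb => x xj; right; by exists j.
Qed.

Lemma inv_branch_oo j y : y \in `]0, 1[ -> (sigma_ j y \in `]a j, b j[) /\ (T (sigma_ j y) = y).
Proof.
move=> y01; have : (T @` `]a j, b j[) y by rewrite (branch_onto fb).
by move=> [x /= xab <-]; rewrite (inverse_branch fb).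
Qed.

Lemma inv_branch_in n x : X x -> X (inv_branch n x).
Proof.
move=> Xx; rewrite /inv_branch; case: pickle_inv => [j|] //=.
apply: (within_unit_itv (@inverse_branch_continuous _ _ _ _ _ _ _ fb j)) => // z z01.
by have [+ _] := inv_branch_oo j z01; exact: branch_sub.
Qed.

Let gamma_gt0 : 0 < gamma. Proof. exact: lt_trans (gamma_gt1 ea). Qed.

Lemma inv_branch_lip n x y : X x -> X y ->
  d (inv_branch n x) (inv_branch n y) <= gamma^-1 * d x y.
Proof.
move=> Xx Xy; rewrite /inv_branch; case: pickle_inv => [j|] /=.
  exact: (branch_contraction ea).
rewrite ((dist_eq0 dm X0 X0).2 erefl); apply: mulr_ge0; first by rewrite invr_ge0 ltW.
exact: d_ge0.
Qed.

Let K := fine (ereal_sup [set (\esum_(j in [set: J]) (expR (gs j x))%:E)%E | x in `[0%R, 1%R]]).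

Lemma weight_sum x N : X x -> \sum_(0 <= n < N) weight n x <= K.
Proof.
move=> Xx; rewrite -lee_fin /K.
have le1 : (\sum_(0 <= n < N) (weight n x)%:E <= \esum_(j in [set: J]) (expR (gs j x))%:E)%E.
  rewrite esum_pickle; last by move=> j; rewrite lee_fin expR_ge0.
  have -> : (\sum_(n <oo) oapp (fun j => (expR (gs j x))%:E) 0 (@pickle_inv J n) =
      \sum_(n <oo) (weight n x)%:E)%E.
    by apply: eq_eseriesr => n _; rewrite /weight; case: pickle_inv.
  by apply: nneseries_lim_ge => n _ _; rewrite lee_fin weight_ge0.
have le2 : (\esum_(j in [set: J]) (expR (gs j x))%:E <=
    ereal_sup [set (\esum_(j in [set: J]) (expR (gs j x))%:E)%E | x in `[0%R, 1%R]])%E.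
  by apply: ereal_sup_ubound; exists x.
rewrite fineK; first by rewrite -sumEFin; exact: le_trans le1 le2.
rewrite ge0_fin_numE; first exact: (potential_summable ea).
by apply: le_trans le2; apply: esum_ge0 => j _; rewrite lee_fin expR_ge0.
Qed.

Let r_ge0 : 0 <= gamma^-1. Proof. by rewrite invr_ge0 ltW. Qed.
Let r_lt1 : gamma^-1 < 1. Proof. by rewrite invf_lt1// (gamma_gt1 ea). Qed.

Lemma density_dlip : dlip d h0. Proof. exact: lipschitz_dlip (density_lipschitz gd). Qed.

Lemma density_pos x : X x -> 0 < h0 x. Proof. exact: (density_gt0 gd). Qed.

Lemma ruelle_density x : X x -> L h0 x = h0 x.
Proof.
move=> Xx; have := density_fixed gd Xx; rewrite /transfer.
set t := fun j : J => _.
have t0 j : (0 <= t j)%E.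
  rewrite lee_fin mulr_ge0 ?expR_ge0// ltW// density_pos//.
  by have := inv_branch_in (pickle j) Xx; rewrite /inv_branch pickleK_inv.
have -> : (\esum_(j in [set: J]) t^\- j = 0)%E.
  by apply: esum1 => j _; rewrite funenegE; apply/max_idPr; rewrite leeNl oppe0 t0.
rewrite sube0; have -> : (\esum_(j in [set: J]) t^\+ j = \esum_(j in [set: J]) t j)%E.
  by apply: eq_esum => j _; rewrite funeposE; apply/max_idPl.
rewrite esum_pickle// => E; apply/EFin_inj; rewrite -E.
rewrite -(ruelle_nneseries d_ge0 d_le1 weight_ge0 inv_branch_in weight_sum density_dlip _ Xx); last first.
  by move=> y Xy; rewrite ltW// density_pos.
apply: eq_eseriesr => n _; rewrite /weight /inv_branch /t.
by case: pickle_inv => //=; rewrite mul0r.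
Qed.

(** Positivity and compactness give some aperture; invariance under [L] improves it to the explicit
    one. *)
Lemma density_cone : cone d (G / (1 - gamma^-1)) h0.
Proof.
have [c c0 ch] := pos_dlip_cone dm density_dlip density_pos.
have := ruelle_fixed_cone d_ge0 d_le1 d_sym d_gt0 (G_gt0 ea) r_ge0 weight_ge0 weight_lip
  inv_branch_in inv_branch_lip weight_sum c0 r_lt1 ch ruelle_density.
exact.
Qed.

Lemma branch_domP n x : branch_dom n x -> exists2 j, pickle j = n & x \in `]a j, b j[.
Proof.
rewrite /branch_dom; case e : (@pickle_inv J n) => [j|] //= xj; exists j => //.
by have := @pickle_invK J n; rewrite e.
Qed.

Lemma measurable_branch_dom n : measurable (branch_dom n).
Proof. by rewrite /branch_dom; case: pickle_inv => //= j; exact: measurable_itv. Qed.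

Lemma trivIset_branch_dom : trivIset [set: nat] branch_dom.
Proof.
move=> n m _ _ [x [/branch_domP[j <- xj] /branch_domP[k <- xk]]].
by congr pickle; apply: (branch_disjoint fb) => //; exists x.
Qed.

Definition full_dom : set R := \bigcup_n branch_dom n.

Lemma full_domP x : full_dom x -> exists j, x \in `]a j, b j[.
Proof. by move=> [n _ /branch_domP[j _ xj]]; exists j. Qed.

Lemma full_dom_branch j x : x \in `]a j, b j[ -> full_dom x.
Proof. by move=> xj; exists (pickle j) => //; rewrite /branch_dom pickleK_inv. Qed.

Lemma full_dom_sub : full_dom `<=` `[0%R, 1%R]%classic.
Proof. by move=> x /full_domP[j]; exact: branch_sub. Qed.

Lemma measurable_full_dom : measurable full_dom.
Proof. by apply: bigcupT_measurable => n; exact: measurable_branch_dom. Qed.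

Definition exceptional : set R := `[0%R, 1%R]%classic `\` full_dom.

Lemma measurable_exceptional : measurable exceptional.
Proof. by apply: measurableD; [exact: measurable_itv|exact: measurable_full_dom]. Qed.

Lemma exceptional_null : mu exceptional = 0%E.
Proof.
apply: measure_negligible; first exact: measurable_exceptional.
have [S SN cover] := branch_cover fb.
have ES : exceptional `<=` S.
  move=> x [x01 xD]; have : (S `|` \bigcup_j `]a j, b j[%classic) x by rewrite -cover.
  by move=> [//|[j _ xj]]; case: xD; exact: (full_dom_branch xj).
case: SN => [cS|]; last exact: negligibleS.
apply/negligibleP; first exact: measurable_exceptional.
exact/countable_lebesgue_measure0/(sub_countable _ cS)/subset_card_le.
Qed.

(* [T] is arbitrary on the exceptional set; this version is Borel. *)
Definition borel_map : R -> R := T \_ full_dom.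
Local Notation Tt := borel_map.

Lemma measurable_borel_map : measurable_fun [set: R] Tt.
Proof.
have mD := measurable_full_dom.
apply/(measurable_restrict _ mD measurableT); rewrite setTI.
apply/(measurable_fun_bigcup _ measurable_branch_dom) => n.
rewrite /branch_dom; case: pickle_inv => [j|] /=; last exact: measurable_fun_set0.
apply: open_continuous_measurable_fun; first exact: interval_open.
move=> x /set_mem xj; apply: differentiable_continuous; apply/derivable1_diffP.
exact: (@branch_derivable _ _ _ _ _ _ _ fb j x xj).
Qed.

Lemma borel_map_branch j y : y \in `]0, 1[ -> Tt (sigma_ j y) = y.
Proof.
move=> y01; have [sab Ts] := inv_branch_oo j y01.
by rewrite /borel_map patchT// mem_set//; exact: full_dom_branch sab.
Qed.

Lemma borel_map_in x : X x -> X (Tt x).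
Proof.
move=> Xx; rewrite /borel_map /patch; case: ifPn => _; first exact: (map_unit fb).
exact: X0.
Qed.

Lemma branch_dom_transport n (F : R -> \bar R) : measurable_fun [set: R] F ->
  (forall x, (0 <= F x)%E) ->
  (\int[mu]_(x in branch_dom n) F x =
   \int[mu]_(y in `]0%R, 1%R[) ((weight n y)%:E * F (inv_branch n y)))%E.
Proof.
move=> mF F0; rewrite /branch_dom /weight /inv_branch; case: pickle_inv => [j|] /=; last first.
  by rewrite integral_set0 integral0_eq// => y _; rewrite mul0e.
have [e e1 mono] : exists2 e : R, e = 1 \/ e = -1 &
    {in `]a j, b j[ &, forall x y, x < y -> e * T x < e * T y}.
  have [inc|dec] := branch_monotone fb j.
    by exists 1; [left|move=> x y xj yj xy; rewrite !mul1r; exact: inc].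
  by exists (-1); [right|move=> x y xj yj xy; rewrite !mulN1r ltrN2; exact: dec].
exact: (branch_transport e1 (@branch_derivable _ _ _ _ _ _ _ fb j) (@branch_derive_neq0 _ _ _ _ _ _ _ fb j) mono
  (branch_onto fb j) (@inverse_branch _ _ _ _ _ _ _ fb j) (@inverse_branch_continuous _ _ _ _ _ _ _ fb j)
  (@potential_branch _ _ _ _ _ _ _ fb j) (@potential_branch_continuous _ _ _ _ _ _ _ fb j)).
Qed.

Let within_measurable (u : R -> R) : {within `[0, 1], continuous u} ->
  measurable_fun (`[0%R, 1%R]%classic : set R) u.
Proof. by move=> cu; exact: subspace_continuous_measurable_fun. Qed.

Lemma dlip_measurable (u : R -> R) : dlip d u -> measurable_fun (`[0%R, 1%R]%classic : set R) u.
Proof. by move=> ul; apply: within_measurable; exact: (dlip_continuous dm). Qed.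

Lemma measurable_weight n : measurable_fun (`[0%R, 1%R]%classic : set R) (weight n).
Proof.
rewrite /weight; case: pickle_inv => [j|] //=; apply: (measurableT_comp (@measurable_expR R)).
by apply: within_measurable; exact: (potential_branch_continuous fb).
Qed.

Lemma dlip_inv_branch n u : dlip d u -> dlip d (fun y => u (inv_branch n y)).
Proof.
move=> [k uk]; exists (`|k| * gamma^-1) => x y Xx Xy.
apply: le_trans (uk _ _ (inv_branch_in n Xx) (inv_branch_in n Xy)) _.
apply: (@le_trans _ _ (`|k| * d (inv_branch n x) (inv_branch n y))).
  by apply: ler_wpM2r; [exact: d_ge0 (inv_branch_in n Xx) (inv_branch_in n Xy)|exact: ler_norm].
by rewrite -mulrA ler_wpM2l// inv_branch_lip.
Qed.

(** Change of variables on each branch domain, where the map undoes the inverse branch; monotone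
    convergence sums the transported terms to [L u * v]. The complement of the branch domains is
    null. *)
Lemma ge0_transfer_duality (u v : R -> R) : dlip d u -> (forall x, X x -> 0 <= u x) ->
  measurable_fun [set: R] v -> (forall x, 0 <= v x) ->
  (\int[mu]_(x in `[0%R, 1%R]) (u x * v (Tt x))%:E =
   \int[mu]_(x in `[0%R, 1%R]) (L u x * v x)%:E)%E.
Proof.
move=> ul u0 mv v0; pose U : set R := `[0%R, 1%R]%classic.
have mU : measurable U by exact: measurable_itv.
pose F := (fun x => (u x * v (Tt x))%:E) \_ U.
have FE x : U x -> F x = (u x * v (Tt x))%:E by move=> Ux; rewrite /F patchT// mem_set.
have mF : measurable_fun [set: R] F.
  apply/(measurable_restrict _ mU measurableT); rewrite setTI.
  apply/measurable_EFinP; apply: measurable_funM; first exact: dlip_measurable.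
  by apply: measurable_funTS; apply: measurableT_comp => //; exact: measurable_borel_map.
have F0 x : (0 <= F x)%E.
  by rewrite /F /patch; case: ifPn => // /set_mem Ux; rewrite lee_fin mulr_ge0// u0.
transitivity (\int[mu]_(x in full_dom) F x)%E.
  rewrite (_ : full_dom = U `\` exceptional); last first.
    rewrite /exceptional setDD setIidr//; exact: full_dom_sub.
  rewrite -ge0_negligible_integral//; last 3 first.
  - exact: measurable_exceptional.
  - exact: measurable_funTS.
  - exact: exceptional_null.
  by apply: eq_integral => x /set_mem Ux; rewrite FE.
rewrite ge0_integral_bigcup//; last 3 first.
- exact: measurable_branch_dom.
- exact: measurable_funTS.
- exact: trivIset_branch_dom.
pose W : set R := `]0%R, 1%R[%classic.
have WU : W `<=` U by exact: subset_itvW.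
transitivity (\sum_(n <oo) \int[mu]_(y in W) (weight n y * u (inv_branch n y) * v y)%:E)%E.
  apply: eq_eseriesr => n _; rewrite branch_dom_transport//.
  apply: eq_integral => y /set_mem Wy; rewrite FE; last exact: (inv_branch_in n (WU _ Wy)).
  rewrite -EFinM mulrA /weight /inv_branch; case: pickle_inv => [j|] /=; last by rewrite !mul0r.
  by rewrite borel_map_branch.
rewrite -integral_nneseries; first last.
- by move=> n y /WU Uy; rewrite lee_fin !mulr_ge0 ?weight_ge0// u0//; exact: inv_branch_in.
- move=> n; apply: (@measurable_funS _ _ (measurableTypeR R) _ U) => //.
  apply/measurable_EFinP; apply: measurable_funM; last exact: measurable_funTS.
  by apply: measurable_funM; [exact: measurable_weight|apply: dlip_measurable; exact: dlip_inv_branch].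
- exact: measurable_itv.
rewrite [RHS]integral_itv_bndoo; last first.
  apply: (@measurable_funS _ _ (measurableTypeR R) _ U) => //.
  apply/measurable_EFinP; apply: measurable_funM; last exact: measurable_funTS.
  apply: dlip_measurable; exact: (ruelle_dlip d_ge0 d_le1 d_sym d_gt0 (G_gt0 ea) r_ge0 weight_ge0
    weight_lip inv_branch_in inv_branch_lip weight_sum).
apply: eq_integral => y /set_mem Wy.
have Xy : X y by exact: (WU _ Wy).
rewrite [RHS]EFinM -(ruelle_nneseries d_ge0 d_le1 weight_ge0 inv_branch_in weight_sum ul u0 Xy).
rewrite [RHS]muleC -nneseriesZl; last first.
  by move=> n _; rewrite lee_fin mulr_ge0 ?weight_ge0// u0//; exact: inv_branch_in.
by apply: eq_eseriesr => n _; rewrite -EFinM mulrC.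
Qed.

End System.

(** * Characteristic function of the Birkhoff sums *)

Section NonMeasurable.
Context dd (T : measurableType dd) {R : realType}.
Variable mu : {measure set T -> \bar R}.
Import HBNNSimple.

(* [F] need not be measurable: its integral is a supremum over simple functions. *)
Lemma integral_null_eq (N : set T) (F G : T -> \bar R) : measurable N -> mu N = 0%E ->
  (forall x, (0 <= F x)%E) -> (forall x, (0 <= G x)%E) -> measurable_fun [set: T] G ->
  (forall x, ~ N x -> F x = G x) -> (\int[mu]_x F x = \int[mu]_x G x)%E.
Proof.
move=> mN N0 F0 G0 mG FG.
have off (H : T -> \bar R) : measurable_fun [set: T] H -> (forall x, (0 <= H x)%E) ->
    (\int[mu]_x H x = \int[mu]_x ((H \_ (~` N)) x))%E.
  move=> mH H0; rewrite (ge0_negligible_integral mN)// [RHS]integral_mkcond.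
  rewrite setTD [LHS]integral_mkcond; apply: eq_integral => x _.
  by rewrite /patch; case: ifP => //; rewrite in_setT.
apply/eqP; rewrite eq_le; apply/andP; split.
  (* A simple function below [F] can exceed [G] only on [N]; cutting it off there preserves its
     integral. *)
  rewrite ge0_integralTE//; apply: ge_ereal_sup => _ [h hF <-].
  rewrite -integralT_nnsfun.
  have mh : measurable_fun [set: T] (fun x => (h x)%:E).
    by apply/measurable_EFinP; exact: measurable_funP.
  rewrite off//; last by move=> x; rewrite lee_fin.
  apply: ge0_le_integral => //.
  - by move=> x _; rewrite /patch; case: ifP => // _; rewrite lee_fin.
  - by apply/(measurable_restrict _ (measurableC mN) measurableT); exact: measurable_funTS.
  - move=> x _; rewrite /patch; case: ifPn => [/set_mem xN|_]; last exact: G0.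
    by rewrite -FG.
rewrite off// [X in (_ <= X)%E]ge0_integralTE//.
have mGN : measurable_fun [set: T] (G \_ (~` N)).
  by apply/(measurable_restrict _ (measurableC mN) measurableT); exact: measurable_funTS.
have GN0 x : (0 <= (G \_ (~` N)) x)%E by rewrite /patch; case: ifP.
rewrite ge0_integralTE//; apply: ge_ereal_sup => _ [h hG <-].
apply: ereal_sup_ubound; exists h => // x; apply: le_trans (hG x) _.
by rewrite /patch; case: ifPn => [/set_mem xN|_]; [rewrite FG|exact: F0].
Qed.

End NonMeasurable.

Section UnitIntegral.
Context {R : realType}.
Let mu := @lebesgue_measure R.
Local Notation X := (fun x : R => x \in `[0%R, 1%R]).
Local Notation U := (`[0%R, 1%R]%classic : set R).

Definition uint (u : R -> R) : R := \int[mu]_(x in `[0%R, 1%R]) u x.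

Definition bmeas (u : R -> R) :=
  measurable_fun U u /\ exists M, forall x, X x -> `|u x| <= M.

Let mU : measurable U. Proof. exact: measurable_itv. Qed.

Lemma bmeas_integrable u : bmeas u -> mu.-integrable `[0%R, 1%R] (EFin \o u).
Proof.
move=> [mu_ [M uM]].
have h : (mu U < +oo)%E.
  by rewrite /mu lebesgue_measure_itv /= lte_fin ltr01 ltry.
apply: measurable_bounded_integrable => //.
exists M; split; first exact: num_real.
by move=> M' MM' x Xx /=; rewrite (le_trans (uM x Xx))// ltW.
Qed.

Lemma bmeas_cst (c : R) : bmeas (fun=> c).
Proof. by split; [exact: measurable_cst|exists `|c|]. Qed.

Lemma bmeasM u v : bmeas u -> bmeas v -> bmeas (fun x => u x * v x).
Proof.
move=> [m1 [M uM]] [m2 [N vN]]; split; first exact: measurable_funM.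
by exists (M * N) => x Xx; rewrite normrM ler_pM// ?uM ?vN.
Qed.

Lemma bmeasD u v : bmeas u -> bmeas v -> bmeas (fun x => u x + v x).
Proof.
move=> [m1 [M uM]] [m2 [N vN]]; split; first exact: measurable_funD.
by exists (M + N) => x Xx; rewrite (le_trans (ler_normD _ _))// lerD// ?uM ?vN.
Qed.

Lemma bmeasZ (k : R) u : bmeas u -> bmeas (fun x => k * u x).
Proof. by apply: bmeasM; exact: bmeas_cst. Qed.

Lemma uint_lin (k l : R) u v : bmeas u -> bmeas v ->
  uint (fun x => k * u x + l * v x) = k * uint u + l * uint v.
Proof.
move=> bu bv; rewrite /uint RintegralD//.
- by rewrite !RintegralZl//; exact: bmeas_integrable.
- by apply: bmeas_integrable; exact: bmeasZ.
- by apply: bmeas_integrable; exact: bmeasZ.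
Qed.

Lemma uintD u v : bmeas u -> bmeas v -> uint (fun x => u x + v x) = uint u + uint v.
Proof.
move=> bu bv; rewrite -[uint u]mul1r -[uint v]mul1r -uint_lin//.
by apply: eq_Rintegral => x _; rewrite !mul1r.
Qed.

Lemma uintZ (k : R) u : bmeas u -> uint (fun x => k * u x) = k * uint u.
Proof.
move=> bu; rewrite -[RHS]addr0 -(mul0r (uint u)) -uint_lin//.
by apply: eq_Rintegral => x _; rewrite mul0r addr0.
Qed.

Lemma uint_le u v : bmeas u -> bmeas v -> (forall x, X x -> u x <= v x) -> uint u <= uint v.
Proof. by move=> bu bv uv; apply: le_Rintegral => //; exact: bmeas_integrable. Qed.

Lemma eq_uint u v : (forall x, X x -> u x = v x) -> uint u = uint v.
Proof. by move=> uv; apply: eq_Rintegral => x /set_mem; exact: uv. Qed.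

Lemma uint0 u : (forall x, X x -> u x = 0) -> uint u = 0.
Proof.
move=> u0; rewrite -[RHS](mul0r (uint (fun=> 0))) -uintZ; last exact: bmeas_cst.
by apply: eq_uint => x Xx; rewrite u0// mulr0.
Qed.

Lemma uint_fin u : bmeas u -> (\int[mu]_(x in `[0%R, 1%R]) (u x)%:E = (uint u)%:E)%E.
Proof.
move=> bu; rewrite /uint /Rintegral fineK//; apply: integrable_fin_num => //.
exact: bmeas_integrable.
Qed.

End UnitIntegral.

(** * Duality for signed functions, characteristic function and variance *)

Section Duality.
Context {R : realType}.
Variable d : R -> R -> R.
Local Notation X := (fun x : R => x \in `[0%R, 1%R]).
Hypothesis d_ge0 : forall x y, X x -> X y -> 0 <= d x y.
Hypothesis d_le1 : forall x y, X x -> X y -> d x y <= 1.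
Hypothesis dlip_meas : forall u : R -> R, dlip d u -> measurable_fun (`[0%R, 1%R]%classic : set R) u.
Variables (L : (R -> R) -> R -> R) (Tt : R -> R).
Hypothesis L_lin : forall (k l : R) u v x, dlip d u -> dlip d v -> X x ->
  L (fun x => k * u x + l * v x) x = k * L u x + l * L v x.
Hypothesis L_dlip : forall u, dlip d u -> dlip d (L u).
Hypothesis mT : measurable_fun [set: R] Tt.
Hypothesis T_in : forall x, X x -> X (Tt x).
Let mu := @lebesgue_measure R.
Hypothesis duality0 : forall u v : R -> R, dlip d u -> (forall x, X x -> 0 <= u x) ->
  measurable_fun [set: R] v -> (forall x, 0 <= v x) ->
  (\int[mu]_(x in `[0%R, 1%R]) (u x * v (Tt x))%:E =
   \int[mu]_(x in `[0%R, 1%R]) (L u x * v x)%:E)%E.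

Lemma dlip_bmeas u : dlip d u -> bmeas u.
Proof.
move=> ul; split; first exact: dlip_meas.
by have [M _ uM] := dlip_bounded d_ge0 d_le1 ul; exists M.
Qed.

Definition gmeas (v : R -> R) := measurable_fun [set: R] v /\ exists M, forall x, `|v x| <= M.

Lemma gmeas_bmeas v : gmeas v -> bmeas v.
Proof. by move=> [mv [M vM]]; split; [exact: measurable_funTS|exists M => x _]. Qed.

Lemma gmeas_comp v : gmeas v -> gmeas (v \o Tt).
Proof. by move=> [mv [M vM]]; split; [exact: measurableT_comp|exists M => x; exact: vM]. Qed.

Lemma gmeasD u v : gmeas u -> gmeas v -> gmeas (fun x => u x + v x).
Proof.
move=> [m1 [M uM]] [m2 [N vN]]; split; first exact: measurable_funD.
by exists (M + N) => x; rewrite (le_trans (ler_normD _ _))// lerD// ?uM ?vN.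
Qed.

Lemma gmeasM u v : gmeas u -> gmeas v -> gmeas (fun x => u x * v x).
Proof.
move=> [m1 [M uM]] [m2 [N vN]]; split; first exact: measurable_funM.
by exists (M * N) => x; rewrite normrM ler_pM// ?uM ?vN.
Qed.

Lemma gmeas_cst (c : R) : gmeas (fun=> c).
Proof. by split; [exact: measurable_cst|exists `|c|]. Qed.

(** Both functions are bounded, so adding constants makes them nonnegative and linearity removes the
    constants. *)
Lemma transfer_duality u v : dlip d u -> gmeas v ->
  uint (fun x => u x * v (Tt x)) = uint (fun x => L u x * v x).
Proof.
have step1 w : dlip d w -> (forall x, X x -> 0 <= w x) -> gmeas v ->
    uint (fun x => w x * v (Tt x)) = uint (fun x => L w x * v x).
  move=> wl w0 gv; have [mv [M vM]] := gv.
  have pos (z : R -> R) : gmeas z -> (forall x, 0 <= z x) ->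
      uint (fun x => w x * z (Tt x)) = uint (fun x => L w x * z x).
    by move=> [mz _] z0; rewrite /uint /Rintegral duality0.
  have gz : gmeas (fun x => v x + M) by apply: gmeasD => //; exact: gmeas_cst.
  have z0 x : 0 <= v x + M by have := vM x; rewrite ler_norml => /andP[]; lra.
  have M0 : 0 <= M := le_trans (normr_ge0 _) (vM 0).
  have e1 := pos _ gz z0; have e2 := pos _ (gmeas_cst M) (fun=> M0).
  have bw := dlip_bmeas wl; have bL := dlip_bmeas (L_dlip wl).
  transitivity (1 * uint (fun x => w x * (v (Tt x) + M)) + (-1) * uint (fun x => w x * M)).
    rewrite -uint_lin.
    - by apply: eq_uint => x _; ring.
    - by apply: bmeasM => //; apply: gmeas_bmeas; exact: (gmeas_comp gz).
    - by apply: bmeasM => //; exact: bmeas_cst.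
  rewrite e1 e2 -uint_lin.
  - by apply: eq_uint => x _; ring.
  - by apply: bmeasM => //; exact: gmeas_bmeas.
  - by apply: bmeasM => //; exact: bmeas_cst.
move=> ul gv; have [M M0 uM] := dlip_bounded d_ge0 d_le1 ul.
have cl := dlip_cst d M; have ul' := dlip_lin 1 1 ul cl.
have bvT := gmeas_bmeas (gmeas_comp gv); have bv := gmeas_bmeas gv.
have e1 := step1 _ ul' _ gv; have e2 := step1 _ cl (fun x _ => M0) gv.
transitivity (1 * uint (fun x => (1 * u x + 1 * M) * v (Tt x)) + (-1) * uint (fun x => M * v (Tt x))).
  rewrite -uint_lin.
  - by apply: eq_uint => x _; ring.
  - by apply: bmeasM => //; exact: dlip_bmeas.
  - by apply: bmeasM => //; exact: dlip_bmeas.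
rewrite e1 ?e2 -?uint_lin.
- by apply: eq_uint => x Xx; rewrite L_lin//; ring.
- by apply: bmeasM => //; apply/dlip_bmeas/L_dlip.
- by apply: bmeasM => //; apply/dlip_bmeas/L_dlip.
- by move=> x Xx; have := uM x Xx; rewrite ler_norml => /andP[]; lra.
Qed.

(** Duality with [u = 1] writes the measure of the preimage as the integral of [L 1] over [A]. *)
Lemma null_preimage (A : set R) : measurable A -> mu A = 0%E ->
  mu (`[0%R, 1%R] `&` Tt @^-1` A) = 0%E.
Proof.
move=> mA A0.
have mTA : measurable (Tt @^-1` A) by rewrite -[X in measurable X]setTI; exact: mT.
have mU : measurable (`[0%R, 1%R]%classic : set R) by exact: measurable_itv.
have l1 := dlip_cst d (1 : R).
have gA : gmeas \1_A.
  by split; [exact: measurable_indic|exists 1 => x; rewrite ger0_norm ?indic_le1].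
have iA0 x : 0 <= \1_A x :> R by [].
have := duality0 l1 (fun x _ => ler01) gA.1 iA0.
have -> : (\int[mu]_(x in `[0%R, 1%R]) (1 * \1_A (Tt x))%:E =
    mu (`[0%R, 1%R] `&` Tt @^-1` A))%E.
  under eq_integral do rewrite mul1r.
  transitivity (\int[mu]_(x in `[0%R, 1%R]) (\1_(Tt @^-1` A) x)%:E)%E; first by [].
  by rewrite integral_indic// setIC.
move=> ->; have bi := bmeas_integrable (bmeasM (dlip_bmeas (L_dlip l1)) (gmeas_bmeas gA)).
rewrite (negligible_integral (mu := mu) mA (measurable_itv _) bi A0) integral0_eq// => x [_ xA].
by rewrite /= indicE memNset// mulr0.
Qed.

(* The observable is cut off outside the unit interval to be globally
   measurable; orbits starting in the unit interval never leave it. *)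
Variable f : R -> R.
Hypothesis fl : dlip d f.
Let fU := f \_ (`[0%R, 1%R]%classic : set R).
Definition cut_sum (n : nat) (x : R) : R := birkhoff_sum Tt fU n x.

Let fUE x : X x -> fU x = f x.
Proof. by move=> Xx; rewrite /fU patchT// mem_set. Qed.

Let iter_in n x : X x -> X (iter n Tt x).
Proof. by move=> Xx; elim: n => //= n IH; exact: T_in. Qed.

Lemma cut_sumE n x : X x -> cut_sum n x = birkhoff_sum Tt f n x.
Proof. by move=> Xx; apply: eq_bigr => k _; rewrite fUE//; exact: iter_in. Qed.

Lemma cut_sum0 x : cut_sum 0 x = 0.
Proof. by rewrite /cut_sum /birkhoff_sum big_geq. Qed.

Lemma cut_sumS n x : cut_sum n.+1 x = fU x + cut_sum n (Tt x).
Proof.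
rewrite /cut_sum /birkhoff_sum big_nat_recl//=; congr (_ + _).
by apply: eq_bigr => k _; rewrite -iterSr.
Qed.

Lemma gmeas_cut : gmeas fU.
Proof.
have [M M0 fM] := dlip_bounded d_ge0 d_le1 fl.
have mU : measurable (`[0%R, 1%R]%classic : set R) by exact: measurable_itv.
split.
  by apply/(measurable_restrict _ mU measurableT); rewrite setTI; exact: dlip_meas.
exists M => x; rewrite /fU /patch; case: ifPn => [/set_mem /fM//|_].
by rewrite normr0.
Qed.

Lemma gmeas_cut_sum n : gmeas (cut_sum n).
Proof.
elim: n => [|n IH].
  rewrite (_ : cut_sum 0 = fun=> 0); first exact: gmeas_cst.
  by apply/funext => x; exact: cut_sum0.
rewrite (_ : cut_sum n.+1 = fun x => fU x + (cut_sum n \o Tt) x); last first.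
  by apply/funext => x; exact: cut_sumS.
by apply: gmeasD; [exact: gmeas_cut|exact: gmeas_comp].
Qed.

Hypothesis L_ext : forall u v x, (forall x, X x -> u x = v x) -> X x -> L u x = L v x.
Variable h : R -> R.
Hypothesis hl : dlip d h.
Hypothesis L_h : forall x, X x -> L h x = h x.
Hypothesis d_sym : forall x y, X x -> X y -> d x y = d y x.

Lemma gmeas_cos t n : gmeas (fun x => cos (t * cut_sum n x)).
Proof.
have [mS _] := gmeas_cut_sum n; split; last by exists 1 => x; rewrite ler_norml cos_geN1 cos_le1.
by apply: (measurableT_comp (@measurable_cos R)); exact: measurable_funM.
Qed.

Lemma gmeas_sin t n : gmeas (fun x => sin (t * cut_sum n x)).
Proof.
have [mS _] := gmeas_cut_sum n; split; last by exists 1 => x; rewrite ler_norml sin_geN1 sin_le1.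
by apply: (measurableT_comp (@measurable_sin R)); exact: measurable_funM.
Qed.

Lemma twist_cdlip t u : cdlip d u -> cdlip d (twist L f t u).
Proof.
move=> ul; have cl : cdlip d (fun x => cis (t * f x) * u x).
  apply: cdlipM => //; have [k fk] := fl; apply: (@cdlip_cabs _ _ d_sym _ (`|t| * k)) => x y Xx Xy.
  by rewrite (le_trans (cabs_cisB _ _))// -mulrBr normrM -mulrA ler_wpM2l// fk.
by split; apply: L_dlip; have [] := cl.
Qed.

(** From [cut_sumS]: the factor [exp(i t f)] goes into the twisted operator and duality strips [Tt]
    from the rest. Duality being real, it is applied to cosine and sine separately. *)
Lemma iter_twist_char t n u : cdlip d u ->
  cI uint (iter n (twist L f t) u) = cI uint (fun x => u x * cis (t * cut_sum n x)).
Proof.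
elim: n u => [|n IH] u ul.
  rewrite /= /cI; congr (_ +i* _)%C; apply: eq_uint => x _;
    by rewrite cut_sum0 mulr0 cis0 mulr1.
rewrite iterSr IH; last exact: twist_cdlip.
pose w x := cis (t * f x) * u x.
have wl : cdlip d w.
  apply: cdlipM => //; have [k fk] := fl; apply: (@cdlip_cabs _ _ d_sym _ (`|t| * k)) => x y Xx Xy.
  by rewrite (le_trans (cabs_cisB _ _))// -mulrBr normrM -mulrA ler_wpM2l// fk.
have [wr wi] := wl.
have gc := gmeas_cos t n; have gs := gmeas_sin t n.
have dr v : gmeas v -> uint (fun x => complex.Re (w x) * v (Tt x)) =
    uint (fun x => L (fun x => complex.Re (w x)) x * v x) by move=> gv; exact: transfer_duality.
have di v : gmeas v -> uint (fun x => complex.Im (w x) * v (Tt x)) =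
    uint (fun x => L (fun x => complex.Im (w x)) x * v x) by move=> gv; exact: transfer_duality.
have bL v z : dlip d z -> gmeas v -> bmeas (fun x => L z x * v x).
  by move=> zl gv; apply: bmeasM; [exact/dlip_bmeas/L_dlip|exact: gmeas_bmeas].
have bT v z : dlip d z -> gmeas v -> bmeas (fun x => z x * v (Tt x)).
  by move=> zl gv; apply: bmeasM; [exact: dlip_bmeas|exact: gmeas_bmeas (gmeas_comp gv)].
have cS x : X x -> u x * cis (t * cut_sum n.+1 x) = w x * cis (t * cut_sum n (Tt x)).
  by move=> Xx; rewrite cut_sumS fUE// mulrDr cisD /w mulrCA mulrA.
rewrite /cI; congr (_ +i* _)%C.
- transitivity (uint (fun x => 1 * (complex.Re (w x) * cos (t * cut_sum n (Tt x))) +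
      (-1) * (complex.Im (w x) * sin (t * cut_sum n (Tt x))))); last first.
    by apply: eq_uint => x Xx; rewrite cS// [RHS]complexReM mul1r mulN1r.
  rewrite uint_lin; [|exact: (bT (fun x => cos (t * cut_sum n x)))|exact: (bT (fun x => sin (t * cut_sum n x)))].
  rewrite (dr _ gc) (di _ gs) -uint_lin; [|exact: bL|exact: bL].
  by apply: eq_uint => x Xx; rewrite complexReM /=; ring.
- transitivity (uint (fun x => 1 * (complex.Re (w x) * sin (t * cut_sum n (Tt x))) +
      1 * (complex.Im (w x) * cos (t * cut_sum n (Tt x))))); last first.
    by apply: eq_uint => x Xx; rewrite cS// [RHS]complexImM !mul1r.
  rewrite uint_lin; [|exact: (bT (fun x => sin (t * cut_sum n x)))|exact: (bT (fun x => cos (t * cut_sum n x)))].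
  rewrite (dr _ gs) (di _ gc) -uint_lin; [|exact: bL|exact: bL].
  by apply: eq_uint => x Xx; rewrite complexImM /=; ring.
Qed.

Lemma uint_cut_sum n u : dlip d u ->
  uint (fun x => u x * cut_sum n x) = \sum_(0 <= k < n) uint (fun x => f x * iter k L u x).
Proof.
elim: n u => [|n IH] u ul.
  by rewrite big_geq//; apply: uint0 => x _; rewrite cut_sum0 mulr0.
have gS := gmeas_cut_sum n.
transitivity (uint (fun x => f x * u x) + uint (fun x => u x * cut_sum n (Tt x))).
  rewrite -uintD.
  - by apply: eq_uint => x Xx; rewrite cut_sumS fUE//; ring.
  - by apply: bmeasM; exact: dlip_bmeas.
  - by apply: bmeasM; [exact: dlip_bmeas|exact: gmeas_bmeas (gmeas_comp gS)].
rewrite transfer_duality// IH; last exact: L_dlip.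
rewrite big_nat_recl//=; congr (_ + _); apply: eq_bigr => k _.
by rewrite -iterSr.
Qed.

Lemma iter_L_dlip k u : dlip d u -> dlip d (iter k L u).
Proof. by move=> ul; elim: k => //= k IH; exact: L_dlip. Qed.

Lemma corr_sum_iter n x : X x ->
  corr_sum h L f n x = \sum_(0 <= k < n) iter k L (L (fun x => f x * h x)) x.
Proof.
have fhl := dlipM d_ge0 d_le1 fl hl; have Lfh := L_dlip fhl.
have suml m : dlip d (fun x => \sum_(0 <= k < m) iter k L (L (fun x => f x * h x)) x).
  elim: m => [|m IH].
    by apply: eq_dlip (dlip_cst d 0) => z _; rewrite big_geq.
  apply: eq_dlip (dlip_lin 1 1 IH (iter_L_dlip m Lfh)) => z _.
  by rewrite big_nat_recr//= !mul1r.
have Lsum m z : X z -> L (fun x => \sum_(0 <= k < m) iter k L (L (fun x => f x * h x)) x) z =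
    \sum_(0 <= k < m) iter k.+1 L (L (fun x => f x * h x)) z.
  elim: m z => [|m IH] z Xz.
    rewrite big_geq//; have e0 : L (fun=> 0 * 0 + 0 * 0) z = 0.
      by rewrite (L_lin 0 0 (dlip_cst d 0) (dlip_cst d 0) Xz) !mul0r addr0.
    by rewrite -[RHS]e0; apply: L_ext => // y _; rewrite big_geq// mul0r addr0.
  rewrite big_nat_recr//= -IH// -[X in X + _]mul1r -[X in _ + X]mul1r -L_lin//.
    by apply: L_ext => // y _; rewrite big_nat_recr//= !mul1r.
  exact: iter_L_dlip.
elim: n x => [|n IH] x Xx; first by rewrite big_geq.
rewrite big_nat_recl// -Lsum//= addrC -[X in X + _]mul1r -[X in _ + X]mul1r -L_lin//.
by apply: L_ext => // y Xy; rewrite IH// !mul1r.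
Qed.

(** In the square of [f + S_n o T], the last square reproduces the previous variance since [h] is
    fixed, and the cross term is the correlation sum up to lag [n]. So the variance of the sum over
    [n] is a Cesaro mean of [partial_var], which ties the latter to [sigma]. *)
Lemma uint_cut_sum_sqr n :
  uint (fun x => cut_sum n x ^+ 2 * h x) = \sum_(0 <= k < n) partial_var h L uint f k.
Proof.
elim: n => [|n IH].
  by rewrite big_geq//; apply: uint0 => x _; rewrite cut_sum0 expr0n/= mul0r.
have gS := gmeas_cut_sum n; have fhl := dlipM d_ge0 d_le1 fl hl.
have gS2 : gmeas (fun x => cut_sum n x ^+ 2) by exact: gmeasM.
have bf := dlip_bmeas fl; have bh := dlip_bmeas hl.
have bS := gmeas_bmeas (gmeas_comp gS); have bS2 := gmeas_bmeas (gmeas_comp gS2).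
transitivity (uint (fun x => f x ^+ 2 * h x) +
    (2 * uint (fun x => (f x * h x) * cut_sum n (Tt x)) + uint (fun x => h x * cut_sum n (Tt x) ^+ 2))).
  rewrite -uintZ; last by apply: bmeasM => //; exact: bmeasM.
  rewrite -!uintD.
  - by apply: eq_uint => x Xx; rewrite cut_sumS fUE//; ring.
  - by do 2 apply: bmeasM => //.
  - by apply: bmeasD; [apply: bmeasZ; apply: bmeasM => //; exact: bmeasM|exact: bmeasM].
  - by apply: bmeasZ; apply: bmeasM => //; exact: bmeasM.
  - exact: bmeasM.
rewrite (transfer_duality fhl gS) (transfer_duality hl gS2).
have -> : uint (fun x => L h x * cut_sum n x ^+ 2) = uint (fun x => cut_sum n x ^+ 2 * h x).
  by apply: eq_uint => x Xx; rewrite L_h// mulrC.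
rewrite IH big_nat_recr//= addrA addrC; congr (_ + _); rewrite /partial_var; congr (_ + 2 * _).
rewrite uint_cut_sum; last exact: L_dlip.
transitivity (uint (fun x => \sum_(0 <= k < n) f x * iter k L (L (fun x => f x * h x)) x)); last first.
  by apply: eq_uint => x Xx; rewrite corr_sum_iter// mulr_sumr.
elim: n {IH gS gS2 bS bS2} => [|n IH].
  by rewrite big_geq//; apply/esym/uint0 => x _; rewrite big_geq.
have bk k : bmeas (fun x => f x * iter k L (L (fun x => f x * h x)) x).
  by apply: bmeasM => //; apply/dlip_bmeas/iter_L_dlip/L_dlip.
rewrite big_nat_recr//= IH -uintD//.
  by apply: eq_uint => x _; rewrite big_nat_recr.
elim: n {IH} => [|n IH].
  have := bmeas_cst (0 : R); congr bmeas; apply/funext => x; rewrite big_geq//.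
have := bmeasD IH (bk n); congr bmeas; apply/funext => x; by rewrite big_nat_recr.
Qed.

End Duality.

(** * The Berry-Esseen constant *)

Section CharacteristicFunction.
Context {R : realType}.
Let mu := @lebesgue_measure R.

(** [- 4 exp(- (s T)^2 / 8)] is a primitive; the bound is uniform in the cut-off [T]. *)
Lemma gauss_tail_integral (T : R) :
  mu.-integrable `]0%R, 1%R] (EFin \o (fun s : R => T * (s * T) * expR (- ((s * T) ^+ 2) / 8))) /\
  \int[mu]_(s in `]0%R, 1%R]) (T * (s * T) * expR (- ((s * T) ^+ 2) / 8)) <= 4.
Proof.
pose q (s : R) := T * (s * T) * expR (- ((s * T) ^+ 2) / 8).
pose E (s : R) := - (s * T) ^+ 2 / 8.
have dE (s : R) : is_derive s 1 E (- (s * T ^+ 2 / 4)).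
  rewrite (_ : E = (- (T ^+ 2 / 8)) \*: (id ^+ 2)); last first.
    by apply/funext => z; transitivity (- (T ^+ 2 / 8) * z ^+ 2) => //; rewrite /E; field.
  by apply: is_derive_eq; rewrite /GRing.scale/=; field.
have dF (s : R) : is_derive s 1 (fun s => - (4 * expR (E s))) (q s).
  have d1 := @is_derive1_comp R expR E s _ _ (is_derive_expR _) (dE s).
  have d2 : is_derive s 1 (- (4 \*: (expR \o E))) (- (4 *: (expR (E s) * - (s * T ^+ 2 / 4)))).
    by apply: is_deriveN; exact: is_deriveZ.
  by apply: is_derive_eq d2 _; rewrite /GRing.scale/= /q /E; field.
have cE : continuous E.
  by move=> z; apply: differentiable_continuous; apply/derivable1_diffP; have [] := dE z.
have cq : continuous q.
  move=> z; apply: cvgM.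
    by apply: cvgM; [exact: cvg_cst|apply: cvgM; [exact: cvg_id|exact: cvg_cst]].
  by apply: (cvg_comp _ expR (cE z)); exact: continuous_expR.
have mU : measurable (`]0%R, 1%R]%classic : set R) by exact: measurable_itv.
have iq : mu.-integrable `[0%R, 1%R] (EFin \o q).
  by apply: continuous_compact_integrable; [exact: segment_compact|exact: continuous_subspaceT].
split.
  apply: (integrableS (mu := mu) (measurable_itv _) (measurable_itv _) _ iq).
  by move=> z /=; rewrite !in_itv/= => /andP[/ltW-> ->].
rewrite /Rintegral (@integral_itv_obnd_cbnd R 0 (BRight 1) (EFin \o q)); last first.
  by apply/measurable_EFinP; apply: measurable_funTS; exact: continuous_measurable_fun.
have -> := @integral_is_derive R q (fun s => - (4 * expR (E s))) 0 1 ler01 dF cq.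
have E0 : E 0 = 0 by rewrite /E mul0r expr0n/= oppr0 mul0r.
by have := expR_ge0 (E 1); rewrite /= E0 expR0; lra.
Qed.

Lemma expR_mul_bound (y : R) : y * expR (- (y ^+ 2) / 8) <= 3 / 2.
Proof.
rewrite mulNr expRN -ler_pdivlMr ?invr_gt0 ?expR_gt0// invrK.
have := expR_ge1Dx (y ^+ 2 / 8); have := sqr_ge0 (y - 8 / 3).
by rewrite sqrrB; lra.
Qed.

(* The frequency cut-off is [T / (sigma sqrt n)] with [40 k T = sigma^3 sqrt n]. *)
Lemma berry_esseen_of_char (h S : R -> R) (sigma k c : R) (n : nat) :
  pdensity h -> measurable_fun [set: R] S ->
  mu.-integrable [set: R] (EFin \o (fun w => S w * h w)) ->
  0 < sigma -> 0 < k -> 0 <= c -> (0 < n)%N ->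
  (forall t, 0 <= t -> 40 * k * t <= sigma ^+ 2 ->
    cabs ((wmean h (fun w => cos (t * S w)) +i* wmean h (fun w => sin (t * S w)))%C -
          (expR (- (n%:R * (sigma ^+ 2 * t ^+ 2 / 2))))%:C%C) <=
    11 / 10 * expR (- (n%:R * (sigma ^+ 2 * t ^+ 2 / 4))) *
      (n%:R * (11 * k * t ^+ 3) + c * t ^+ 2)) ->
  forall x, `|wcdf h (fun w => S w / (sigma * Num.sqrt n%:R)) x - std_normal_cdf x| <=
    9 / 8 * (22 / 5 * (33 / 2 * (k / (sigma ^+ 3 * Num.sqrt n%:R)) + c / (sigma ^+ 2 * n%:R)) +
             480 * (k / (sigma ^+ 3 * Num.sqrt n%:R))).
Proof.
move=> hp mS iS s0 k0 c0 n0 H x.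
have nn : 0 < n%:R :> R by rewrite ltr0n.
set r := Num.sqrt n%:R; have r0 : 0 < r by rewrite sqrtr_gt0.
have r2 : n%:R = r ^+ 2 by rewrite sqr_sqrtr// ltW.
have sN : sigma != 0 by rewrite gt_eqF.
have rN : r != 0 by rewrite gt_eqF.
have kN : k != 0 by rewrite gt_eqF.
pose N := sigma * r; have N0 : 0 < N by exact: mulr_gt0.
pose T := sigma ^+ 2 / (40 * k) * N.
have T0 : 0 < T by rewrite mulr_gt0// divr_gt0 ?exprn_gt0// mulr_gt0.
pose c1 := k / (sigma ^+ 3 * r); pose c2 := c / (sigma ^+ 2 * n%:R).
have c10 : 0 <= c1 by rewrite ltW// divr_gt0// mulr_gt0// exprn_gt0.
have c20 : 0 <= c2 by rewrite divr_ge0// ltW// mulr_gt0// exprn_gt0.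
pose W1 w := T * (S w / N).
have mW1 : measurable_fun [set: R] W1 by apply: measurable_funM => //; exact: measurable_funM.
(* [33/2] is [11] times the bound [3/2] of [expR_mul_bound]. *)
pose K := 11 / 10 * (33 / 2 * c1 + c2).
have K0 : 0 <= K by rewrite /K; lra.
pose q (s : R) := K * (T * (s * T) * expR (- ((s * T) ^+ 2) / 8)).
have [iq0 iq4] := gauss_tail_integral T.
have iq : mu.-integrable `]0%R, 1%R] (EFin \o q).
  by apply: (integrable_scale (mu := mu)) => //; exact: measurable_itv.
have -> : wcdf h (fun w => S w / N) x = wcdf h W1 (T * x).
  by apply: eq_Rintegral => w _; rewrite /W1 ler_pM2l.
rewrite -(wcdf_gauss x T0).
have -> : 9 / 8 * (22 / 5 * (33 / 2 * c1 + c2) + 480 * c1) =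
    9 / 8 * (K * 4 + 24 * (1 / (2 * T))).
  (* The normal law scaled by [T] has Lipschitz constant [1 / (2 T)]; times the [24] of [esseen] it
     gives [480 c1]. *)
  have -> : 1 / (2 * T) = 20 * c1 by rewrite /T /N /c1; field; rewrite sN rN kN.
  by rewrite /K; field.
have mT : 0 < 1 / (2 * T) by rewrite divr_gt0// mulr_gt0.
have mid : measurable_fun [set: R] (fun w : R => T * w) by exact: measurable_funM.
have iW1 : mu.-integrable [set: R] (EFin \o (fun w => W1 w * h w)).
  have := integrable_scale (T / N) measurableT iS; congr (integrable _ _ _).
  by apply/funext => w; rewrite /W1 /=; congr _%:E; ring.
have iW2 : mu.-integrable [set: R] (EFin \o (fun w => T * w * gauss_pdf w)).
  have := integrable_scale T measurableT (@integrable_id_gauss R); congr (integrable _ _ _).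
  by apply/funext => w; rewrite /= mulrA.
have lip y y' : y <= y' -> wcdf gauss_pdf (fun w => T * w) y' - wcdf gauss_pdf (fun w => T * w) y
    <= 1 / (2 * T) * (y' - y).
  move=> yy'; have e z : wcdf gauss_pdf (fun w => T * w) z = std_normal_cdf (z / T).
    by rewrite -(wcdf_gauss _ T0) mulrC divfK// gt_eqF.
  rewrite !e (le_trans (std_normal_cdf_lip _))//; first by rewrite ler_pM2r ?invr_gt0.
  by apply: le_of_eq; field; rewrite gt_eqF.
have main (s z : R) : (`]0%R, 1%R]%classic : set R) s ->
    `|wmean h (fun w => sin (s * (z - W1 w))) - wmean gauss_pdf (fun w => sin (s * (z - T * w)))|
    <= s * q s.
  rewrite /= in_itv/= => /andP[s0' s1].
  pose t := s * (sigma ^+ 2 / (40 * k)); pose y := s * T.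
  have t0 : 0 <= t by rewrite mulr_ge0 ?ltW// divr_gt0 ?exprn_gt0// mulr_gt0.
  have tk : 40 * k * t <= sigma ^+ 2.
    rewrite (_ : 40 * k * t = s * sigma ^+ 2); last by rewrite /t; field.
    by rewrite ler_piMl// sqr_ge0.
  have yt : y = t * N by rewrite /y /T /t; ring.
  have y0 : 0 <= y by rewrite mulr_ge0// ltW.
  have {H} := H t t0 tk.
  set C := wmean h (fun w => cos (t * S w)); set Sg := wmean h (fun w => sin (t * S w)).
  have icos : mu.-integrable [set: R] (EFin \o (fun w => cos (t * S w) * h w)).
    apply: (wmean_integrable (M := 1)) => //; last by move=> w; rewrite ler_norml cos_geN1 cos_le1.
    by apply: (measurableT_comp (@measurable_cos R)); exact: measurable_funM.
  have isin : mu.-integrable [set: R] (EFin \o (fun w => sin (t * S w) * h w)).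
    apply: (wmean_integrable (M := 1)) => //; last by move=> w; rewrite ler_norml sin_geN1 sin_le1.
    by apply: (measurableT_comp (@measurable_sin R)); exact: measurable_funM.
  have e1 : wmean h (fun w => sin (s * (z - W1 w))) = sin (s * z) * C - cos (s * z) * Sg.
    rewrite /C /Sg /wmean -!RintegralZl// -RintegralB//; last 2 first.
    - exact: (integrable_scale _ measurableT).
    - exact: (integrable_scale _ measurableT).
    apply: eq_Rintegral => w _; rewrite (_ : s * (z - W1 w) = s * z - t * S w); last first.
      by rewrite /W1 /t /T; field; rewrite kN /N mulf_neq0.
    by rewrite sinB; ring.
  have e2 : wmean gauss_pdf (fun w => sin (s * (z - T * w))) = sin (s * z) * expR (- (y ^+ 2) / 2).
    rewrite -(sqrrN y) -wmean_gauss_sin; apply: eq_Rintegral => w _.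
    by congr (sin _ * _); rewrite /y; ring.
  have ny (p : R) : n%:R * (sigma ^+ 2 * t ^+ 2 / p) = y ^+ 2 / p.
    by rewrite r2 yt /N; ring.
  rewrite !ny -!(mulNr (y ^+ 2)) => H.
  apply: (@le_trans _ _ (cabs ((C +i* Sg)%C - (expR (- y ^+ 2 / 2))%:C%C))).
    (* This unimodular factor makes the real part of [rot * Z] equal to the difference of the two
       sine means. *)
    rewrite e1 e2; pose rot : R[i] := (sin (s * z) +i* cos (s * z))%C.
    have r1 : cabs rot = 1 by rewrite /cabs /= addrC cos2Dsin2 sqrtr1.
    set Z := (_ - _ : R[i]).
    have Re1 : complex.Re (rot * Z) =
        sin (s * z) * C - cos (s * z) * Sg - sin (s * z) * expR (- y ^+ 2 / 2).
      by rewrite complexReM /Z /=; ring.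
    have h1 := Re_le_cabs (rot * Z); have h2 := Re_le_cabs (- (rot * Z)).
    move: h1 h2; rewrite cabsN complexReN Re1 cabsM r1 mul1r => h1 h2.
    by rewrite ler_norml lerNl; apply/andP; split.
  apply: (le_trans H).
  have -> : n%:R * (11 * k * t ^+ 3) + c * t ^+ 2 = y ^+ 2 * (11 * c1 * y + c2).
    by rewrite r2 yt /c1 /c2 r2 /N; field; rewrite sN rN.
  set e8 := expR (- y ^+ 2 / 8).
  have e80 : 0 <= e8 := expR_ge0 _.
  (* Half of the Gaussian factor absorbs the extra power of [y]; the other half stays under the
     integral. *)
  have e84 : expR (- y ^+ 2 / 4) = e8 * e8 by rewrite -expRD; congr expR; field.
  have e81 : e8 <= 1 by rewrite -expR0 ler_expR mulNr oppr_le0 divr_ge0// sqr_ge0.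
  have h3 : y * e8 <= 3 / 2 := expR_mul_bound y.
  have h4 : e8 * (11 * c1 * y + c2) <= 33 / 2 * c1 + c2.
    have h5 := ler_wpM2l c10 h3; have h6 := ler_wpM2l c20 e81; lra.
  rewrite e84 /q -/y -/e8 (_ : s * (K * (T * y * e8)) =
    (11 / 10 * (y ^+ 2 * e8)) * (33 / 2 * c1 + c2)); last by rewrite /K /y; ring.
  rewrite (_ : 11 / 10 * (e8 * e8) * (y ^+ 2 * (11 * c1 * y + c2)) =
    (11 / 10 * (y ^+ 2 * e8)) * (e8 * (11 * c1 * y + c2))); last by ring.
  by apply: ler_wpM2l => //; apply: mulr_ge0 => //; apply: mulr_ge0 => //; exact: sqr_ge0.
have pg := @pdensity_gauss R.
apply: le_trans (esseen mT hp pg mW1 mid iW1 iW2 lip iq main (T * x)) _.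
rewrite ler_wpM2l// lerD2r /q (RintegralZl (mu := mu) K (measurable_itv _) iq0).
by rewrite ler_wpM2l.
Qed.

End CharacteristicFunction.

(** * The apertures and the comparison with [cosh] *)

Section Constants.
Context {R : realType}.
Variables (gamma G : R).
Hypotheses (gamma1 : 1 < gamma) (G0 : 0 < G).

(** The fixed point of [c -> G + c / gamma]. The other apertures satisfy [b = a + 1],
    [a = G + b / gamma] and [a1 = G + a / gamma], as [ruelle_cone] dictates. *)
Definition cone_a0 := gamma * G / (gamma - 1).
Definition cone_a1 := (gamma ^+ 2 * G + 1) / (gamma * (gamma - 1)).
Definition cone_a := (1 + gamma * G) / (gamma - 1).
Definition cone_b := gamma * (1 + G) / (gamma - 1).
Definition cone_Q := expR cone_a1 * ((cone_a + cone_a1) / (cone_a - cone_a1)).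

Let g0 : gamma != 0. Proof. by rewrite gt_eqF// (lt_trans _ gamma1). Qed.
Let g1 : gamma - 1 != 0. Proof. by rewrite gt_eqF// subr_gt0. Qed.
Let g1' : 0 < gamma - 1. Proof. by rewrite subr_gt0. Qed.
Let g0' : 0 < gamma. Proof. exact: lt_trans gamma1. Qed.

Let ratioE : (cone_a + cone_a1) / (cone_a - cone_a1) = (2 * gamma ^+ 2 * G + gamma + 1) / (gamma - 1).
Proof.
have e : cone_a - cone_a1 = gamma^-1 by rewrite /cone_a /cone_a1; field; rewrite g0 g1.
by rewrite e invrK /cone_a /cone_a1; field; rewrite g0 g1.
Qed.

Let ratio_gt0 : 0 < (2 * gamma ^+ 2 * G + gamma + 1) / (gamma - 1).
Proof.
rewrite divr_gt0// -addrA addr_gt0//; first by rewrite mulr_gt0// mulr_gt0// exprn_gt0.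
by rewrite addr_gt0.
Qed.

Lemma cone_Q_gt0 : 0 < cone_Q.
Proof. by rewrite mulr_gt0 ?expR_gt0// ratioE. Qed.

Lemma cosh_sqr_D_R : cosh (D_R gamma G / 4) ^+ 2 = (cone_Q + 1) ^+ 2 / (4 * cone_Q).
Proof.
have -> : D_R gamma G / 4 = ln cone_Q / 2.
  rewrite /cone_Q lnM ?posrE ?expR_gt0// ?ratioE// expRK /D_R /cone_a1; field.
  by rewrite g0 g1.
set z := ln cone_Q / 2.
have e : expR z ^+ 2 = cone_Q.
  by rewrite -expRM_natl -[RHS]lnK ?posrE ?cone_Q_gt0//; congr expR; rewrite /z; field.
rewrite -e /cosh expRN; field; exact/lt0r_neq0/expR_gt0.
Qed.

(** [exp a1 >= 1 + G] because [a1 >= G], and the ratio is at least [1 + 8 G] because [2 gamma^2 - 8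
    (gamma - 1) = 2 (gamma - 2)^2]. A power of [Q] can thus pay for the distortion constant. *)
Lemma distortion_le_Q : (1 + 2 * G) ^+ 2 <= cone_Q.
Proof.
have h1 : 1 + G <= expR cone_a1.
  apply: (le_trans _ (expR_ge1Dx _)); rewrite lerD2l /cone_a1 ler_pdivlMr ?mulr_gt0//.
  by have := mulr_gt0 g0' G0; nra.
have h2 : 1 + 8 * G <= (2 * gamma ^+ 2 * G + gamma + 1) / (gamma - 1).
  rewrite ler_pdivlMr//; have := mulr_ge0 (ltW G0) (sqr_ge0 (gamma - 2)).
  by rewrite sqrrB; nra.
rewrite /cone_Q ratioE; apply: (@le_trans _ _ ((1 + G) * (1 + 8 * G))).
  rewrite -subr_ge0 (_ : _ - _ = 4 * G ^+ 2 + 5 * G); last by ring.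
  by rewrite addr_ge0// mulr_ge0// ?sqr_ge0// ltW.
have G0' := G0; apply: ler_pM => //; lra.
Qed.

(** As [1 - eta = 2 / (Q + 1)], the claim is [B^2 Q^3 <= (Q + 1)^4]. For [B = 2] this is one term of
    the binomial expansion; for [B = 1 + 2 G] it follows from [B^2 <= Q]. *)
Lemma contraction_cosh (B : R) : B = 2 \/ B = 1 + 2 * G ->
  (B / (1 - (cone_Q - 1) / (cone_Q + 1))) ^+ 2 <= 16 * cosh (D_R gamma G / 4) ^+ 6.
Proof.
move=> BE; have Q0 := cone_Q_gt0; have hQ := distortion_le_Q.
have -> : cosh (D_R gamma G / 4) ^+ 6 = (cosh (D_R gamma G / 4) ^+ 2) ^+ 3 by rewrite -exprM.
rewrite cosh_sqr_D_R; move: cone_Q Q0 hQ => Q Q0 hQ.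
have Q1 : Q + 1 != 0 by rewrite gt_eqF// addr_gt0.
have -> : 1 - (Q - 1) / (Q + 1) = 2 / (Q + 1) by field.
rewrite invf_div mulrA.
rewrite (_ : (B * (Q + 1) / 2) ^+ 2 = B ^+ 2 * (Q + 1) ^+ 2 / 4); last by field.
rewrite (_ : 16 * _ = (Q + 1) ^+ 6 / (4 * Q ^+ 3)); last by field; exact: lt0r_neq0.
rewrite ler_pdivlMr ?mulr_gt0 ?exprn_gt0//.
rewrite (_ : B ^+ 2 * (Q + 1) ^+ 2 / 4 * (4 * Q ^+ 3) = (Q + 1) ^+ 2 * (B ^+ 2 * Q ^+ 3)); last by field.
rewrite (_ : (Q + 1) ^+ 6 = (Q + 1) ^+ 2 * (Q + 1) ^+ 4); last by ring.
apply: ler_wpM2l; first exact: sqr_ge0.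
have Q20 : 0 <= Q ^+ 2 := sqr_ge0 _; have Q30 : 0 <= Q ^+ 3 by rewrite exprn_ge0// ltW.
have Q40 : 0 <= Q ^+ 4 by rewrite exprn_ge0// ltW.
have ex : (Q + 1) ^+ 4 = Q ^+ 4 + 4 * Q ^+ 3 + 6 * Q ^+ 2 + 4 * Q + 1 by ring.
rewrite ex; case: BE => ->; first by rewrite (_ : 2 ^+ 2 = 4) ?expr2//; lra.
apply: (@le_trans _ _ (Q * Q ^+ 3)); first exact: ler_wpM2r.
by rewrite -exprS; lra.
Qed.

End Constants.

(** Once [s <= F' r], the left side is at most [9/8 (77 + 480)] times [c A'^2], and [A'^2 <= 16 ch]
    turns this into [10026 c ch]. The smallness hypothesis is what yields [s <= F' r]. *)
Lemma berry_esseen_arith (R : realType) (ch s r F' nf' A' : R) :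
  0 < nf' -> nf' <= F' -> 0 < A' -> 0 < s -> 0 < r -> s ^+ 2 <= 9 / 2 * nf' * F' * A' ->
  A' ^+ 2 <= 16 * ch -> 11460 * (ch * nf' * F' ^+ 2 / (s ^+ 3 * r)) < 1 ->
  9 / 8 * (22 / 5 * (33 / 2 * (nf' * F' ^+ 2 * A' ^+ 2 / (s ^+ 3 * r)) +
                     nf' * F' * A' ^+ 2 / (s ^+ 2 * r ^+ 2)) +
           480 * (nf' * F' ^+ 2 * A' ^+ 2 / (s ^+ 3 * r))) <=
  11460 * (ch * nf' * F' ^+ 2 / (s ^+ 3 * r)).
Proof.
move=> n0 nF A0' s0 r0 sA Ach small.
have F0 : 0 < F' := lt_le_trans n0 nF.
have s3r : 0 < s ^+ 3 * r by rewrite mulr_gt0// exprn_gt0.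
pose c := nf' * F' ^+ 2 / (s ^+ 3 * r).
have c0 : 0 < c by rewrite divr_gt0// mulr_gt0// exprn_gt0.
have e1 : nf' * F' ^+ 2 * A' ^+ 2 / (s ^+ 3 * r) = c * A' ^+ 2 by rewrite /c; ring.
have e2 : nf' * F' * A' ^+ 2 / (s ^+ 2 * r ^+ 2) = c * A' ^+ 2 * (s / (F' * r)).
  by rewrite /c; field; rewrite !gt_eqF.
have e3 : ch * nf' * F' ^+ 2 / (s ^+ 3 * r) = c * ch by rewrite /c; ring.
rewrite e1 e2 e3 in small *.
have q1 : s / (F' * r) <= 1.
  rewrite ler_pdivrMr ?mul1r ?mulr_gt0//.
  have chc : 11460 * (ch * (nf' * F' ^+ 2)) < s ^+ 3 * r.
    move: small; rewrite /c (_ : 11460 * _ = 11460 * (ch * (nf' * F' ^+ 2)) / (s ^+ 3 * r)); last by ring.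
    by rewrite ltr_pdivrMr// mul1r.
  (* The variance bound squared, to be combined with [chc] so that [ch] cancels. *)
  have s4 : s ^+ 4 <= 324 * ch * (nf' ^+ 2 * F' ^+ 2).
    apply: (@le_trans _ _ (81 / 4 * (nf' ^+ 2 * F' ^+ 2) * A' ^+ 2)).
      rewrite (_ : _ * A' ^+ 2 = (9 / 2 * nf' * F' * A') ^+ 2); last by field.
      by rewrite (exprM s 2 2) ler_sqr// nnegrE ?sqr_ge0//; exact: le_trans (sqr_ge0 s) sA.
    rewrite (_ : 324 * ch * _ = 81 / 4 * (nf' ^+ 2 * F' ^+ 2) * (16 * ch)); last by field.
    by rewrite ler_wpM2l// !mulr_ge0 ?ltW.
  have h : 11460 * s ^+ 4 <= 324 * (s ^+ 3 * (r * nf')).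
    apply: (@le_trans _ _ (11460 * (324 * ch * (nf' ^+ 2 * F' ^+ 2)))); first by rewrite ler_wpM2l ?ler0n.
    rewrite (_ : 11460 * _ = 324 * nf' * (11460 * (ch * (nf' * F' ^+ 2)))); last by ring.
    rewrite (_ : 324 * (s ^+ 3 * _) = 324 * nf' * (s ^+ 3 * r)); last by ring.
    by rewrite ler_wpM2l ?mulr_ge0 ?ler0n//; exact: ltW.
  have h2 : 11460 * s <= 324 * (r * nf').
    rewrite -(ler_pM2l (exprn_gt0 3 s0)).
    by move: h; rewrite exprSr; clear; lra.
  have rn : r * nf' <= r * F' by rewrite ler_pM2l.
  by move: h2 rn (mulr_gt0 r0 n0); clear; lra.
have cA : c * A' ^+ 2 <= 16 * (c * ch).
  by rewrite [leRHS]mulrCA ler_pM2l.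
have cq : c * A' ^+ 2 * (s / (F' * r)) <= c * A' ^+ 2.
  by rewrite ler_piMr// mulr_ge0// ?ltW// exprn_gt0.
move: cA cq (mulr_gt0 c0 (exprn_gt0 2 A0')); clear; lra.
Qed.

(** * Back to the original map and the Gibbs measure *)

Section GibbsLaw.
Context {R : realType} {J : countType}.
Variables (d : R -> R -> R) (T : R -> R) (a b : J -> R) (sigma_ gs : J -> R -> R).
Variables (gamma G : R) (h0 f : R -> R).
Hypothesis dm : compatible_metric d.
Hypothesis fb : full_branch_map T a b sigma_ gs.
Hypothesis ea : expanding_assumptions d sigma_ gs gamma G.
Hypothesis gd : gibbs_density d sigma_ gs h0.
Hypothesis fl : is_lipschitz d f.
Local Notation X := (fun x : R => x \in `[0%R, 1%R]).
Local Notation U := (`[0%R, 1%R]%classic : set R).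
Let mu := @lebesgue_measure R.

Local Notation L := (ruelle (weight gs) (inv_branch sigma_)).
Local Notation Tt := (borel_map T a b).
Local Notation S := (cut_sum Tt f).

Let d_ge0 := unit_metric_ge0 dm.
Let d_le1 := unit_metric_le1 dm.
Let d_sym := unit_metric_sym dm.
Let d_gt0 := unit_metric_gt0_01 dm.
Let gamma1 : 1 < gamma := gamma_gt1 ea.
Let gamma_gt0 : 0 < gamma := lt_trans ltr01 gamma1.
Let G0 : 0 < G := G_gt0 ea.
Let r_ge0 : 0 <= gamma^-1. Proof. by rewrite invr_ge0 ltW. Qed.
Let fdl : dlip d f := lipschitz_dlip dm fl.
Let hdl : dlip d h0 := density_dlip dm gd.
Let mU : measurable U. Proof. exact: measurable_itv. Qed.
Let w0 := @weight_ge0 R J gs.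
Let wl := weight_lip dm ea.
Let bi := inv_branch_in fb.
Let bl := inv_branch_lip dm ea.
Let ws := weight_sum ea.

Let L_lin (k l : R) u v x : dlip d u -> dlip d v -> X x ->
  L (fun x => k * u x + l * v x) x = k * L u x + l * L v x.
Proof. exact: (ruelle_lin d_ge0 d_le1 w0 bi ws). Qed.

Let L_ext u v x : (forall x, X x -> u x = v x) -> X x -> L u x = L v x.
Proof. exact: (ruelle_ext _ bi). Qed.

Let L_cone (c : R) u : 0 < c -> cone d c u -> cone d (G + c * gamma^-1) (L u).
Proof. exact: (ruelle_cone d_ge0 d_le1 d_sym d_gt0 w0 wl bi bl ws). Qed.

Let L_dlip u : dlip d u -> dlip d (L u).
Proof. exact: (ruelle_dlip d_ge0 d_le1 d_sym d_gt0 G0 r_ge0 w0 wl bi bl ws). Qed.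

Let L_h x : X x -> L h0 x = h0 x.
Proof. exact: (ruelle_density dm fb ea gd). Qed.

Let dmeas := dlip_measurable dm.
Let mT := measurable_borel_map fb.
Let T_in := borel_map_in fb.
Let dual0 := ge0_transfer_duality dm fb ea.

(** Outside this set the orbits of [T] and of its Borel version coincide. It is built from the Borel
    version so as to be measurable. *)
Definition bad_set : set R := \bigcup_k (U `&` (iter k Tt) @^-1` (exceptional a b)).

Let mbad_k k : measurable (U `&` (iter k Tt) @^-1` (exceptional a b)).
Proof.
apply: measurableI => //.
have mk : measurable_fun [set: R] (iter k Tt).
  by elim: k => [|k IH]; [exact: measurable_id|exact: (measurableT_comp mT IH)].
by have := mk measurableT _ (measurable_exceptional a b); rewrite setTI.
Qed.

Lemma measurable_bad_set : measurable bad_set.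
Proof. by apply: bigcupT_measurable => k; exact: mbad_k. Qed.

Lemma bad_set_null : mu bad_set = 0%E.
Proof.
have null k : mu (U `&` (iter k Tt) @^-1` (exceptional a b)) = 0%E.
  elim: k => [|k IH].
    apply: (@subset_measure0 _ _ _ mu _ (exceptional a b) (mbad_k 0) (measurable_exceptional a b)).
    - by move=> x [].
    - exact: (exceptional_null fb).
  have mB := mbad_k k.
  have mP : measurable (U `&` Tt @^-1` (U `&` (iter k Tt) @^-1` (exceptional a b))).
    by apply: measurableI => //; have := mT measurableT mB; rewrite setTI.
  apply: (@subset_measure0 _ _ _ mu _ _ (mbad_k k.+1) mP).
    by move=> x [Xx]; rewrite /= -iterS iterSr => xk; split => //; split => //; exact: T_in.
  exact: (null_preimage d_ge0 d_le1 dmeas L_dlip mT dual0).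
apply/negligibleP; first exact: measurable_bad_set.
by apply: negligible_bigcup => k; apply/negligibleP; [exact: mbad_k|exact: null].
Qed.

Lemma iter_borel_map k x : X x -> ~ bad_set x -> iter k T x = iter k Tt x.
Proof.
move=> Xx xbad; have Xk m : X (iter m Tt x) by elim: m => //= m IH; exact: T_in.
elim: k => //= k ->; rewrite /borel_map patchT//; apply/mem_set.
by apply: contrapT => xD; apply: xbad; exists k => //; split => //; split => //; exact: Xk.
Qed.

Lemma birkhoff_cut_sum n x : X x -> ~ bad_set x -> birkhoff_sum T f n x = S n x.
Proof.
move=> Xx xbad; rewrite (cut_sumE T_in)//; apply: eq_bigr => k _.
by rewrite iter_borel_map.
Qed.

Definition gibbs_pdf : R -> R := h0 \_ U.

Lemma gibbs_pdfE x : X x -> gibbs_pdf x = h0 x.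
Proof. by move=> Xx; rewrite /gibbs_pdf patchT// mem_set. Qed.

Lemma gibbs_pdf_out x : ~ U x -> gibbs_pdf x = 0.
Proof. by move=> Xx; rewrite /gibbs_pdf /patch memNset. Qed.

Lemma pdensity_gibbs : pdensity gibbs_pdf.
Proof.
split.
- move=> x; rewrite /gibbs_pdf /patch; case: ifPn => // /set_mem Ux.
  by rewrite ltW//; exact: (density_gt0 gd).
- by apply/(measurable_restrict _ mU measurableT); rewrite setTI; exact: dmeas.
- rewrite -(density_mass gd) [RHS]integral_mkcond; apply: eq_integral => x _.
  by rewrite /gibbs_pdf /patch; case: ifP.
Qed.

Lemma wmean_gibbs v : wmean gibbs_pdf v = uint (fun x => h0 x * v x).
Proof.
rewrite /wmean /uint /Rintegral [in RHS]integral_mkcond; congr fine.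
apply: eq_integral => x _; rewrite /gibbs_pdf /patch.
by case: ifP => _; rewrite ?mulr0// mulrC.
Qed.

Let gS n := gmeas_cut_sum d_ge0 d_le1 dmeas mT fdl n.

(** The event built from [T] need not be Borel; it differs from the Borel one inside [bad_set] only,
    and [integral_null_eq] identifies the two integrals. *)
Lemma gibbs_measureE n (r x : R) :
  gibbs_measure h0 [set y | birkhoff_sum T f n y / r <= x] =
  (wcdf gibbs_pdf (fun y => S n y / r) x)%:E.
Proof.
have [mS _] := gS n; have [p0 mp p1] := pdensity_gibbs.
have mW : measurable_fun [set: R] (fun y => S n y / r) by exact: measurable_funM.
have mv := measurable_le_nat x mW.
rewrite /wcdf /wmean /Rintegral fineK; last first.
  apply: integrable_fin_num => //; apply: (wmean_integrable (M := 1)) => //.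
    by move=> y; rewrite normr_nat lern1; case: (_ <= _).
rewrite /gibbs_measure [LHS]integral_mkcond.
refine (@integral_null_eq _ _ R mu _ _ _ measurable_bad_set bad_set_null _ _ _ _).
- move=> y; rewrite /patch; case: ifPn => // /set_mem[Uy _].
  by rewrite lee_fin ltW//; exact: (density_gt0 gd).
- by move=> y; rewrite lee_fin mulr_ge0.
- by apply/measurable_EFinP; exact: measurable_funM.
move=> y ybad; rewrite /patch; have [Uy|Uy] := pselect (U y).
  rewrite gibbs_pdfE// -birkhoff_cut_sum//.
  have [le|gt] := boolP (birkhoff_sum T f n y / r <= x).
    by rewrite mem_set// mul1r.
  by rewrite memNset ?mul0r// => -[_ /= h]; rewrite h in gt.
by rewrite gibbs_pdf_out// mulr0 memNset// => -[].
Qed.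

Lemma gibbs_variance n :
  gibbs_expectation h0 (fun y => (birkhoff_sum T f n y ^+ 2)%R) =
  (uint (fun x => S n x ^+ 2 * h0 x))%:E.
Proof.
have [mS [M SM]] := gS n; have [p0 mp p1] := pdensity_gibbs.
have bS : bmeas (fun x => S n x ^+ 2 * h0 x).
  apply: bmeasM; last exact: (dlip_bmeas d_ge0 d_le1 dmeas).
  by apply: gmeas_bmeas; apply: gmeasM; exact: gS.
rewrite -uint_fin// /gibbs_expectation integral_mkcond [RHS]integral_mkcond.
refine (@integral_null_eq _ _ R mu _ _ _ measurable_bad_set bad_set_null _ _ _ _).
- move=> y; rewrite /patch; case: ifPn => // /set_mem Uy.
  by rewrite lee_fin mulr_ge0 ?sqr_ge0// ltW//; exact: (density_gt0 gd).
- move=> y; rewrite /patch; case: ifPn => // /set_mem Uy.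
  by rewrite lee_fin mulr_ge0 ?sqr_ge0// ltW//; exact: (density_gt0 gd).
- apply/(measurable_restrict _ mU measurableT); rewrite setTI.
  by apply/measurable_EFinP; have [] := bS.
move=> y ybad; rewrite /patch; case: ifPn => // /set_mem Uy.
by rewrite birkhoff_cut_sum.
Qed.

Let nf := fine (sup_norm f).
Let lf := fine (lip_seminorm d f).

Let f_le x : X x -> `|f x| <= nf. Proof. by move=> Xx; exact: (sup_normP dm). Qed.
Let f_lip x y : X x -> X y -> `|f x - f y| <= lf * d x y.
Proof. exact: (lipschitz_le dm). Qed.
Let nf0 : 0 <= nf.
Proof. by apply: le_trans (f_le (x := 0) _) => //; rewrite in_itv/= lexx ler01. Qed.
Let lf0 : 0 <= lf. Proof. by apply: fine_ge0; exact: (lip_seminorm_ge0 dm). Qed.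

Hypothesis f_mean : gibbs_expectation h0 f = 0%E.
Variable sigma : R.
Hypothesis sigma_gt0 : 0 < sigma.
Hypothesis sigma_lim :
  ((n%:R^-1)%:E * gibbs_expectation h0 (fun y => (birkhoff_sum T f n y ^+ 2)%R))%E
    @[n --> \oo] --> (sigma ^+ 2)%:E.

Let bfh : bmeas (fun x => f x * h0 x).
Proof. by apply: bmeasM; exact: (dlip_bmeas d_ge0 d_le1 dmeas). Qed.

Let I_fh : uint (fun x => f x * h0 x) = 0.
Proof. by apply/EFin_inj; rewrite -uint_fin//. Qed.

Let I_h : uint h0 = 1.
Proof.
apply/EFin_inj; rewrite -uint_fin; last exact: (dlip_bmeas d_ge0 d_le1 dmeas).
exact: (density_mass gd).
Qed.

Let I_lin (k l : R) u v : dlip d u -> dlip d v ->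
  uint (fun x => k * u x + l * v x) = k * uint u + l * uint v.
Proof. by move=> ul vl; apply: uint_lin; exact: (dlip_bmeas d_ge0 d_le1 dmeas). Qed.

Let I_le u v : dlip d u -> dlip d v -> (forall x, X x -> u x <= v x) -> uint u <= uint v.
Proof. by move=> ul vl; apply: uint_le; exact: (dlip_bmeas d_ge0 d_le1 dmeas). Qed.

Let I_L u : dlip d u -> uint (L u) = uint u.
Proof.
move=> ul; have := transfer_duality d_ge0 d_le1 dmeas L_lin L_dlip mT dual0 ul (gmeas_cst 1).
move=> e; transitivity (uint (fun x => L u x * 1)).
  by apply: eq_uint => x _; rewrite mulr1.
by rewrite -e; apply: eq_uint => x _; rewrite mulr1.
Qed.

Let v_lim : m%:R^-1 * \sum_(0 <= k < m) partial_var h0 L uint f k @[m --> \oo] --> sigma ^+ 2.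
Proof.
have e n : ((n%:R^-1)%:E * gibbs_expectation h0 (fun y => (birkhoff_sum T f n y ^+ 2)%R) =
    (n%:R^-1 * \sum_(0 <= k < n) partial_var h0 L uint f k)%:E)%E.
  rewrite gibbs_variance EFinM; congr (_ * _%:E)%E.
  exact: (uint_cut_sum_sqr d_ge0 d_le1 dmeas L_lin L_dlip mT dual0 fdl L_ext hdl L_h).
by move: sigma_lim; under eq_fun do rewrite e; move/fine_cvg.
Qed.

Let A0 := cone_a0 gamma G.
Let A1 := cone_a1 gamma G.
Let Aa := cone_a gamma G.
Let Ab := cone_b gamma G.
Let Q := cone_Q gamma G.
Let B := Num.max (1 + 2 * G) 2.
Let F := nf + lf.
Let A := B / (1 - (Q - 1) / (Q + 1)).
Let k := nf * F ^+ 2 * A ^+ 2.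
Let g0 : gamma != 0. Proof. by rewrite gt_eqF. Qed.
Let g1 : gamma - 1 != 0. Proof. by rewrite gt_eqF// subr_gt0. Qed.
Let g1' : 0 < gamma - 1. Proof. by rewrite subr_gt0. Qed.

Let BE : B = 2 \/ B = 1 + 2 * G.
Proof. by rewrite /B; case: (leP (1 + 2 * G) 2) => _; [left|right]. Qed.

Let A0_gt0 : 0 < A0. Proof. by rewrite /A0 /cone_a0 divr_gt0// mulr_gt0. Qed.
Let A01 : A0 <= A1.
Proof.
rewrite -subr_ge0 (_ : A1 - A0 = (gamma * (gamma - 1))^-1).
  by rewrite invr_ge0 mulr_ge0// ltW.
by rewrite /A1 /A0 /cone_a1 /cone_a0; field; rewrite g0 g1.
Qed.
Let A1a : A1 < Aa.
Proof.
rewrite -subr_gt0 (_ : Aa - A1 = gamma^-1) ?invr_gt0//.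
by rewrite /A1 /Aa /cone_a1 /cone_a; field; rewrite g0 g1.
Qed.
Let Aab : Aa <= Ab.
Proof.
rewrite -subr_ge0 (_ : Ab - Aa = 1) ?ler01//.
by rewrite /Ab /Aa /cone_b /cone_a; field; rewrite g1.
Qed.
Let Ab0E : Ab - A0 = gamma / (gamma - 1).
Proof. by rewrite /Ab /A0 /cone_b /cone_a0; field; rewrite g1. Qed.
Let Ab0 : 1 <= Ab - A0.
Proof. by rewrite Ab0E ler_pdivlMr// mul1r gerBl. Qed.
Let GA0 : A0 <= G * (Ab - A0).
Proof. by rewrite Ab0E /A0 /cone_a0; apply: le_of_eq; field; rewrite g1. Qed.

Let h_cone : cone d A0 h0.
Proof.
have -> : A0 = G / (1 - gamma^-1).
  rewrite /A0 /cone_a0; field; rewrite g0 g1/=.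
  done.
exact: (density_cone dm fb ea gd).
Qed.

Let L_cone_a v : cone d Aa v -> cone d A1 (L v).
Proof.
move=> vc; have -> : A1 = G + Aa * gamma^-1.
  by rewrite /A1 /Aa /cone_a1 /cone_a; field; rewrite g0 g1.
by apply: L_cone => //; exact: lt_trans (lt_le_trans A0_gt0 A01) A1a.
Qed.

Let L_cone_b v : cone d Ab v -> cone d Aa (L v).
Proof.
move=> vc; have -> : Aa = G + Ab * gamma^-1.
  by rewrite /Ab /Aa /cone_b /cone_a; field; rewrite g0 g1.
by apply: L_cone => //; exact: lt_le_trans (lt_trans (lt_le_trans A0_gt0 A01) A1a) Aab.
Qed.

Let h_pos x : X x -> 0 < h0 x. Proof. exact: (density_gt0 gd). Qed.
Let B2 : 2 <= B. Proof. by rewrite /B le_max lexx orbT. Qed.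
Let BG : 1 + 2 * G <= B. Proof. by rewrite /B le_max lexx. Qed.

Let char_bound n t : 0 <= t -> 40 * k * t <= sigma ^+ 2 ->
  cabs ((wmean gibbs_pdf (fun w => cos (t * S n w)) +i*
         wmean gibbs_pdf (fun w => sin (t * S n w)))%C -
        (expR (- (n%:R * (sigma ^+ 2 * t ^+ 2 / 2))))%:C%C) <=
  11 / 10 * expR (- (n%:R * (sigma ^+ 2 * t ^+ 2 / 4))) *
    (n%:R * (11 * k * t ^+ 3) + nf * F * A ^+ 2 * t ^+ 2).
Proof.
move=> t0 tk; have v0 : 0 < sigma ^+ 2 by exact: exprn_gt0.
have hc : cdlip d (fun x => (h0 x)%:C%C) by exact: cdlip_real.
have := cI_twist_bound d_ge0 d_le1 d_sym d_gt0 (ltW G0) A0_gt0 A01 A1a Aab Ab0 GA0 h_cone h_pos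
  L_lin L_ext L_h L_cone_a L_cone_b I_lin I_le I_h I_L nf0 lf0 f_le f_lip I_fh B2 BG n v0 t0 v_lim tk.
rewrite (iter_twist_char d_ge0 d_le1 dmeas L_lin L_dlip mT dual0 fdl d_sym)//.
rewrite !wmean_gibbs /cI.
have -> : uint (fun x => complex.Re ((h0 x)%:C%C * cis (t * S n x))) = uint (fun x => h0 x * cos (t * S n x)).
  by apply: eq_uint => x _; rewrite complexReM /= mul0r subr0.
have -> : uint (fun x => complex.Im ((h0 x)%:C%C * cis (t * S n x))) = uint (fun x => h0 x * sin (t * S n x)).
  by apply: eq_uint => x _; rewrite complexImM /= mul0r addr0.
exact.
Qed.

Let v_le : sigma ^+ 2 <= 9 / 2 * nf * F * A.
Proof.
have cv := partial_var_cvg d_ge0 d_le1 d_sym d_gt0 (ltW G0) A0_gt0 A01 A1a Aab Ab0 GA0 h_cone h_pos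
  L_lin L_ext L_h L_cone_a L_cone_b I_lin I_le I_h I_L nf0 lf0 f_le f_lip I_fh B2 BG v_lim.
exact: (partial_var_lim_le d_ge0 d_le1 d_sym d_gt0 (ltW G0) A0_gt0 A01 A1a Aab Ab0 GA0 h_cone h_pos
  L_lin L_ext L_h L_cone_a L_cone_b I_lin I_le I_h I_L nf0 lf0 f_le f_lip I_fh B2 BG cv).
Qed.

Let A_sqr : A ^+ 2 <= 16 * cosh (D_R gamma G / 4) ^+ 6.
Proof. exact: (contraction_cosh gamma1 G0 BE). Qed.

Let A_gt0 : 0 < A.
Proof.
have Q0 : 0 < Q := cone_Q_gt0 gamma1 G0.
rewrite /A divr_gt0//; first by apply: lt_le_trans B2.
by rewrite subr_gt0 ltr_pdivrMr ?mul1r; lra.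
Qed.

(** By [v_le], an observable of zero norm would have zero variance. *)
Let nf_gt0 : 0 < nf.
Proof.
rewrite lt_neqAle nf0 andbT; apply/eqP => e.
have := v_le; rewrite -e mulr0 !mul0r => v0.
by have := lt_le_trans (exprn_gt0 2 sigma_gt0) v0; rewrite ltxx.
Qed.

Let F_ge : nf <= F. Proof. by rewrite /F lerDl. Qed.

Let S_integrable n :
  mu.-integrable [set: R] (EFin \o (fun w => S n w * gibbs_pdf w)).
Proof. by have [mS [M SM]] := gS n; exact: (wmean_integrable pdensity_gibbs mS SM). Qed.

Lemma gibbs_berry_esseen (x : R) (n : nat) : (0 < n)%N ->
  `|wcdf gibbs_pdf (fun y => S n y / (sigma * Num.sqrt n%:R)) x - std_normal_cdf x| <=
  11460 * (cosh (D_R gamma G / 4) ^+ 6 * nf * F ^+ 2 / (sigma ^+ 3 * Num.sqrt n%:R)).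
Proof.
move=> n0; have [mS _] := gS n.
(* If the right side is at least [1], the bound holds because both distribution functions lie in
   [[0, 1]]; otherwise [berry_esseen_arith] has its smallness hypothesis. *)
have [small|big] := ltP (11460 * (cosh (D_R gamma G / 4) ^+ 6 * nf * F ^+ 2 /
    (sigma ^+ 3 * Num.sqrt n%:R))) 1; last first.
  apply: le_trans big.
  have mW : measurable_fun [set: R] (fun y => S n y / (sigma * Num.sqrt n%:R)).
    exact: measurable_funM.
  have mg : measurable_fun [set: R] (fun y : R => 1 * y) by exact: measurable_funM.
  have /andP[l1 u1] := wcdf_bounds x pdensity_gibbs mW.
  have /andP[l2 u2] := wcdf_bounds (1 * x) pdensity_gauss mg.
  by rewrite wcdf_gauss// in l2 u2; rewrite ler_norml; lra.
have F0 : 0 < F := lt_le_trans nf_gt0 F_ge.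
have k0 : 0 < k by apply: mulr_gt0; [apply: mulr_gt0 => //; exact: exprn_gt0|exact: exprn_gt0].
have c0 : 0 <= nf * F * A ^+ 2 by apply: mulr_ge0; [apply: mulr_ge0; exact: ltW|exact: sqr_ge0].
have r0 : 0 < Num.sqrt n%:R :> R by rewrite sqrtr_gt0 ltr0n.
have := berry_esseen_of_char pdensity_gibbs mS (S_integrable n) sigma_gt0 k0 c0 n0 (@char_bound n) x.
move=> /le_trans; apply.
have {2}-> : n%:R = Num.sqrt n%:R ^+ 2 :> R by rewrite sqr_sqrtr.
exact: berry_esseen_arith.
Qed.

End GibbsLaw.

Theorem theorem1p1 (R : realType) (J : countType) (d : R -> R -> R)
    (T : R -> R) (a b : J -> R) (sigma_ gs : J -> R -> R) (gamma G : R)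
    (h0 f : R -> R) (sigma : R) :
  compatible_metric d ->
  full_branch_map T a b sigma_ gs ->
  expanding_assumptions d sigma_ gs gamma G ->
  gibbs_density d sigma_ gs h0 ->
  is_lipschitz d f ->
  gibbs_expectation h0 f = 0%E ->
  ((n%:R^-1)%:E * gibbs_expectation h0 (fun y => (birkhoff_sum T f n y ^+ 2)%R))%E
    @[n --> \oo] --> (sigma ^+ 2)%:E ->
  0 < sigma ->
  forall (x : R) (n : nat), (1 <= n)%N ->
  `| fine (gibbs_measure h0
       [set y | birkhoff_sum T f n y / (sigma * Num.sqrt n%:R) <= x])
     - std_normal_cdf x |
  <= 11460 *
     (cosh (D_R gamma G / 4) ^+ 6 * fine (sup_norm f) *
        (fine (sup_norm f) + fine (lip_seminorm d f)) ^+ 2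
      / (sigma ^+ 3 * Num.sqrt n%:R)).
Proof.
move=> dm fb ea gd fl fm sl s0 x n n0.
rewrite (gibbs_measureE dm fb ea gd fl).
exact: (gibbs_berry_esseen dm fb ea gd fl fm s0 sl).
Qed.
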